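(* Let $u\in\mathbb S^{n-1}$ and $g\in\mathcal K_1(\mathbb R)$. The directional short-time Fourier transform $$DS_{g,u}:\ \mathcal K_1'(\mathbb R^n)\to\mathcal K_1'(\mathbb R)\widehat\otimes\,\mathcal U'(\mathbb C^n),\qquad \langle DS_{g,u}f,\Phi\rangle:=\langle f,DS^*_{\overline g,u}\Phi\rangle,\quad \Phi\in\mathcal K_1(\mathbb R)\widehat\otimes\,\mathcal U(\mathbb C^n),$$ and the directional synthesis operator $$DS^*_{g,u}:\ \mathcal K_1'(\mathbb R)\widehat\otimes\,\mathcal U'(\mathbb C^n)\to\mathcal K_1'(\mathbb R^n),\qquad \langle DS^*_{g,u}F,\varphi\rangle:=\langle F,DS_{\overline g,u}\varphi\rangle,\quad \varphi\in\mathcal K_1(\mathbb R^n),$$ are continuous linear maps (for the strong dual topologies).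
   Context: $\mathbb S^{n-1}$ is the unit sphere of $\mathbb R^n$. $\mathcal K_1(\mathbb R^n)$ is the space of $\varphi\in C^\infty(\mathbb R^n)$ for which all norms $\rho_k(\varphi)=\sup_{t\in\mathbb R^n,\,|\alpha|\le k}e^{k|t|}|\varphi^{(\alpha)}(t)|$, $k\in\mathbb N_0$, are finite, topologized by these norms; $\mathcal K_1'(\mathbb R^n)$ is its dual. $\mathcal U(\mathbb C^n)$ is the space of entire functions $\varphi$ on $\mathbb C^n$ with $\theta_k(\varphi)=\sup_{z\in\Pi_k}(1+|z|^2)^{k/2}|\varphi(z)|<\infty$ for all $k\in\mathbb N_0$, where $\Pi_k=\mathbb R^n+i[-k,k]^n$, topologized by these norms; $\mathcal U'(\mathbb C^n)$ is its dual. $\mathcal K_1(\mathbb R)\widehat\otimes\,\mathcal U(\mathbb C^n)$ is the completion of the tensor product in the $\pi$-topology (equivalently the $\varepsilon$-topology); it consists of functions $\Phi(x,z)$, smooth in $x\in\mathbb R$ and entire in $z\in\mathbb C^n$, with topology given by the norms $\rho^l_k(\Phi)=\sup_{(x,z)\in\mathbb R\times\Pi_k}e^{k|x|}(1+|z|^2)^{k/2}|\partial_x^l\Phi(x,z)|$, $k,l\in\mathbb N_0$. Its dual is $(\mathcal K_1(\mathbb R)\widehat\otimes\,\mathcal U(\mathbb C^n))'=\mathcal K_1'(\mathbb R)\widehat\otimes\,\mathcal U'(\mathbb C^n)$. On test functions, for $\varphi\in\mathcal K_1(\mathbb R^n)$, $\Phi\in\mathcal K_1(\mathbb R)\widehat\otimes\,\mathcal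 U(\mathbb C^n)$ and $h\in\mathcal K_1(\mathbb R)$, $$DS_{h,u}\varphi(x,z)=\int_{\mathbb R^n}\varphi(t)\overline{h(u\cdot t-x)}e^{-2\pi i t\cdot z}dt,\qquad DS^*_{h,u}\Phi(t)=\int_{\mathbb R^n}\int_{\mathbb R}\Phi(x,\xi)h(u\cdot t-x)e^{2\pi i\xi\cdot t}dx\,d\xi .$$ *)

(* Defs.v *)
From HB Require Import structures.
From mathcomp Require Import all_boot all_order all_algebra.
From mathcomp Require Import complex.
From mathcomp Require Import all_classical all_reals all_analysis.

Set Implicit Arguments.
Unset Strict Implicit.
Unset Printing Implicit Defensive.

Import Order.TTheory GRing.Theory Num.Theory.
Import numFieldNormedType.Exports.

Local Open Scope classical_set_scope.
Local Open Scope ring_scope.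
Local Open Scope complex_scope.

Section strong_dual.
Context (K : numFieldType).

(* Von Neumann boundedness: absorbed by every neighbourhood of the origin. *)
Definition vN_bounded (E : preTopologicalLmodType K) : set (set E) :=
  [set B | forall U : set E, nbhs 0 U ->
    exists2 r : K, 0 < r &
      forall c : K, r <= `|c| -> B `<=` [set c *: x | x in U]].

Definition continuous_scalar (E : preTopologicalLmodType K) : {pred E -> K^o} :=
  mem [set f : E -> K^o | scalar f /\ continuous f].
Arguments continuous_scalar : clear implicits.

Record dual (E : preTopologicalLmodType K) := Dual {
  dual_fun :> E -> K^o ;
  dual_funP : dual_fun \in continuous_scalar E }.

Context (E : preTopologicalLmodType K).

Lemma continuous_scalar_submod_closed : submod_closed (continuous_scalar E).
Proof.
split=> [|a f g].
  rewrite inE; split; last exact: cst_continuous.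
  by move=> a x y /=; rewrite [RHS]addr0 [RHS]mulr0.
rewrite !inE => -[lf cf] [lg cg]; split.
  move=> b x y; rewrite !fctE lf lg /GRing.scale/=.
  by rewrite !mulrDr addrACA mulrCA.
move=> x; apply: (@cvgD K K^o _ (nbhs x)); last exact: cg.
apply: (@cvgZl_tmp K K^o _ (nbhs x)); exact: cf.
Qed.

HB.instance Definition _ :=
  GRing.isSubmodClosed.Build _ _ (continuous_scalar E)
    continuous_scalar_submod_closed.
HB.instance Definition _ := [isSub for @dual_fun E].
HB.instance Definition _ := [Choice of dual E by <:].
HB.instance Definition _ := [SubChoice_isSubLmodule of dual E by <:].

(* The strong topology: uniform convergence on the bounded subsets of E. *)
HB.instance Definition _ := Topological.copy (dual E)
  (initial_topology
     (fun f : dual E => (f : E -> K^o) : {family @vN_bounded E, E -> K^o})).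

End strong_dual.

Section seminorm_topology.
Context (R : realType) (E : zmodType) (I : eqType) (p : I -> E -> \bar R).

(* Open sets of the topology generated by the family p of (semi)norms. *)
Definition seminorm_open : set_system E :=
  [set U | forall x, U x -> exists (s : seq I) (e : R), 0 < e /\
     [set y | forall i, i \in s -> (p i (y - x)%R < e%:E)%E] `<=` U].

Lemma seminorm_openT : seminorm_open setT.
Proof. by move=> x _; exists [::], 1; split. Qed.

Lemma seminorm_openI : setI_closed seminorm_open.
Proof.
move=> A B oA oB x [/oA[s [e [e0 sA]]] /oB[t [d [d0 tB]]]].
exists (s ++ t), (Num.min e d); split; first by rewrite lt_min e0.
move=> y ysd; split.
  apply: sA => i si; apply: (lt_le_trans (ysd i _)).
    by rewrite mem_cat si.
  by rewrite lee_fin ge_min lexx.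
apply: tB => i ti; apply: (lt_le_trans (ysd i _)).
  by rewrite mem_cat ti orbT.
by rewrite lee_fin ge_min lexx orbT.
Qed.

Lemma seminorm_open_bigU (J : Type) (F : J -> set E) :
  (forall j, seminorm_open (F j)) -> seminorm_open (\bigcup_j F j).
Proof.
move=> oF x [j _ /oF[s [e [e0 sF]]]]; exists s, e; split => // y /sF Fy.
by exists j.
Qed.

End seminorm_topology.

Section real_partial_derivatives.
Context (R : realType) (n : nat).
Implicit Types f g : 'rV[R]_n -> R.

Definition partial (i : 'I_n) f : 'rV[R]_n -> R :=
  fun t => 'D_(delta_mx 0 i) f t.

Fixpoint Ck (k : nat) f : Prop :=
  continuous f /\
  match k with
  | 0 => True
  | k.+1 => forall i,
      (forall t, derivable f t (delta_mx 0 i)) /\ Ck k (partial i f)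
  end.

Definition Cinfty f := forall k, Ck k f.

(* The derivative of order alpha_i in the variable t_i, for every i. *)
Definition multi_partial (alpha : {ffun 'I_n -> nat}) f : 'rV[R]_n -> R :=
  foldr (fun i => iter (alpha i) (partial i)) f (enum 'I_n).

End real_partial_derivatives.

Section linear_combinations.
Context (R : realType).

Lemma partialL n (i : 'I_n) (a : R) (f g : 'rV[R]_n -> R) :
  (forall t, derivable f t (delta_mx 0 i)) ->
  (forall t, derivable g t (delta_mx 0 i)) ->
  partial i (a *: f + g) = a *: partial i f + partial i g.
Proof.
move=> df dg; apply/funext => t; rewrite /partial deriveD//; last exact: derivableZ.
by rewrite deriveZ.
Qed.

Lemma CkL n k (a : R) (f g : 'rV[R]_n -> R) :
  Ck k f -> Ck k g -> Ck k (a *: f + g).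
Proof.
have cL (p q : 'rV[R]_n -> R) :
    continuous p -> continuous q -> continuous (a *: p + q).
  move=> cp cq x; apply: (@cvgD R R^o _ (nbhs x)); last exact: cq.
  by apply: (@cvgZl_tmp R R^o _ (nbhs x)); exact: cp.
elim: k f g => [|k ih] f g /= [cf pf] [cg pg]; split=> //; try exact: cL.
move=> i; have [df kf] := pf i; have [dg kg] := pg i; split.
  by move=> t; apply: derivableD => //; exact: derivableZ.
by rewrite partialL//; exact: ih.
Qed.

Lemma CinftyL n (a : R) (f g : 'rV[R]_n -> R) :
  Cinfty f -> Cinfty g -> Cinfty (a *: f + g).
Proof. by move=> cf cg k; exact: CkL. Qed.

Lemma Cinfty_partial n (i : 'I_n) (f : 'rV[R]_n -> R) :
  Cinfty f -> Cinfty (partial i f).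
Proof. by move=> cf k; have [_ /(_ i)[]] := cf k.+1. Qed.

Lemma Cinfty_derivable n (i : 'I_n) (f : 'rV[R]_n -> R) :
  Cinfty f -> forall t, derivable f t (delta_mx 0 i).
Proof. by move=> cf; have [_ /(_ i)[]] := cf 1%N. Qed.

Lemma iter_partialL n (i : 'I_n) m (a : R) (f g : 'rV[R]_n -> R) :
  Cinfty f -> Cinfty g ->
  [/\ Cinfty (iter m (partial i) f), Cinfty (iter m (partial i) g) &
  iter m (partial i) (a *: f + g) =
  a *: iter m (partial i) f + iter m (partial i) g].
Proof.
move=> cf cg; elim: m => [//|m [ihf ihg ih]]; split => /=.
- exact: Cinfty_partial.
- exact: Cinfty_partial.
- by rewrite ih partialL//; exact: Cinfty_derivable.
Qed.

Lemma multi_partialL n (alpha : {ffun 'I_n -> nat}) (a : R)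
    (f g : 'rV[R]_n -> R) : Cinfty f -> Cinfty g ->
  multi_partial alpha (a *: f + g) =
  a *: multi_partial alpha f + multi_partial alpha g.
Proof.
move=> cf cg; rewrite /multi_partial.
suff: [/\ Cinfty (foldr (fun i => iter (alpha i) (partial i)) f (enum 'I_n)),
 Cinfty (foldr (fun i => iter (alpha i) (partial i)) g (enum 'I_n)) &
 foldr (fun i => iter (alpha i) (partial i)) (a *: f + g) (enum 'I_n) =
  a *: foldr (fun i => iter (alpha i) (partial i)) f (enum 'I_n) +
  foldr (fun i => iter (alpha i) (partial i)) g (enum 'I_n)] by case.
elim: (enum 'I_n) => [//|i s [ihf ihg ih]] /=.
by rewrite ih; exact: iter_partialL.
Qed.

Lemma Cinfty0 n : Cinfty (0 : 'rV[R]_n -> R).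
Proof.
move=> k; elim: k => [|k ih] /=; split=> //; try exact: cst_continuous.
move=> i; split; first by move=> t; exact: derivable_cst.
suff -> : partial i (0 : 'rV[R]_n -> R) = 0 by [].
by apply/funext => t; rewrite /partial derive_cst.
Qed.

End linear_combinations.

Section complex_functions.
Context (R : realType).
Local Notation C := R[i].

Definition ReF T (f : T -> C) : T -> R := fun x => complex.Re (f x).
Definition ImF T (f : T -> C) : T -> R := fun x => complex.Im (f x).

Definition cexp (z : C) : C :=
  (expR (complex.Re z) * cos (complex.Im z)) +i*
  (expR (complex.Re z) * sin (complex.Im z)).

Definition dot (F : pzRingType) n (x y : 'rV[F]_n) : F :=
  \sum_j x 0 j * y 0 j.

Definition enorm n (t : 'rV[R]_n) : R := Num.sqrt (\sum_j t 0 j ^+ 2).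

Definition sqnormc n (z : 'rV[C]_n) : R :=
  \sum_j ComplexField.Normc.normc (z 0 j) ^+ 2.

Definition toC n (t : 'rV[R]_n) : 'rV[C]_n := map_mx (fun x => x%:C) t.

Definition cCinfty n (f : 'rV[R]_n -> C) := Cinfty (ReF f) /\ Cinfty (ImF f).

Definition cmulti_partial n (alpha : {ffun 'I_n -> nat}) (f : 'rV[R]_n -> C) :
    'rV[R]_n -> C :=
  fun t => multi_partial alpha (ReF f) t +i* multi_partial alpha (ImF f) t.

Definition cderive1n l (f : R -> C) : R -> C :=
  fun x => derive1n l (ReF f) x +i* derive1n l (ImF f) x.

Definition cCinfty1 (f : R -> C) := forall l x,
  derivable (derive1n l (ReF f)) x 1 /\ derivable (derive1n l (ImF f)) x 1.

End complex_functions.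

Definition entire (K : numFieldType) n (f : 'rV[K]_n -> K) :=
  forall z, differentiable (f : 'rV[K]_n -> K^o) z.

Lemma entireL (K : numFieldType) n (a : K) (f g : 'rV[K]_n -> K) :
  entire f -> entire g -> entire (fun z => a * f z + g z).
Proof.
move=> ef eg z.
apply: (@differentiableD K _ K^o (fun z => a *: (f z : K^o)) g) => //.
by apply: (@differentiableZ K _ K^o f) => //; exact: ef.
Qed.

Section tuple_product_measure.
Context (R : realType) d (T : measurableType d).

Definition cons_pair n (x : T * n.-tuple T) : n.+1.-tuple T :=
  [the n.+1.-tuple T of x.1 :: x.2].

Lemma measurable_cons_pair n : measurable_fun setT (@cons_pair n).
Proof. by apply: measurable_cons. Qed.

Section pushforward_cons.
Context (nu : {sigma_finite_measure set T -> \bar R}).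
Context n (mu : {sigma_finite_measure set (n.-tuple T) -> \bar R}).

Definition cons_measure : set (n.+1.-tuple T) -> \bar R :=
  pushforward (nu \x mu)%E (@cons_pair n).

Let measurable_preimage B :
  measurable B -> measurable (@cons_pair n @^-1` B).
Proof.
by move=> mB; rewrite -[X in measurable X]setTI; exact: measurable_cons_pair.
Qed.

Let cons_measure0 : cons_measure set0 = 0%E.
Proof. by rewrite /cons_measure /pushforward preimage_set0 measure0. Qed.

Let cons_measure_ge0 A : (0 <= cons_measure A)%E.
Proof. by rewrite /cons_measure /pushforward measure_ge0. Qed.

Let cons_measure_sigma_additive : semi_sigma_additive cons_measure.
Proof.
move=> F mF tF mUF; rewrite /cons_measure /pushforward preimage_bigcup.
apply: measure_semi_sigma_additive.
- by move=> k; exact: measurable_preimage.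
- apply/trivIsetP => /= i j _ _ ij; rewrite -preimage_setI.
  by move/trivIsetP : tF => /(_ _ _ _ _ ij) ->//; rewrite preimage_set0.
- by rewrite -preimage_bigcup; exact: measurable_preimage.
Qed.

HB.instance Definition _ := isMeasure.Build _ _ _ cons_measure
  cons_measure0 cons_measure_ge0 cons_measure_sigma_additive.

Let cons_measure_sigma_finite : sigma_finite setT cons_measure.
Proof.
have /sigma_finiteP[F [TF ndF Foo]] := sigma_finiteT nu.
have /sigma_finiteP[G [TG ndG Goo]] := sigma_finiteT mu.
pose u (t : n.+1.-tuple T) : T * n.-tuple T := (thead t, [tuple of behead t]).
have mu_ : measurable_fun setT u.
  apply: measurable_fun_pair; last exact: measurable_behead.
  exact: measurable_tnth.
exists (fun i => u @^-1` (F i `*` G i)).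
  rewrite -preimage_bigcup (_ : \bigcup_i (F i `*` G i) = setT).
    by rewrite preimage_setT.
  rewrite -setXTT TF TG predeqE => -[x y]; split.
    by move=> [i _ []/= ? ?]; split; exists i.
  move=> [/= [i _ Fix] [j _ Gjy]]; exists (maxn i j) => //; split.
    by move: x Fix; exact/subsetPset/ndF/leq_maxl.
  by move: y Gjy; exact/subsetPset/ndG/leq_maxr.
move=> i; have [mFi Fioo] := Foo i; have [mGi Gioo] := Goo i; split.
  by rewrite -[X in measurable X]setTI; apply: mu_ => //; exact: measurableX.
rewrite /cons_measure /pushforward -comp_preimage.
rewrite (_ : u \o _ = id) ?preimage_id; last first.
  by apply/funext => -[x t] /=; congr pair; exact: val_inj.
by rewrite product_measure1E// lte_mul_pinfty// ge0_fin_numE.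
Qed.

HB.instance Definition _ := Measure_isSigmaFinite.Build _ _ _ cons_measure
  cons_measure_sigma_finite.

End pushforward_cons.

(* The n-fold product measure: the product of nu with the (n-1)-fold one,
   transported along (x, t) |-> x :: t. *)
Fixpoint tuple_measure (nu : {sigma_finite_measure set T -> \bar R}) n :
    {sigma_finite_measure set (n.-tuple T) -> \bar R} :=
  match n with
  | 0 => [the {sigma_finite_measure set (0.-tuple T) -> \bar R} of
           @dirac _ (0.-tuple T) [tuple] R]
  | m.+1 => [the {sigma_finite_measure set (m.+1.-tuple T) -> \bar R} of
           cons_measure nu (tuple_measure nu m)]
  end.

End tuple_product_measure.

Section complex_integrals.
Context (R : realType).

Definition cintegral d (T : measurableType d) (mu : {measure set T -> \bar R})
    (f : T -> R[i]) : R[i] :=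
  Rintegral mu setT (ReF f) +i* Rintegral mu setT (ImF f).

Definition integralR (f : R -> R[i]) : R[i] :=
  cintegral (@lebesgue_measure R) f.

Definition integralRn n (f : 'rV[R]_n -> R[i]) : R[i] :=
  cintegral (tuple_measure (@lebesgue_measure R) n)
    (fun t : n.-tuple (measurableTypeR R) => f (\row_j tnth t j)).

End complex_integrals.

Section test_functions.
Context (R : realType).
Local Notation C := R[i].
Local Notation normc := ComplexField.Normc.normc.

Lemma ereal_supL (X : Type) (A : set X) (w : X -> R) (a : C) (F G H : X -> C) :
  (forall x, 0 <= w x) -> (forall x, H x = a * F x + G x) ->
  (ereal_sup [set (w x * normc (F x))%:E | x in A] < +oo)%E ->
  (ereal_sup [set (w x * normc (G x))%:E | x in A] < +oo)%E ->
  (ereal_sup [set (w x * normc (H x))%:E | x in A] < +oo)%E.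
Proof.
move=> w0 HE.
set f := ereal_sup _ => foo; set g := ereal_sup _ => goo.
have [->|/set0P[x0 Ax0]] := eqVneq A set0; first by rewrite image_set0 ereal_sup0.
have fub x : A x -> ((w x * normc (F x))%:E <= f)%E.
  by move=> Ax; apply: ereal_sup_ubound; exists x.
have gub x : A x -> ((w x * normc (G x))%:E <= g)%E.
  by move=> Ax; apply: ereal_sup_ubound; exists x.
have ffin : f \is a fin_num.
  by rewrite fin_numElt foo (lt_le_trans _ (fub _ Ax0))// ltNyr.
have gfin : g \is a fin_num.
  by rewrite fin_numElt goo (lt_le_trans _ (gub _ Ax0))// ltNyr.
apply: (@le_lt_trans _ _ (normc a * fine f + fine g)%:E); last exact: ltry.
apply: ge_ereal_sup => _ [x Ax <-]; rewrite lee_fin HE.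
have := fub _ Ax; rewrite -(fineK ffin) lee_fin => fx.
have := gub _ Ax; rewrite -(fineK gfin) lee_fin => gx.
apply: (@le_trans _ _ (w x * (normc a * normc (F x) + normc (G x)))).
  rewrite ler_wpM2l// -ComplexField.Normc.normcM.
  exact: le_normcD.
rewrite mulrDr lerD// mulrCA ler_wpM2l//.
by case: (a) => ? ?; exact: sqrtr_ge0.
Qed.

Lemma ReFL T (a : C) (f g : T -> C) :
  ReF (a *: f + g) = complex.Re a *: ReF f + (- complex.Im a *: ImF f + ReF g).
Proof.
apply/funext => x; rewrite /ReF /ImF !fctE.
by case: a (f x) (g x) => [a b] [c d] [e h] /=; rewrite addrA [(- b) *: _]mulNr.
Qed.

Lemma ImFL T (a : C) (f g : T -> C) :
  ImF (a *: f + g) = complex.Re a *: ImF f + (complex.Im a *: ReF f + ImF g).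
Proof.
apply/funext => x; rewrite /ReF /ImF !fctE.
by case: a (f x) (g x) => [a b] [c d] [e h] /=; rewrite addrA.
Qed.

Lemma ComplexL (a : C) (b c d e : R) :
  (complex.Re a * b + (- complex.Im a * c + d)) +i*
  (complex.Re a * c + (complex.Im a * b + e)) = a * (b +i* c) + (d +i* e).
Proof.
case: a => a1 a2; apply/eqP; rewrite eq_complex /=.
by rewrite !addrA mulNr !eqxx.
Qed.

Section K1.
Context (n : nat).

Definition rho (k : nat) (phi : 'rV[R]_n -> C) : \bar R :=
  ereal_sup [set (expR (k%:R * enorm p.1) *
                  normc (cmulti_partial p.2 phi p.1))%:E |
             p in [set p : 'rV[R]_n * {ffun 'I_n -> nat} |
                   (\sum_i p.2 i <= k)%N]].

Definition K1_pred : {pred 'rV[R]_n -> C} :=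
  mem [set phi : 'rV[R]_n -> C |
       cCinfty phi /\ forall k, (rho k phi < +oo)%E].

Lemma K1_submod_closed : submod_closed K1_pred.
Proof.
split=> [|a f g].
  rewrite inE; split; first by split; exact: Cinfty0.
  move=> k; apply: (@le_lt_trans _ _ 0%E); last exact: ltry.
  apply: ge_ereal_sup => _ [[t al] _ <-]; rewrite lee_fin.
  rewrite [cmulti_partial _ _ _](_ : _ = 0).
    by rewrite ComplexField.Normc.normc0 mulr0.
  have m0 : multi_partial al (0 : 'rV[R]_n -> R) = 0.
    have := multi_partialL al (-1) (@Cinfty0 R n) (@Cinfty0 R n).
    by rewrite scaler0 addr0 scaleN1r addNr.
  by rewrite /cmulti_partial !m0.
rewrite !inE => -[[rf if_] nf] [[rg ig] ng]; split.
  by split; rewrite (ReFL, ImFL); do !apply: CinftyL.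
move=> k; apply: ereal_supL (nf k) (ng k); first by move=> ?; exact: expR_ge0.
move=> [t al] /=; rewrite /cmulti_partial ReFL ImFL.
rewrite !multi_partialL//; try by apply: CinftyL.
exact: ComplexL.
Qed.

HB.instance Definition _ :=
  GRing.isSubmodClosed.Build _ _ K1_pred K1_submod_closed.

Record K1 := MkK1 { K1_fun :> 'rV[R]_n -> C ; K1_funP : K1_fun \in K1_pred }.

HB.instance Definition _ := [isSub for K1_fun].
HB.instance Definition _ := [Choice of K1 by <:].
HB.instance Definition _ := [SubChoice_isSubLmodule of K1 by <:].

Definition K1_norm (k : nat) (phi : K1) : \bar R := rho k phi.

HB.instance Definition _ := isOpenTopological.Build K1
  (seminorm_openT K1_norm) (@seminorm_openI R _ _ K1_norm)
  (@seminorm_open_bigU R _ _ K1_norm).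

End K1.

(* KU n is the completed tensor product of K_1(R) and U(C^n), realised as the
   space of functions Phi(x, z), smooth in x and entire in z, for which all the
   norms rhoU (k, l) are finite; strip k is R^n + i[-k, k]^n. *)
Section KU.
Context (n : nat).

Definition strip (k : nat) : set 'rV[C]_n :=
  [set z | forall j, `|complex.Im (z 0 j)| <= k%:R].

Definition rhoU (kl : nat * nat) (Phi : R * 'rV[C]_n -> C) : \bar R :=
  ereal_sup [set (expR (kl.1%:R * `|p.1|) *
                  (1 + sqnormc p.2) `^ (kl.1%:R / 2) *
                  normc (cderive1n kl.2 (fun x => Phi (x, p.2)) p.1))%:E |
             p in [set p : R * 'rV[C]_n | strip kl.1 p.2]].

Definition KU_pred : {pred R * 'rV[C]_n -> C} :=
  mem [set Phi : R * 'rV[C]_n -> C |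
       [/\ forall z, cCinfty1 (fun x => Phi (x, z)),
           forall x, entire (fun z => Phi (x, z)) &
           forall kl, (rhoU kl Phi < +oo)%E]].

Lemma KU_submod_closed : submod_closed KU_pred.
Proof.
have d0 l : derive1n l (0 : R -> R) = 0.
  elim: l => [//|l ih]; rewrite derive1nS ih.
  by apply/funext => x; exact: derive1_cst.
split=> [|a f g].
  rewrite inE; split.
  - move=> z l x; rewrite [ReF _](_ : _ = 0)// [ImF _](_ : _ = 0)// d0.
    by split; exact: derivable_cst.
  - by move=> x z; exact: differentiable_cst.
  - move=> kl; apply: (@le_lt_trans _ _ 0%E); last exact: ltry.
    apply: ge_ereal_sup => _ [[x z] _ <-]; rewrite lee_fin.
    rewrite [cderive1n _ _ _](_ : _ = 0).
      by rewrite ComplexField.Normc.normc0 mulr0.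
    by rewrite /cderive1n [ReF _](_ : _ = 0)// [ImF _](_ : _ = 0)// !d0.
rewrite !inE => -[sf ef nf] [sg eg ng].
have L (c : R) (p q : R -> R) l :
    (forall l x, derivable (derive1n l p) x 1) ->
    (forall l x, derivable (derive1n l q) x 1) ->
    derive1n l (c *: p + q) = c *: derive1n l p + derive1n l q.
  move=> dp dq; elim: l => [//|l ih]; rewrite !derive1nS ih.
  apply/funext => x; rewrite !fctE !derive1E deriveD//; last exact: derivableZ.
  by rewrite deriveZ.
have dL (c : R) (p q : R -> R) :
    (forall l x, derivable (derive1n l p) x 1) ->
    (forall l x, derivable (derive1n l q) x 1) ->
    forall l x, derivable (derive1n l (c *: p + q)) x 1.
  by move=> dp dq l x; rewrite L//; apply: derivableD => //; exact: derivableZ.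
have rf z l x : derivable (derive1n l (ReF (fun x => f (x, z)))) x 1.
  by have [] := sf z l x.
have if_ z l x : derivable (derive1n l (ImF (fun x => f (x, z)))) x 1.
  by have [] := sf z l x.
have rg z l x : derivable (derive1n l (ReF (fun x => g (x, z)))) x 1.
  by have [] := sg z l x.
have ig z l x : derivable (derive1n l (ImF (fun x => g (x, z)))) x 1.
  by have [] := sg z l x.
have E z : (fun x => (a *: f + g) (x, z)) =
  a *: (fun x => f (x, z)) + (fun x => g (x, z)) by [].
split.
- by move=> z l x; rewrite E ReFL ImFL; split; apply: (dL) => //; apply: (dL).
- by move=> x; exact: (entireL a (ef x) (eg x)).
- move=> kl; apply: ereal_supL (nf kl) (ng kl).
    by move=> ?; rewrite mulr_ge0// ?expR_ge0// powR_ge0.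
  move=> [x z] /=; rewrite /cderive1n E ReFL ImFL.
  rewrite !L//; try by apply: (dL).
  exact: ComplexL.
Qed.

HB.instance Definition _ :=
  GRing.isSubmodClosed.Build _ _ KU_pred KU_submod_closed.

Record KU := MkKU {
  KU_fun :> R * 'rV[C]_n -> C ; KU_funP : KU_fun \in KU_pred }.

HB.instance Definition _ := [isSub for KU_fun].
HB.instance Definition _ := [Choice of KU by <:].
HB.instance Definition _ := [SubChoice_isSubLmodule of KU by <:].

Definition KU_norm (kl : nat * nat) (Phi : KU) : \bar R := rhoU kl Phi.

HB.instance Definition _ := isOpenTopological.Build KU
  (seminorm_openT KU_norm) (@seminorm_openI R _ _ KU_norm)
  (@seminorm_open_bigU R _ _ KU_norm).

End KU.

(* K_1(R) is the case n = 1, for functions on R instead of row vectors. *)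
Definition K1_line : {pred R -> C} :=
  mem [set g : R -> C | (fun t : 'rV[R]_1 => g (t 0 0)) \in @K1_pred 1].

Definition unit_sphere n : set 'rV[R]_n := [set u | enorm u = 1].

Definition twopii : C := 0 +i* (2 * pi).

(* The integrals are total: these are plain functions, whose membership in the
   test function spaces has to be proved. *)
Definition DS n (h : R -> C) (u : 'rV[R]_n) (phi : 'rV[R]_n -> C) :
    R * 'rV[C]_n -> C :=
  fun xz => integralRn (fun t =>
    phi t * conjc (h (dot u t - xz.1)) * cexp (- twopii * dot (toC t) xz.2)).

Definition DSstar n (h : R -> C) (u : 'rV[R]_n) (Phi : R * 'rV[C]_n -> C) :
    'rV[R]_n -> C :=
  fun t => integralRn (fun xi => integralR (fun x =>
    Phi (x, toC xi) * h (dot u t - x) * cexp (twopii * (dot xi t)%:C))).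

End test_functions.

(* Main.v *)
Require Import Defs.
From HB Require Import structures.
From mathcomp Require Import all_boot all_order all_algebra.
From mathcomp Require Import complex.
From mathcomp Require Import all_classical all_reals all_analysis.
From mathcomp Require Import measurable_realfun.
From mathcomp Require Import ring lra.

Import Order.TTheory GRing.Theory Num.Theory.
Import numFieldNormedType.Exports.

Local Open Scope classical_set_scope.
Local Open Scope ring_scope.

Set Implicit Arguments.
Unset Strict Implicit.
Unset Printing Implicit Defensive.

(** Both maps on the dual spaces are transposes.  The transpose of a continuous
linear map is continuous for the strong topologies, because a continuous linear
map sends bounded sets to bounded sets ([transpose_continuous]).  So the whole
content lies in the two maps between the spaces of test functions: they have to
be well defined, linear and continuous, that is, each seminorm of the image has
to be bounded by a constant times one seminorm of the argument.

The analysis map takes [phi] in K_1(R^n) to the integral of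
[phi(t) g(u.t - x) exp(-2 pi i t.z)] over [t].
- Its derivatives in [x] fall on [g], up to a sign ([cis_derive_dstft]).
- It is entire in [z] because the remainder [exp w - 1 - w] is quadratic in [w]
  up to exponential factors in [t], which the decay of [phi] absorbs
  ([entire_dstft]).
- The growth of [exp(-2 pi i t.z)] in a strip and the factor [exp(k|x|)] are
  absorbed by the decay of [phi] and [g], since [|x| <= |u.t| + |u.t - x|]
  ([DS_integrand_le]).
- The polynomial factor in [z] comes from integration by parts in [t]
  ([dstft_parts]).  It is enough to bound the pure powers [z_j ^ k], one [j] at
  a time ([poly_weight_le]); then only derivatives [d_j ^ m phi] occur, and
  partial derivatives in different variables never have to be interchanged.

The synthesis map takes [Phi] to the integral of
[Phi(x, xi) h(u.t - x) exp(2 pi i xi.t)] over [(x, xi)].  A derivative in [t_i]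
either falls on [h] or produces a factor [xi_i], which is absorbed into [Phi];
so the synthesis maps, together with all their derivatives, form a class that
is stable under partial derivatives ([synth_ops]), and it suffices to bound the
integral itself by [exp(- K |t|)].  This decay is due to analyticity: moving the
contour of the single variable [xi_j] to [xi_j + i s] multiplies the integrand
by [exp(- 2 pi s t_j)], where [s] has the sign of [t_j] and is as large as
wanted; choosing [j] with [|t_j|] maximal is enough, as [|t| <= n |t_j|]
([DSstar_decay]).  An entire function is here one that is differentiable at
every point, with no continuity of the derivative, so the contour is moved by
means of Goursat's lemma, which is proved by bisection ([goursat],
[integral_shift]).

All these integrals over R^n are controlled in the same way: the integrands are
continuous in each variable separately, which already makes them measurable
([sepcont_measurable]), and they are dominated by a multiple of the product of
the functions [1 / (1 + v_j ^ 2)].  Both conditions pass to sections, so Fubini's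
theorem reduces the vanishing of an integral over R^n to the vanishing of the
integrals over lines in one coordinate direction ([rint_slice0]); integration by
parts and the contour shift are both instances of this. *)

(** * Measurability of separately continuous functions *)

Section separately_continuous.
Context {R : realType}.

(** The function is the pointwise limit of its compositions with the rounding of
    [x] down to the grid of mesh [1 / m.+1]; such a composition takes only
    countably many values of [x], so it is measurable. *)
Lemma caratheodory_measurable d (T : measurableType d)
    (f : measurableTypeR R * T -> R) :
  (forall x, measurable_fun [set: T] (fun y => f (x, y))) ->
  (forall y, continuous (fun x : R => f (x, y))) ->
  measurable_fun [set: measurableTypeR R * T] f.
Proof.
move=> mf cf.
pose grid (m : nat) (k : int) : R := k%:~R / m.+1%:R.
pose rnd m (x : R) := grid m (Num.floor (x * m.+1%:R)).
apply: (@measurable_fun_cvg _ _ _ _ (fun m p => f (rnd m p.1, p.2))) => [m|].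
  move=> _ B mB; rewrite setTI.
  rewrite (_ : _ @^-1` _ = \bigcup_(k : int)
    ([set x | Num.floor (x * m.+1%:R) = k] `*`
     ((fun y => f (grid m k, y)) @^-1` B))); last first.
    apply/seteqP; split => [[x y] /= Bxy|[x y] [k _ [/= <- //]]].
    by exists (Num.floor (x * m.+1%:R)).
  apply: countable_bigcupT_measurable => // k.
  apply: measurableX; last by rewrite -[X in measurable X]setTI; exact: mf.
  rewrite (_ : [set x | _] = `[grid m k, grid m (k + 1)[%classic); last first.
    apply/seteqP; split => x /=; rewrite in_itv/= ler_pdivrMr// ltr_pdivlMr//.
      by move=> <-; exact: floor_itv.
    by move=> xk; apply/eqP; rewrite floor_eq.
  exact: measurable_itv.
move=> [x y] _ /=.
apply: (@continuous_cvg _ _ _ _ _ _ (fun x0 : R => f (x0, y))); first exact: cf.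
apply/cvgrPdist_le => e e0; near=> m.
have m0 : 0 < m.+1%:R :> R by [].
rewrite /rnd /grid.
have /andP[h1 h2] := floor_itv (x * m.+1%:R).
rewrite intrD1 in h2.
rewrite ger0_norm; last by rewrite subr_ge0 ler_pdivrMr.
rewrite -(ler_pM2r m0) mulrBl divfK ?gt_eqF//.
have : 1 <= e * m.+1%:R; last by lra.
rewrite mulrC -ler_pdivrMl// mulr1; apply: ltW.
near: m.
exact: near_infty_natSinv_lt (PosNum e0).
Unshelve. all: end_near. Qed.

(** Separate rather than joint continuity: this is what entire functions with a
    real parameter have at once, and it passes to sections and products. *)
Definition sepcont n (f : 'rV[R]_n -> R) := forall v j,
  continuous (fun y : R => f (v + y *: delta_mx 0 j)).

Lemma sepcont_cst n (c : R) : sepcont (fun _ : 'rV[R]_n => c).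
Proof. by move=> v j; exact: cst_continuous. Qed.

Lemma sepcontM n (f g : 'rV[R]_n -> R) : sepcont f -> sepcont g ->
  sepcont (fun v => f v * g v).
Proof.
move=> cf cg v j y.
exact: (@continuousM _ _ (fun y : R => f (v + y *: delta_mx 0 j))
  (fun y : R => g (v + y *: delta_mx 0 j)) y (cf v j y) (cg v j y)).
Qed.

Definition consr n (x : R) (v : 'rV[R]_n) : 'rV[R]_n.+1 :=
  \row_j oapp (v 0) x (unlift ord0 j).

Definition rowt n (t : n.-tuple (measurableTypeR R)) : 'rV[R]_n :=
  \row_j tnth t j.

Lemma consr0 n x (v : 'rV[R]_n) : consr x v 0 ord0 = x.
Proof. by rewrite mxE unlift_none. Qed.

Lemma consrS n x (v : 'rV[R]_n) k : consr x v 0 (lift ord0 k) = v 0 k.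
Proof. by rewrite mxE liftK. Qed.

Lemma consr_slice0 n x y (v : 'rV[R]_n) :
  consr x v + y *: delta_mx 0 ord0 = consr (x + y) v.
Proof.
apply/rowP => j; rewrite !mxE eqxx /=; case: unliftP => [k ->|->] /=.
  by rewrite mulr0 addr0.
by rewrite mulr1.
Qed.

Lemma consr_sliceS n x y (v : 'rV[R]_n) k :
  consr x v + y *: delta_mx 0 (lift ord0 k) = consr x (v + y *: delta_mx 0 k).
Proof.
apply/rowP => j; rewrite !mxE eqxx /=; case: unliftP => [l ->|->] /=.
  by rewrite !mxE eqxx (inj_eq lift_inj).
by rewrite mulr0 addr0.
Qed.

Lemma rowt_cons n x (t : n.-tuple (measurableTypeR R)) :
  rowt [tuple of x :: t] = consr x (rowt t).
Proof.
apply/rowP => j; rewrite !mxE; case: unliftP => [k ->|->] //=.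
by rewrite tnthS mxE.
Qed.

Lemma rowt_eta n (t : n.+1.-tuple (measurableTypeR R)) :
  rowt t = consr (thead t) (rowt [tuple of behead t]).
Proof. by rewrite -rowt_cons [in LHS](tuple_eta t). Qed.

Lemma sepcont_consr n x (f : 'rV[R]_n.+1 -> R) :
  sepcont f -> sepcont (fun v => f (consr x v)).
Proof.
move=> cf v k; have := cf (consr x v) (lift ord0 k).
by under eq_fun do rewrite consr_sliceS.
Qed.

Lemma sepcont_head n v (f : 'rV[R]_n.+1 -> R) :
  sepcont f -> continuous (fun x : R => f (consr x v)).
Proof.
move=> cf; have := cf (consr 0 v) ord0.
by under eq_fun do rewrite consr_slice0 add0r.
Qed.

Lemma sepcont_measurable_pair n (f : 'rV[R]_n.+1 -> R) :
  (forall g : 'rV[R]_n -> R, sepcont g ->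
     measurable_fun setT (fun t => g (rowt t))) ->
  sepcont f ->
  measurable_fun [set: measurableTypeR R * n.-tuple (measurableTypeR R)]
    (fun p => f (consr p.1 (rowt p.2))).
Proof.
move=> ih cf; apply: caratheodory_measurable => [x|t] /=.
  exact: (ih (fun v => f (consr x v)) (sepcont_consr cf)).
exact: sepcont_head.
Qed.

(** Induction on the dimension: a section at a fixed first coordinate is
    measurable by the induction hypothesis, and the dependence on the first
    coordinate is continuous. *)
Lemma sepcont_measurable n (f : 'rV[R]_n -> R) :
  sepcont f -> measurable_fun setT (fun t => f (rowt t)).
Proof.
elim: n f => [|n ih] f cf.
  rewrite (_ : (fun t => _) = cst (f 0)); first exact: measurable_cst.
  by apply/funext => t; congr f; apply/rowP => -[].
rewrite (_ : (fun t => _) = (fun p => f (consr p.1 (rowt p.2))) \o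
    (fun t : n.+1.-tuple _ => (thead t, [tuple of behead t]))); last first.
  by apply/funext => t /=; rewrite rowt_eta.
apply: measurableT_comp; first exact: sepcont_measurable_pair.
apply: measurable_fun_pair; last exact: measurable_behead.
exact: measurable_tnth.
Qed.

Lemma sepcont_pair n (f : 'rV[R]_n.+1 -> R) : sepcont f ->
  measurable_fun [set: measurableTypeR R * n.-tuple (measurableTypeR R)]
    (fun p => f (consr p.1 (rowt p.2))).
Proof. by apply: sepcont_measurable_pair; exact: sepcont_measurable. Qed.

End separately_continuous.

(** * An integrable product weight *)

Section weight.
Context {R : realType}.
Notation leb := (@lebesgue_measure R).
Notation tm n := (tuple_measure leb n).

Definition weight n (v : 'rV[R]_n) : R := \prod_j (1 + v 0 j ^+ 2)^-1.

Lemma oneDsq_gt0 (x : R) : 0 < 1 + x ^+ 2.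
Proof. by rewrite ltr_wpDr// sqr_ge0. Qed.

Lemma weight_gt0 n (v : 'rV[R]_n) : 0 < weight v.
Proof. by apply: prodr_gt0 => j _; rewrite invr_gt0 oneDsq_gt0. Qed.

Lemma weight_consr n x (v : 'rV[R]_n) :
  weight (consr x v) = (1 + x ^+ 2)^-1 * weight v.
Proof.
rewrite /weight big_ord_recl consr0; congr (_ * _).
by apply: eq_bigr => j _; rewrite consrS.
Qed.

Lemma continuous_invoneDsq : continuous (fun x : R => (1 + x ^+ 2)^-1).
Proof. exact: continuous_oneDsqrV. Qed.

Lemma integral_invoneDsq :
  (\int[leb]_x ((1 + x ^+ 2)^-1)%:E = pi%:E)%E.
Proof.
rewrite ge0_symfun_integralT//.
- rewrite (_ : [set x | _] = `[0, +oo[%classic); last first.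
    by apply/seteqP; split => x /=; rewrite in_itv/= andbT.
  by rewrite integral0y_oneDsqr -EFinM mulrC divfK.
- by move=> x; rewrite invr_ge0 ltW// oneDsq_gt0.
- exact: continuous_invoneDsq.
- by move=> x /=; rewrite sqrrN.
Qed.

Lemma integrable_invoneDsq :
  leb.-integrable setT (EFin \o (fun x : R => (1 + x ^+ 2)^-1)).
Proof.
apply/integrableP; split.
  apply/measurable_EFinP; apply: continuous_measurable_fun.
  exact: continuous_invoneDsq.
under eq_integral do rewrite /= ger0_norm ?invr_ge0 1?ltW ?oneDsq_gt0//.
by rewrite integral_invoneDsq ltry.
Qed.

Lemma continuous_prodr (I : Type) (s : seq I) (F : I -> R -> R) :
  (forall i, continuous (F i)) -> continuous (fun y => \prod_(i <- s) F i y).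
Proof.
move=> cF; elim: s => [|i s ih].
  by under eq_fun do rewrite big_nil; exact: cst_continuous.
under eq_fun do rewrite big_cons.
by move=> y; apply: continuousM; [exact: cF|exact: ih].
Qed.

Lemma sepcont_weight n : sepcont (@weight n).
Proof.
move=> v j; rewrite /weight.
rewrite (_ : (fun y : R => _) = fun y : R =>
  \prod_i (1 + (v 0 i + (i == j)%:R * y) ^+ 2)^-1).
  apply: continuous_prodr => i y.
  apply: (@continuous_comp _ _ _ (fun y : R => v 0 i + (i == j)%:R * y)
    (fun x : R => (1 + x ^+ 2)^-1) y).
    apply: (@continuousD _ R^o R (cst (v 0 i)) (fun y : R => (i == j)%:R * y)).
      exact: cst_continuous.
    exact: mulrl_continuous.
  exact: continuous_invoneDsq.
apply/funext => y; apply: eq_bigr => i _.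
by rewrite !mxE eqxx /= mulrC.
Qed.

Lemma measurable_weight n : measurable_fun
  [set: n.-tuple (measurableTypeR R)] (fun t => (weight (rowt t))%:E).
Proof.
by apply/measurable_EFinP; exact: (sepcont_measurable (@sepcont_weight n)).
Qed.

(** Tonelli: each coordinate contributes a factor [pi]. *)
Lemma integral_weight n :
  (\int[tm n]_t (weight (rowt t))%:E = (pi ^+ n)%:E)%E.
Proof.
elim: n => [|n ih].
  rewrite integral_dirac//; last first.
    exact: measurable_weight.
  by rewrite diracT mul1e /weight big_ord0.
rewrite ge0_integral_pushforward//; last 3 first.
- exact: measurable_cons_pair.
- exact: measurable_weight.
- by move=> t _; rewrite lee_fin ltW// weight_gt0.
under eq_integral do rewrite /= rowt_cons.
rewrite fubini_tonelli1/=; last 2 first.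
- by apply/measurable_EFinP; exact: (sepcont_pair (@sepcont_weight _)).
- by move=> t; rewrite lee_fin ltW// weight_gt0.
rewrite /fubini_F/=.
under eq_integral => x _.
  under eq_integral do rewrite weight_consr EFinM.
  rewrite ge0_integralZl//; last 3 first.
  - exact: measurable_weight.
  - by move=> t _; rewrite lee_fin ltW// weight_gt0.
  - by rewrite lee_fin invr_ge0 ltW// oneDsq_gt0.
  rewrite ih muleC; over.
rewrite ge0_integralZl//.
- by rewrite integral_invoneDsq -EFinM exprSr.
- apply/measurable_EFinP; apply: continuous_measurable_fun.
  exact: continuous_invoneDsq.
- by move=> t _; rewrite lee_fin invr_ge0 ltW// oneDsq_gt0.
- by rewrite lee_fin exprn_ge0// pi_ge0.
Qed.

End weight.

(** * Integrals of dominated functions and reduction to lines *)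

Section weighted_integrals.
Context {R : realType}.
Notation leb := (@lebesgue_measure R).
Notation tm n := (tuple_measure leb n).

Definition rint n (f : 'rV[R]_n -> R) : R := \int[tm n]_t f (rowt t).

Definition wdom n (C : R) (f : 'rV[R]_n -> R) := forall v, `|f v| <= C * weight v.

Lemma wdom_ge0 n C (f : 'rV[R]_n -> R) : wdom C f -> 0 <= C.
Proof.
move=> /(_ 0) h; have := le_trans (normr_ge0 _) h.
by rewrite pmulr_lge0// weight_gt0.
Qed.

Lemma integrable_wdom n C (f : 'rV[R]_n -> R) : sepcont f -> wdom C f ->
  (tm n).-integrable setT (EFin \o (fun t => f (rowt t))).
Proof.
move=> cf fC; apply: (@le_integrable _ _ _ _ _ _ _
    (fun t => (C%:E * (weight (rowt t))%:E)%E)) => //.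
- by apply/measurable_EFinP; exact: sepcont_measurable.
- move=> t _ /=; rewrite lee_fin [X in _ <= X]ger0_norm; first exact: fC.
  by rewrite mulr_ge0 ?(wdom_ge0 fC)// ltW// weight_gt0.
- apply: integrableZl => //; apply/integrableP; split.
    exact: measurable_weight.
  under eq_integral do rewrite /= ger0_norm ?ltW ?weight_gt0//.
  by rewrite integral_weight ltry.
Qed.

Lemma rint_weight n : rint (@weight R n) = pi ^+ n.
Proof. by rewrite /rint /Rintegral integral_weight. Qed.

Lemma wdom_weight n : wdom 1 (@weight R n).
Proof. by move=> v; rewrite mul1r ger0_norm// ltW// weight_gt0. Qed.

Lemma le_rint n C (f : 'rV[R]_n -> R) : sepcont f -> wdom C f ->
  `|rint f| <= C * pi ^+ n.
Proof.
move=> cf fC; have If := integrable_wdom cf fC.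
apply: le_trans (le_normr_Rintegral _ If) _ => //.
rewrite -rint_weight /rint -RintegralZl//; last first.
  exact: integrable_wdom (@sepcont_weight R n) (@wdom_weight n).
apply: le_Rintegral => //.
- exact: integrable_norm.
- rewrite (_ : _ \o _ = fun t => (C%:E * (weight (rowt t))%:E)%E)//.
  apply: integrableZl => //.
  exact: integrable_wdom (@sepcont_weight R n) (@wdom_weight n).
Qed.

Lemma rintZ n C c (f : 'rV[R]_n -> R) : sepcont f -> wdom C f ->
  rint (fun v => c * f v) = c * rint f.
Proof. by move=> cf fC; rewrite /rint RintegralZl//; exact: integrable_wdom fC. Qed.

Lemma rintD n C C' (f g : 'rV[R]_n -> R) : sepcont f -> wdom C f ->
  sepcont g -> wdom C' g -> rint (fun v => f v + g v) = rint f + rint g.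
Proof.
move=> cf fC cg gC; rewrite /rint RintegralD//.
  exact: integrable_wdom fC.
exact: integrable_wdom gC.
Qed.

Lemma rintB n C C' (f g : 'rV[R]_n -> R) : sepcont f -> wdom C f ->
  sepcont g -> wdom C' g -> rint (fun v => f v - g v) = rint f - rint g.
Proof.
move=> cf fC cg gC; rewrite /rint RintegralB//.
  exact: integrable_wdom fC.
exact: integrable_wdom gC.
Qed.

Lemma eq_rint n (f g : 'rV[R]_n -> R) : f =1 g -> rint f = rint g.
Proof. by move=> /funext ->. Qed.

Lemma wdom_consr n C (f : 'rV[R]_n.+1 -> R) x : wdom C f ->
  wdom (C * (1 + x ^+ 2)^-1) (fun v => f (consr x v)).
Proof. by move=> fC v; rewrite -mulrA -weight_consr; exact: fC. Qed.

Lemma integrable_wdom_pair n C (f : 'rV[R]_n.+1 -> R) :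
  sepcont f -> wdom C f ->
  (leb \x tm n)%E.-integrable setT (fun p => (f (consr p.1 (rowt p.2)))%:E).
Proof.
move=> cf fC; apply/integrable12ltyP.
  by apply/measurable_EFinP; exact: sepcont_pair.
pose h (x : R) : \bar R := (C * pi ^+ n * (1 + x ^+ 2)^-1)%:E.
apply: (@le_lt_trans _ _ (\int[leb]_x h x)%E); last first.
  under eq_integral do rewrite /h EFinM.
  rewrite integralZl//; last exact: integrable_invoneDsq.
  by rewrite integral_invoneDsq -EFinM ltry.
apply: ge0_le_integral => //.
- by move=> x _; exact: integral_ge0.
- apply: (measurable_fun_fubini_tonelli_F
    (fun p => (`|(f (consr p.1 (rowt p.2)))%:E|)%E)) => //.
  by apply: measurableT_comp => //; apply/measurable_EFinP; exact: sepcont_pair.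
- apply/measurable_EFinP; apply: measurable_funM; first exact: measurable_cst.
  apply: continuous_measurable_fun; exact: continuous_invoneDsq.
move=> x _.
have cx := sepcont_consr (x := x) cf; have dx := wdom_consr x fC.
have /integrableP[mn _] := integrable_wdom cx dx.
rewrite /h mulrAC EFinM -integral_weight -ge0_integralZl//.
- apply: ge0_le_integral => //.
  + by apply: measurableT_comp => //; exact: mn.
  + apply: emeasurable_funM; first exact: measurable_cst.
    exact: measurable_weight.
  + by move=> t _; rewrite -EFinM lee_fin; exact: dx.
- exact: measurable_weight.
- by move=> t _; rewrite lee_fin ltW// weight_gt0.
- by rewrite lee_fin (wdom_ge0 dx).
Qed.

Lemma rint_pair n C (f : 'rV[R]_n.+1 -> R) : sepcont f -> wdom C f ->
  rint f =
  fine (\int[leb \x tm n]_p (f (consr p.1 (rowt p.2)))%:E)%E.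
Proof.
move=> cf fC; rewrite /rint /Rintegral; congr fine.
rewrite integral_pushforward//=.
- by apply: eq_integral => -[x t] _ /=; rewrite rowt_cons.
- exact: measurable_cons_pair.
- by apply/measurable_EFinP; exact: sepcont_measurable.
- rewrite preimage_setT (_ : _ \o _ = fun p => (f (consr p.1 (rowt p.2)))%:E).
    exact: integrable_wdom_pair fC.
  by apply/funext => -[x t] /=; rewrite rowt_cons.
Qed.

Lemma fin_rint n C (f : 'rV[R]_n -> R) : sepcont f -> wdom C f ->
  (\int[tm n]_t (f (rowt t))%:E)%E = (rint f)%:E.
Proof.
move=> cf fC; rewrite /rint /Rintegral fineK//.
by apply: integrable_fin_num => //; exact: integrable_wdom fC.
Qed.

Lemma rint_consr n C (f : 'rV[R]_n.+1 -> R) : sepcont f -> wdom C f ->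
  rint f = \int[leb]_x rint (fun v => f (consr x v)).
Proof.
move=> cf fC; rewrite (rint_pair cf fC) /Rintegral.
rewrite -integral12_prod_meas1; last exact: integrable_wdom_pair fC.
congr fine; apply: eq_integral => x _; rewrite /fubini_F/=.
by rewrite (fin_rint (sepcont_consr cf) (wdom_consr x fC)).
Qed.

Lemma integrable_sdom C (f : R -> R) : continuous f ->
  (forall x, `|f x| <= C * (1 + x ^+ 2)^-1) ->
  leb.-integrable setT (EFin \o f).
Proof.
move=> cf fC; apply: (@le_integrable _ (measurableTypeR R) R leb setT measurableT
    (EFin \o f) (fun x => (C%:E * ((1 + x ^+ 2)^-1)%:E)%E)) => //.
- by apply/measurable_EFinP; exact: continuous_measurable_fun.
- move=> x _ /=; rewrite lee_fin; apply: le_trans (fC _) _.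
  exact: ler_norm.
- by apply: integrableZl => //; exact: integrable_invoneDsq.
Qed.

Lemma wdom_head n C (f : 'rV[R]_n.+1 -> R) v : wdom C f ->
  forall x, `|f (consr x v)| <= C * weight v * (1 + x ^+ 2)^-1.
Proof.
by move=> fC x; rewrite -mulrA [X in C * X]mulrC -weight_consr; exact: fC.
Qed.

Lemma rint_consl n C (f : 'rV[R]_n.+1 -> R) : sepcont f -> wdom C f ->
  rint f = rint (fun v => \int[leb]_x f (consr x v)).
Proof.
move=> cf fC; rewrite (rint_pair cf fC).
rewrite -integral21_prod_meas1; last exact: integrable_wdom_pair fC.
rewrite [RHS]/rint /Rintegral.
congr fine; apply: eq_integral => t _; rewrite /fubini_G/= fineK//.
apply: integrable_fin_num => //.
exact: (integrable_sdom (sepcont_head cf) (wdom_head (rowt t) fC)).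
Qed.

(** Induction on the dimension.  If the line is in the direction of the first
    coordinate, that coordinate is integrated first; otherwise it is integrated
    last, and the induction hypothesis applies to each section. *)
Lemma rint_slice0 n C (f : 'rV[R]_n -> R) j : sepcont f -> wdom C f ->
  (forall v, \int[leb]_y f (v + y *: delta_mx 0 j) = 0) -> rint f = 0.
Proof.
elim: n C f j => [|n ih] C f j; first by case: j.
have rint0 m : rint (fun _ : 'rV[R]_m => 0) = 0.
  by rewrite /rint Rintegral_cst// mul0r.
move=> cf fC; case: (unliftP ord0 j) => [k ->|->] f0.
  rewrite (rint_consr cf fC).
  transitivity (\int[leb]_x (0 : R)); last by rewrite Rintegral_cst// mul0r.
  apply: eq_Rintegral => x _.
  apply: (ih _ _ k (sepcont_consr cf) (wdom_consr x fC)) => v.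
  rewrite -[RHS](f0 (consr x v)); apply: eq_Rintegral => y _.
  by rewrite consr_sliceS.
rewrite (rint_consl cf fC) -[RHS](rint0 n); apply: eq_rint => v.
rewrite -[RHS](f0 (consr 0 v)); apply: eq_Rintegral => y _.
by rewrite consr_slice0 add0r.
Qed.

(** The bounds are required for all [s], which suits parameters that only
    translate or rotate the phase of an integrand. *)
Lemma rint_derive n (K K' : R) (f f' : R -> 'rV[R]_n -> R) (s0 : R) :
  (forall s, sepcont (f s)) -> (forall s, wdom K (f s)) ->
  (forall s, wdom K' (f' s)) ->
  (forall (s : R) v, is_derive s (1 : R) (f^~ v) (f' s v)) ->
  is_derive s0 (1 : R) (fun s => rint (f s)) (rint (f' s0)).
Proof.
move=> cf fK f'K df.
have d1 s v : partial1of2 (fun s t => f s (rowt t)) s v = f' s (rowt v).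
  by rewrite partial1of2E; apply: (@derive_val _ _ _ _ _ _ _ (df s (rowt v))).
have s0I : s0 \in `]s0 - 1, s0 + 1[.
  by rewrite in_itv/= ltrBlDr ltrDl ltr01.
have c1 x : `]s0 - 1, s0 + 1[%classic x ->
    (tm n).-integrable setT (EFin \o (fun t => f x (rowt t))).
  by move=> _; exact: integrable_wdom (cf x) (fK x).
have c2 x t : `]s0 - 1, s0 + 1[%classic x -> setT t ->
    derivable ((fun s t => f s (rowt t)) ^~ t) x 1.
  by move=> _ _; exact: (@ex_derive _ _ _ _ _ _ _ (df x (rowt t))).
have K'0 : 0 <= K' by exact: wdom_ge0 (f'K 0).
have c3 (t : n.-tuple (measurableTypeR R)) : 0 <= K' * weight (rowt t).
  by rewrite mulr_ge0// ltW// weight_gt0.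
have c4 : (tm n).-integrable setT
    (EFin \o (fun t : n.-tuple (measurableTypeR R) => K' * weight (rowt t))).
  apply: (integrable_wdom (C := K') (f := fun v => K' * weight v)).
    by apply: sepcontM; [exact: sepcont_cst|exact: sepcont_weight].
  move=> v; rewrite ger0_norm// mulr_ge0// ltW// weight_gt0//.
have c5 x t : `]s0 - 1, s0 + 1[%classic x -> setT t ->
    `|partial1of2 (fun s t => f s (rowt t)) x t| <= K' * weight (rowt t).
  by move=> _ _; rewrite d1; exact: f'K.
apply: DeriveDef.
  exact: (derivable_under_integral measurableT s0I c1 c2 c3 c4 c5).
rewrite -derive1E.
rewrite (differentiation_under_integral measurableT s0I c1 c2 c3 c4 c5).
by apply: eq_Rintegral => t _; rewrite d1.
Qed.

End weighted_integrals.

(** * Bisection of rectangles *)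

Section bisection.
Context {R : realType}.

(** If [G] failed for a rectangle, it would fail for one of its four quarters, and
    so on: the nested rectangles shrink to a point [(x, y)], near which [G] holds
    by the local hypothesis.  A rectangle is given by its lower left corner and
    its side lengths, so that the side lengths at step [k] are explicit. *)
Lemma bisection2 (G : R -> R -> R -> R -> Prop) :
  (forall p q w h, 0 <= w -> 0 <= h ->
     (forall p' q', p' = p \/ p' = p + w / 2 -> q' = q \/ q' = q + h / 2 ->
        G p' q' (w / 2) (h / 2)) -> G p q w h) ->
  (forall x y, exists2 e : R, 0 < e & forall p q w h,
     0 <= w < e -> 0 <= h < e -> p <= x <= p + w -> q <= y <= q + h ->
     G p q w h) ->
  forall p q w h, 0 <= w -> 0 <= h -> G p q w h.
Proof.
move=> Gq Gloc p0 q0 w h w0 h0; apply: contrapT => nG.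
have h2 (k : nat) : 0 < (2 ^+ k)^-1 :> R by rewrite invr_gt0 exprn_gt0.
pose bad k (s : R * R) := ~ G s.1 s.2 (w / 2 ^+ k) (h / 2 ^+ k).
have wS (x : R) k : x / 2 ^+ k.+1 = x / 2 ^+ k / 2.
  by rewrite exprSr invfM mulrA.
have wk k : 0 <= w / 2 ^+ k by rewrite mulr_ge0// ltW.
have hk k : 0 <= h / 2 ^+ k by rewrite mulr_ge0// ltW.
have step (ks : nat * (R * R)) : exists s', bad ks.1 ks.2 ->
    [/\ bad ks.1.+1 s', ks.2.1 <= s'.1, s'.1 + w / 2 ^+ ks.1.+1 <= ks.2.1 + w / 2 ^+ ks.1,
     ks.2.2 <= s'.2 & s'.2 + h / 2 ^+ ks.1.+1 <= ks.2.2 + h / 2 ^+ ks.1].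
  case: ks => k [p q]; rewrite /bad /=.
  have [g|ng] := pselect (G p q (w / 2 ^+ k) (h / 2 ^+ k)); first by exists (0, 0).
  apply: contrapT => /forallNP ns; apply: ng; apply: Gq => // p' q' hp hq.
  apply: contrapT => ng'; apply: (ns (p', q')) => _.
  have := wk k; have := hk k; rewrite !wS.
  move: (w / 2 ^+ k) (h / 2 ^+ k) hp hq ng' => w' h' hp hq ng' ??.
  by rewrite /=; split => //=; [case: hp|case: hp|case: hq|case: hq] => ->; lra.
have [f fP] := choice step.
pose s := fix s k := if k is k'.+1 then f (k', s k') else (p0, q0).
have sbad k : bad k (s k).
  elim: k => [|k ih]; first by rewrite /bad /= !divr1.
  by have [] := fP (k, s k) ih.
have nest (g : R * R -> R) (l : R) : 0 <= l -> (forall k, g (s k) <= g (s k.+1)) ->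
    (forall k, g (s k.+1) + l / 2 ^+ k.+1 <= g (s k) + l / 2 ^+ k) ->
    exists x, forall k, g (s k) <= x <= g (s k) + l / 2 ^+ k.
  move=> l0 gi gd.
  have gi' j k : g (s j) <= g (s (j + k)%N).
    elim: k => [|k ih]; first by rewrite addn0.
    by rewrite addnS (le_trans ih).
  have gd' j k : g (s (j + k)%N) + l / 2 ^+ (j + k) <= g (s j) + l / 2 ^+ j.
    elim: k => [|k ih]; first by rewrite addn0.
    by rewrite addnS (le_trans (gd _)).
  have ub j k : g (s k) <= g (s j) + l / 2 ^+ j.
    apply: le_trans (gd' j k); apply: (@le_trans _ _ (g (s (j + k)%N))).
      by rewrite addnC; exact: gi'.
    by rewrite lerDl mulr_ge0// ltW.
  exists (sup (range (g \o s))) => k; apply/andP; split.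
    apply: ub_le_sup; last by exists k.
    by exists (g (s 0) + l / 2 ^+ 0) => _ [j _ <-]; exact: ub.
  by apply: ge_sup; [exists (g (s 0)), 0%N|move=> _ [j _ <-]; exact: ub].
have [x xP] : exists x, forall k, (s k).1 <= x <= (s k).1 + w / 2 ^+ k.
  by apply: (nest fst) => // k; have [] := fP (k, s k) (sbad k).
have [y yP] : exists y, forall k, (s k).2 <= y <= (s k).2 + h / 2 ^+ k.
  by apply: (nest snd) => // k; have [] := fP (k, s k) (sbad k).
have [e e0 eG] := Gloc x y.
have small (l : R) : \forall k \near \oo, l / 2 ^+ k < e.
  have : l / 2 ^+ k @[k --> \oo] --> (0 : R).
    rewrite (_ : (fun k => _) = geometric l 2^-1); last first.
      by apply/funext => k; rewrite /geometric /= exprVn.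
    by apply: cvg_geometric; rewrite ger0_norm// invf_lt1// ltr1n.
  by move=> /(cvgr_lt 0); exact.
have [k [kw kh]] : exists k, w / 2 ^+ k < e /\ h / 2 ^+ k < e.
  have [N1 _ H1] := small w; have [N2 _ H2] := small h.
  exists (maxn N1 N2); split; [apply: H1|apply: H2] => /=.
    exact: leq_maxl.
  exact: leq_maxr.
by apply: (sbad k); apply: eG => //; rewrite ?wk ?hk.
Qed.

End bisection.

(** * Goursat lemma for closed differential forms *)

Section goursat.
Context {R : realType}.
Notation leb := (@lebesgue_measure R).

Definition segint (a b : R) (f : R -> R) : R := \int[leb]_(x in `[a, b]) f x.

Lemma segint_integrable a b (f : R -> R) : continuous f ->
  leb.-integrable `[a, b] (EFin \o f).
Proof.
move=> cf; apply: continuous_compact_integrable; first exact: segment_compact.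
exact: continuous_subspaceT.
Qed.

Lemma segint_split a m b (f : R -> R) : continuous f -> a <= m -> m <= b ->
  segint a b f = segint a m f + segint m b f.
Proof.
move=> cf am mb; have := @Rintegral_itvB R f (BLeft a) (BRight b) m.
rewrite bnd_simp => /(_ (segint_integrable a b cf) am).
rewrite bnd_simp => /(_ mb).
rewrite Rintegral_itv_obnd_cbnd; last first.
  apply: integrableS (segint_integrable m b cf) => //.
  exact: subset_itv_oc_cc.
by rewrite /segint => <-; rewrite addrC subrK.
Qed.

Lemma segintD a b (f g : R -> R) : continuous f -> continuous g ->
  segint a b (fun x => f x + g x) = segint a b f + segint a b g.
Proof. by move=> cf cg; rewrite /segint RintegralD//; exact: segint_integrable. Qed.

Lemma segintB a b (f g : R -> R) : continuous f -> continuous g ->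
  segint a b (fun x => f x - g x) = segint a b f - segint a b g.
Proof. by move=> cf cg; rewrite /segint RintegralB//; exact: segint_integrable. Qed.

Lemma segint_cst a b k : a <= b -> segint a b (fun=> k) = k * (b - a).
Proof.
move=> ab; rewrite /segint Rintegral_cst//.
rewrite [X in fine X](lebesgue_measure_itv `[a, b]) /= lte_fin.
by case: ltgtP ab => // -> _; rewrite subrr.
Qed.

Lemma segint_near_cst a b k e (f : R -> R) : continuous f -> a <= b ->
  (forall x, a <= x <= b -> `|f x - k| <= e) ->
  `|segint a b f - k * (b - a)| <= e * (b - a).
Proof.
move=> cf ab fe.
have ck (c : R) : continuous (fun _ : R => c) by exact: cst_continuous.
have cB (c : R) : continuous (fun x => f x - c).
  by move=> x; apply: (@continuousB _ R^o _ f (fun=> c)); [exact: cf|exact: ck].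
rewrite -segint_cst// -segintB// -segint_cst//; apply: le_trans (le_normr_Rintegral _ _) _ => //.
  exact: segint_integrable.
apply: le_Rintegral => //.
- apply: (@segint_integrable a b (fun x => `|f x - k|)) => x.
  by apply: (@continuous_comp _ _ _ (fun x => f x - k) Num.norm x);
    [exact: cB|exact: norm_continuous].
- exact: segint_integrable.
Qed.

(** The integral of [P dx - Q dy] around the boundary of the rectangle; for
    [P = Re f] and [Q = Im f] this is the real part of the contour integral of
    [f]. *)
Definition rect_circ (P Q : R -> R -> R) (a b c d : R) : R :=
  segint a b (fun x => P x c - P x d) - segint c d (fun y => Q b y - Q a y).

(** The form [P dx - Q dy] is closed at every point, but its coefficients need not
    have continuous derivatives.  The circulation is additive under subdivision
    into quarters and, near a point, it is [e (w + h) ^ 2] up to a constant factor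
    because the affine part of a closed form does not contribute; the bound
    [4 e (w + h) ^ 2] is preserved by merging four quarters, so it propagates to
    the whole rectangle by bisection. *)
Lemma goursat (P Q : R -> R -> R) :
  (forall y, continuous (fun x => P x y)) -> (forall x, continuous (Q x)) ->
  (forall x0 y0, exists p1 p2 q2, forall e, 0 < e ->
     exists2 dl, 0 < dl & forall x y, `|x - x0| < dl -> `|y - y0| < dl ->
       `|P x y - P x0 y0 - p1 * (x - x0) - p2 * (y - y0)| <=
         e * (`|x - x0| + `|y - y0|) /\
       `|Q x y - Q x0 y0 + p2 * (x - x0) - q2 * (y - y0)| <=
         e * (`|x - x0| + `|y - y0|)) ->
  forall a b c d, a <= b -> c <= d -> rect_circ P Q a b c d = 0.
Proof.
move=> cP cQ dPQ a b c d ab cd.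
have cPB y z : continuous (fun x => P x y - P x z).
  by move=> x; apply: (@continuousB _ R^o _ (P^~ y) (P^~ z)); exact: cP.
have cQB y z : continuous (fun x => Q y x - Q z x).
  by move=> x; apply: (@continuousB _ R^o _ (Q y) (Q z)); exact: cQ.
suff main e : 0 < e -> forall p q w h, 0 <= w -> 0 <= h ->
    `|rect_circ P Q p (p + w) q (q + h)| <= 4 * e * (w + h) ^+ 2.
  apply/eqP; rewrite -normr_le0; apply/ler_addgt0Pl => e e0; rewrite addr0.
  pose S := (b - a + (d - c)) ^+ 2; have S0 : 0 <= S by exact: sqr_ge0.
  have S1 : 0 < 4 * (S + 1) by rewrite mulr_gt0// ltr_wpDl.
  have e'0 : 0 < e / (4 * (S + 1)) by rewrite divr_gt0.
  have := main _ e'0 a c (b - a) (d - c); rewrite !subr_ge0 => /(_ ab cd).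
  have subKC (x y : R) : x + (y - x) = y by rewrite addrC subrK.
  rewrite !subKC => /le_trans; apply.
  rewrite -/S; move: e'0; set e' := e / _ => e'0.
  have -> : e = e' * (4 * (S + 1)) by rewrite /e' divfK// gt_eqF.
  by rewrite [4 * e']mulrC -mulrA !ler_pM2l// lerDl.
move=> e0; apply: bisection2 => [p q w h w0 h0 ih|x0 y0].
  have split_x y1 y2 : rect_circ P Q p (p + w) y1 y2 =
      rect_circ P Q p (p + w / 2) y1 y2 + rect_circ P Q (p + w / 2) (p + w) y1 y2.
    rewrite /rect_circ (@segint_split p (p + w / 2) (p + w))//; try lra.
    have -> : (fun y => Q (p + w) y - Q p y) = (fun y =>
        (Q (p + w / 2) y - Q p y) + (Q (p + w) y - Q (p + w / 2) y)).
      by apply/funext => y; ring.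
    rewrite [segint y1 y2 _](@segintD _ _ (fun y => Q (p + w / 2) y - Q p y)
      (fun y => Q (p + w) y - Q (p + w / 2) y))//; ring.
  have split_y x1 x2 : rect_circ P Q x1 x2 q (q + h) =
      rect_circ P Q x1 x2 q (q + h / 2) + rect_circ P Q x1 x2 (q + h / 2) (q + h).
    rewrite /rect_circ (@segint_split q (q + h / 2) (q + h))//; try lra.
    have -> : (fun x => P x q - P x (q + h)) = (fun x =>
        (P x q - P x (q + h / 2)) + (P x (q + h / 2) - P x (q + h))).
      by apply/funext => y; ring.
    rewrite [segint x1 x2 _](@segintD _ _ (fun x => P x q - P x (q + h / 2))
      (fun x => P x (q + h / 2) - P x (q + h)))//; ring.
  have E (x l : R) : x + l = x + l / 2 + l / 2 by lra.
  have h1 := ih p q (or_introl erefl) (or_introl erefl).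
  have h2 := ih p (q + h / 2) (or_introl erefl) (or_intror erefl).
  have h3 := ih (p + w / 2) q (or_intror erefl) (or_introl erefl).
  have h4 := ih (p + w / 2) (q + h / 2) (or_intror erefl) (or_intror erefl).
  rewrite -!E in h1 h2 h3 h4.
  rewrite split_x !split_y.
  apply: (le_trans (ler_normD _ _)).
  apply: (le_trans (lerD (ler_normD _ _) (ler_normD _ _))).
  apply: (le_trans (lerD (lerD h1 h2) (lerD h3 h4))).
  by rewrite le_eqVlt; apply/orP; left; apply/eqP; field.
have [p1 [p2 [q2 /(_ e e0)[dl dl0 dP]]]] := dPQ x0 y0.
exists dl => // p q w h /andP[w0 we] /andP[h0 he] /andP[px xp] /andP[qy yq].
have near x y : p <= x <= p + w -> q <= y <= q + h ->
    [/\ `|x - x0| < dl, `|y - y0| < dl & `|x - x0| + `|y - y0| <= w + h].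
  move=> /andP[? ?] /andP[? ?].
  have ? : `|x - x0| <= w by rewrite ler_norml; apply/andP; split; lra.
  have ? : `|y - y0| <= h by rewrite ler_norml; apply/andP; split; lra.
  by split; lra.
have eP x y : p <= x <= p + w -> q <= y <= q + h ->
    `|P x y - P x0 y0 - p1 * (x - x0) - p2 * (y - y0)| <= e * (w + h) /\
    `|Q x y - Q x0 y0 + p2 * (x - x0) - q2 * (y - y0)| <= e * (w + h).
  move=> hx hy; have [dx dy dxy] := near x y hx hy; have [h1 h2] := dP x y dx dy.
  by split; [apply: le_trans h1 _|apply: le_trans h2 _]; rewrite ler_pM2l.
(* the affine part contributes - p2 h w to both integrals, so it cancels *)
have I1 : `|segint p (p + w) (fun x => P x q - P x (q + h)) - - (p2 * h) * w|
    <= 2 * e * (w + h) * w.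
  have := @segint_near_cst p (p + w) (- (p2 * h)) (2 * e * (w + h)) _ (cPB q (q + h)).
  rewrite [p + w - p]addrAC subrr add0r; apply; first by rewrite lerDl.
  move=> x hx; have [hq hqh] : q <= q <= q + h /\ q <= q + h <= q + h.
    by rewrite !lexx lerDl h0.
  have [/ler_normlP[? ?] _] := eP x q hx hq.
  have [/ler_normlP[? ?] _] := eP x (q + h) hx hqh.
  by apply/ler_normlP; split; lra.
have I2 : `|segint q (q + h) (fun y => Q (p + w) y - Q p y) - - (p2 * w) * h|
    <= 2 * e * (w + h) * h.
  have := @segint_near_cst q (q + h) (- (p2 * w)) (2 * e * (w + h)) _ (cQB (p + w) p).
  rewrite [q + h - q]addrAC subrr add0r; apply; first by rewrite lerDl.
  move=> x hx; have [hq hqh] : p <= p <= p + w /\ p <= p + w <= p + w.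
    by rewrite !lexx lerDl w0.
  have [_ /ler_normlP[? ?]] := eP p x hq hx.
  have [_ /ler_normlP[? ?]] := eP (p + w) x hqh hx.
  by apply/ler_normlP; split; lra.
rewrite /rect_circ.
have wh : 0 <= w + h by rewrite addr_ge0.
have -> : 4 * e * (w + h) ^+ 2 =
    2 * e * (w + h) * w + 2 * e * (w + h) * h + 2 * (e * (w + h) * (w + h)) by ring.
have : 0 <= e * (w + h) * (w + h) by rewrite !mulr_ge0// ltW.
move: I1 I2 => /ler_normlP[? ?] /ler_normlP[? ?] ?.
by apply/ler_normlP; split; lra.
Qed.

End goursat.

(** * Integrals over the real line *)

Section improper_integrals.
Context {R : realType}.
Notation leb := (@lebesgue_measure R).

Lemma integral_exhaust (f : R -> R) C : continuous f ->
  (forall x, `|f x| <= C * (1 + x ^+ 2)^-1) ->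
  segint (- N%:R) N%:R f @[N --> \oo] --> \int[leb]_x f x.
Proof.
move=> cf fC.
have C0 : 0 <= C.
  by have := fC 0; rewrite expr0n /= addr0 invr1 mulr1; exact: le_trans.
pose D N : set R := `[- N%:R, N%:R]%classic.
have mD N : measurable (D N) by exact: measurable_itv.
have mf : measurable_fun [set: measurableTypeR R] f.
  exact: continuous_measurable_fun.
have -> : (fun N : nat => segint (- N%:R) N%:R f) =
    fine \o (fun N => \int[leb]_x ((f \_ (D N)) x)%:E)%E.
  by apply/funext => N; rewrite /= /segint Rintegral_mkcond.
apply: fine_cvg; rewrite /Rintegral fineK; last first.
  by apply: integrable_fin_num => //; exact: integrable_sdom fC.
apply: (@dominated_cvg _ (measurableTypeR R) R leb setT measurableT
  (fun N x => ((f \_ (D N)) x)%:E) (fun x => (f x)%:E)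
  (fun x => (C * (1 + x ^+ 2)^-1)%:E)) => //.
- move=> N; apply/measurable_EFinP.
  apply/(measurable_restrictT f) => //.
  exact: measurable_funTS.
- move=> x _; apply: cvg_near_cst.
  have [n hn] : exists n : nat, `|x| <= n%:R.
    by exists (Num.truncn `|x|).+1; rewrite ltW// truncnS_gt.
  exists n => // m /= nm; rewrite patchE mem_set// /D /= in_itv /= -ler_norml.
  by rewrite (le_trans hn)// ler_nat.
- apply: (integrable_sdom (C := C)) => [x|x].
    apply: (@continuousM _ _ (fun=> C) (fun x : R => (1 + x ^+ 2)^-1)).
      exact: cst_continuous.
    exact: continuous_invoneDsq.
  by rewrite ger0_norm// mulr_ge0// invr_ge0 ltW// oneDsq_gt0.
- move=> N x _; rewrite lee_fin patchE; case: ifP => _; first exact: fC.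
  by rewrite normr0 mulr_ge0// invr_ge0 ltW// oneDsq_gt0.
Qed.

(** Used with [f] whose primitive, or whose contour integral over a far vertical
    side, decays like [1 / (1 + N ^ 2)]. *)
Lemma integral_exhaust0 (f : R -> R) C K : continuous f ->
  (forall x, `|f x| <= C * (1 + x ^+ 2)^-1) ->
  (forall N : nat, `|segint (- N%:R) N%:R f| <= K * (1 + N%:R ^+ 2)^-1) ->
  \int[leb]_x f x = 0.
Proof.
move=> cf fC fK; have h := integral_exhaust cf fC.
have K0 : 0 <= K.
  by have := fK 0%N; rewrite expr0n /= addr0 invr1 mulr1; exact: le_trans.
apply: (cvg_unique _ h) => //.
apply: norm_cvg0.
apply: (@squeeze_cvgr _ _ _ _ (cst 0) (fun N => K * N.+1%:R^-1)).
- near=> N; rewrite normr_ge0 /=; apply: le_trans (fK N) _.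
  rewrite ler_wpM2l// lef_pV2 ?posrE ?oneDsq_gt0//.
  rewrite -natrX -[1]/(1%:R) -natrD ler_nat add1n ltnS -mulnn.
  by case: (N) => // m; rewrite leq_pmulr.
- exact: cvg_cst.
- rewrite -[X in _ --> X](mulr0 K); apply: cvgM; first exact: cvg_cst.
  exact: cvg_harmonic.
Unshelve. all: end_near. Qed.

(** The circulation around the rectangle with vertices [- N], [N] at the heights
    [c] and [d] vanishes, and the vertical sides contribute
    [O(1 / (1 + N ^ 2))]. *)
Lemma integral_shift (P Q : R -> R -> R) C c d : c <= d ->
  (forall y, continuous (fun x => P x y)) -> (forall x, continuous (Q x)) ->
  (forall x0 y0, exists p1 p2 q2, forall e, 0 < e ->
     exists2 dl, 0 < dl & forall x y, `|x - x0| < dl -> `|y - y0| < dl ->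
       `|P x y - P x0 y0 - p1 * (x - x0) - p2 * (y - y0)| <=
         e * (`|x - x0| + `|y - y0|) /\
       `|Q x y - Q x0 y0 + p2 * (x - x0) - q2 * (y - y0)| <=
         e * (`|x - x0| + `|y - y0|)) ->
  (forall x y, c <= y <= d ->
     `|P x y| <= C * (1 + x ^+ 2)^-1 /\ `|Q x y| <= C * (1 + x ^+ 2)^-1) ->
  \int[leb]_x P x c = \int[leb]_x P x d.
Proof.
move=> cd cP cQ dPQ PQC.
have Pc x : `|P x c| <= C * (1 + x ^+ 2)^-1.
  by have [] := PQC x c; rewrite ?lexx.
have Pd x : `|P x d| <= C * (1 + x ^+ 2)^-1.
  by have [] := PQC x d; rewrite ?lexx ?cd.
apply/eqP; rewrite -subr_eq0 -RintegralB//; last 2 first.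
- exact: integrable_sdom Pc.
- exact: integrable_sdom Pd.
apply/eqP; apply: (@integral_exhaust0 _ (C + C) ((C + C) * (d - c))).
- by move=> x; apply: (@continuousB _ R^o _ (P^~ c) (P^~ d)); exact: cP.
- by move=> x; rewrite mulrDl (le_trans (ler_normB _ _))// lerD.
move=> N.
have := goursat cP cQ dPQ (a := - N%:R) (b := N%:R) _ cd.
rewrite lerNl; have N0 : - N%:R <= N%:R :> R by rewrite (@le_trans _ _ 0)// oppr_le0.
move=> /(_ N0)/eqP; rewrite /rect_circ subr_eq0 => /eqP ->.
have cQN : continuous (fun y => Q N%:R y - Q (- N%:R) y).
  by move=> x; apply: (@continuousB _ R^o _ (Q N%:R) (Q (- N%:R))); exact: cQ.
have := @segint_near_cst _ c d 0 ((C + C) * (1 + N%:R ^+ 2)^-1) _ cQN cd.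
rewrite mul0r subr0 [X in _ -> _ <= X]mulrAC; apply => y ycd.
rewrite subr0 mulrDl (le_trans (ler_normB _ _))// lerD//.
  by have [] := PQC N%:R y ycd.
by have [] := PQC (- N%:R) y ycd; rewrite sqrrN.
Qed.

(** By the fundamental theorem of calculus the integral over [[- N, N]] is
    [f N - f (- N)], which tends to 0. *)
Lemma integral_derive0 (f f' : R -> R) C :
  (forall x : R, is_derive x (1 : R) f (f' x)) -> continuous f' ->
  (forall x, `|f x| <= C * (1 + x ^+ 2)^-1) ->
  (forall x, `|f' x| <= C * (1 + x ^+ 2)^-1) ->
  \int[leb]_x f' x = 0.
Proof.
move=> df cf' fC f'C.
have cf : continuous f.
  move=> x; apply/differentiable_continuous/derivable1_diffP.
  exact: (@ex_derive _ _ _ _ _ _ _ (df x)).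
apply: (@integral_exhaust0 _ C (C + C)) => // N.
have [->|N0] := eqVneq N 0%N.
  rewrite oppr0 /segint set_itv1 Rintegral_set1 normr0.
  apply: mulr_ge0; last by rewrite invr_ge0 ltW// oneDsq_gt0.
  have := fC 0; rewrite expr0n /= addr0 invr1 mulr1 => h.
  by rewrite addr_ge0// (le_trans _ h).
have NN : - N%:R < N%:R :> R by rewrite (@lt_trans _ _ 0) ?oppr_lt0 ?ltr0n ?lt0n.
rewrite /segint /Rintegral (@continuous_FTC2 _ _ f)//=.
- rewrite mulrDl (le_trans (ler_normB _ _))// lerD//.
  by have := fC (- N%:R); rewrite sqrrN.
- exact: continuous_subspaceT.
- split.
  + by move=> x _; exact: (@ex_derive _ _ _ _ _ _ _ (df x)).
  + exact/cvg_at_right_filter/cf.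
  + exact/cvg_at_left_filter/cf.
- by move=> x _; rewrite derive1E; exact: (@derive_val _ _ _ _ _ _ _ (df x)).
Qed.

End improper_integrals.

Local Open Scope complex_scope.
Local Notation normc := ComplexField.Normc.normc.

(** * Complex numbers and the exponential *)

Section complex_numbers.
Context {R : realType}.
Notation C := R[i].
Implicit Types z w : C.

Lemma ReD z w : complex.Re (z + w) = complex.Re z + complex.Re w.
Proof. by case: z; case: w. Qed.
Lemma ImD z w : complex.Im (z + w) = complex.Im z + complex.Im w.
Proof. by case: z; case: w. Qed.
Lemma ReN z : complex.Re (- z) = - complex.Re z. Proof. by case: z. Qed.
Lemma ImN z : complex.Im (- z) = - complex.Im z. Proof. by case: z. Qed.
Lemma ReM z w : complex.Re (z * w) =
  complex.Re z * complex.Re w - complex.Im z * complex.Im w.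
Proof. by case: z; case: w. Qed.
Lemma ImM z w : complex.Im (z * w) =
  complex.Re z * complex.Im w + complex.Im z * complex.Re w.
Proof. by case: z => a b; case: w => c d /=. Qed.

Lemma normc_ge0 z : 0 <= normc z.
Proof. by case: z => a b; exact: sqrtr_ge0. Qed.

Lemma normcD z w : normc (z + w) <= normc z + normc w.
Proof. exact: le_normcD. Qed.

Lemma normc_opp z : normc (- z) = normc z.
Proof. exact: normcN. Qed.

Lemma normcB z w : normc (z - w) <= normc z + normc w.
Proof. by rewrite (le_trans (normcD _ _))// normc_opp. Qed.

Lemma normc_conj z : normc (conjc z) = normc z.
Proof. by case: z => a b /=; rewrite sqrrN. Qed.

Lemma Re_le_normc z : `|complex.Re z| <= normc z.
Proof.
case: z => a b /=; rewrite -sqrtr_sqr ler_wsqrtr// lerDl; exact: sqr_ge0.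
Qed.

Lemma Im_le_normc z : `|complex.Im z| <= normc z.
Proof.
case: z => a b /=; rewrite -sqrtr_sqr ler_wsqrtr// lerDr; exact: sqr_ge0.
Qed.

Lemma normc_le_ReIm z : normc z <= `|complex.Re z| + `|complex.Im z|.
Proof.
case: z => a b /=; rewrite -[leRHS]ger0_norm ?addr_ge0// -sqrtr_sqr ler_wsqrtr//.
rewrite sqrrD !real_normK ?num_real// -addrA lerD2l lerDr.
by rewrite mulrn_wge0// mulr_ge0.
Qed.

Lemma normc_real (x : R) : normc x%:C = `|x|.
Proof. by rewrite /= expr0n addr0 sqrtr_sqr. Qed.

Lemma normcX z n : normc (z ^+ n) = normc z ^+ n.
Proof.
elim: n => [|n ih]; first by rewrite !expr0 ComplexField.Normc.normc1.
by rewrite !exprS ComplexField.Normc.normcM ih.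
Qed.

Lemma normc_sum (I : Type) (s : seq I) (F : I -> C) :
  normc (\sum_(i <- s) F i) <= \sum_(i <- s) normc (F i).
Proof.
elim: s => [|i s ih]; first by rewrite !big_nil ComplexField.Normc.normc0.
by rewrite !big_cons (le_trans (normcD _ _))// lerD2l.
Qed.

Lemma normC_normc z : `|z| = (normc z)%:C. Proof. by []. Qed.

Lemma cexpD z w : cexp (z + w) = cexp z * cexp w.
Proof.
apply/eqP; rewrite eq_complex ReM ImM /cexp /= ReD ImD expRD cosD sinD.
by apply/andP; split; apply/eqP; ring.
Qed.

Lemma normc_cexp z : normc (cexp z) = expR (complex.Re z).
Proof.
rewrite /cexp /= !exprMn -mulrDr cos2Dsin2 mulr1 sqrtr_sqr ger0_norm// expR_ge0.
Qed.

Lemma MVT_norm (f f' : R -> R) (K a b : R) :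
  (forall x : R, is_derive x (1 : R) f (f' x)) ->
  (forall x, Num.min a b <= x <= Num.max a b -> `|f' x| <= K) ->
  `|f b - f a| <= K * `|b - a|.
Proof.
move=> df f'K.
have cf : continuous f.
  move=> x; apply/differentiable_continuous/derivable1_diffP.
  exact: (@ex_derive _ _ _ _ _ _ _ (df x)).
have main (x y : R) : x <= y -> (forall t, x <= t <= y -> `|f' t| <= K) ->
    `|f y - f x| <= K * `|y - x|.
  move=> xy hK; have [c] := MVT_segment xy (fun x _ => df x) (continuous_subspaceT cf).
  by rewrite in_itv/= => hc ->; rewrite normrM ler_wpM2r// hK.
have [ab|/ltW ba] := leP a b.
  by apply: main => // t ht; apply: f'K; rewrite min_l// max_r.
rewrite distrC [in leRHS]distrC; apply: main => // t ht.
by apply: f'K; rewrite min_r// max_l.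
Qed.

Lemma between0 (x y : R) : Num.min 0 y <= x <= Num.max 0 y -> `|x| <= `|y|.
Proof.
have [y0|/ltW y0] := leP 0 y.
  by move=> /andP[x0 xy]; rewrite !ger0_norm.
by move=> /andP[x0 xy]; rewrite !ler0_norm// lerN2.
Qed.

Lemma le_sin_norm (x : R) : `|sin x| <= `|x|.
Proof.
have := @MVT_norm sin cos 1 0 x _ _; rewrite sin0 !subr0 mul1r; apply => y _.
by rewrite ler_norml cos_geN1 cos_le1.
Qed.

Lemma le_cosB1_norm (x : R) : `|cos x - 1| <= `|x| ^+ 2.
Proof.
have := @MVT_norm cos (fun x => - sin x) `|x| 0 x _ _.
rewrite cos0 subr0 expr2; apply => // y hy.
by rewrite normrN (le_trans (le_sin_norm _))// between0.
Qed.

Lemma le_cosB1_norm1 (x : R) : `|cos x - 1| <= `|x|.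
Proof.
have := @MVT_norm cos (fun x => - sin x) 1 0 x _ _.
rewrite cos0 subr0 mul1r; apply => // y hy.
by rewrite normrN ler_norml sin_geN1 sin_le1.
Qed.

Lemma le_sinB_norm (x : R) : `|sin x - x| <= `|x| ^+ 2.
Proof.
have := @MVT_norm (fun x => sin x - x) (fun x => cos x - 1) `|x| 0 x _ _.
rewrite sin0 !subr0 expr2; apply => y hy.
by rewrite (le_trans (le_cosB1_norm1 _))// between0.
Qed.

Lemma le_expRB1_norm (x : R) : `|expR x - 1| <= `|x| * expR `|x|.
Proof.
have := @MVT_norm expR expR (expR `|x|) 0 x _ _.
rewrite expR0 subr0 mulrC; apply => // y hy.
rewrite ger0_norm ?expR_ge0// ler_expR.
by rewrite (le_trans (ler_norm _))// between0.
Qed.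

Lemma le_expRB1B_norm (x : R) : `|expR x - 1 - x| <= `|x| ^+ 2 * expR `|x|.
Proof.
have := @MVT_norm (fun x => expR x - x) (fun x => expR x - 1) (`|x| * expR `|x|) 0 x _ _.
rewrite expR0 !subr0 mulrAC -expr2 addrAC; apply => y hy.
rewrite (le_trans (le_expRB1_norm _))// ler_pM// ?expR_ge0 ?ler_expR//.
  exact: between0.
exact: between0.
Qed.

(** Real and imaginary parts are split into the corresponding errors for [expR],
    [cos] and [sin], each of which is bounded by the mean value theorem. *)
Lemma normc_cexpB1 z : normc (cexp z - 1 - z) <= 4 * normc z ^+ 2 * expR (normc z).
Proof.
case: z => a b; set z := a +i* b; apply: le_trans (normc_le_ReIm _) _.
set r := normc z; have ar : `|a| <= r by exact: Re_le_normc z.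
have br : `|b| <= r by exact: Im_le_normc z.
have r0 : 0 <= r by exact: normc_ge0.
rewrite !(ReD, ReN, ImD, ImN) /= oppr0 addr0.
have er : expR `|a| <= expR r by rewrite ler_expR.
have ea : expR a <= expR r by rewrite ler_expR (le_trans (ler_norm _)).
have sq (x : R) : `|x| <= r -> `|x| ^+ 2 <= r ^+ 2 by move=> ?; rewrite lerXn2r// nnegrE.
have sqe (x y : R) : `|x| <= r -> 0 <= y -> y <= expR r -> `|x| ^+ 2 * y <= r ^+ 2 * expR r.
  by move=> ? ? ?; rewrite ler_pM// ?sqr_ge0// sq.
have -> : expR a * cos b - 1 - a = expR a * (cos b - 1) + (expR a - 1 - a) by ring.
have -> : expR a * sin b - b = expR a * (sin b - b) + (expR a - 1) * b by ring.
have h1 : `|expR a * (cos b - 1)| <= r ^+ 2 * expR r.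
  rewrite normrM ger0_norm ?expR_ge0// mulrC.
  apply: le_trans (sqe b _ br (expR_ge0 a) ea).
  by rewrite ler_wpM2r ?expR_ge0 ?le_cosB1_norm.
have h2 : `|expR a - 1 - a| <= r ^+ 2 * expR r.
  by apply: le_trans (sqe a _ ar (expR_ge0 _) er); exact: le_expRB1B_norm.
have h3 : `|expR a * (sin b - b)| <= r ^+ 2 * expR r.
  rewrite normrM ger0_norm ?expR_ge0// mulrC.
  apply: le_trans (sqe b _ br (expR_ge0 a) ea).
  by rewrite ler_wpM2r ?expR_ge0 ?le_sinB_norm.
have h4 : `|(expR a - 1) * b| <= r ^+ 2 * expR r.
  have h : `|expR a - 1| <= r * expR r.
    by rewrite (le_trans (le_expRB1_norm _))// ler_pM// expR_ge0.
  by rewrite normrM (le_trans (ler_pM _ _ h br))// expr2 mulrAC.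
have -> : 4 * r ^+ 2 * expR r = (r ^+ 2 * expR r + r ^+ 2 * expR r) +
   (r ^+ 2 * expR r + r ^+ 2 * expR r) by ring.
by apply: lerD; apply: le_trans (ler_normD _ _) _; apply: lerD.
Qed.

End complex_numbers.

(** * Calculus for complex-valued functions of real variables *)

Section complex_calculus.
Context {R : realType}.
Notation C := R[i].

(** Derivatives with respect to a real variable are taken in the real and the
    imaginary part, as in the definition of smoothness of test functions. *)
Definition cis_derive (f : R -> C) (s : R) (D : C) :=
  is_derive s (1 : R) (ReF f) (complex.Re D) /\
  is_derive s (1 : R) (ImF f) (complex.Im D).

Lemma cis_deriveD (f g : R -> C) s D E : cis_derive f s D -> cis_derive g s E ->
  cis_derive (fun x => f x + g x) s (D + E).
Proof.
move=> [f1 f2] [g1 g2]; split.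
  rewrite ReD (_ : ReF _ = ReF f + ReF g); first exact: is_deriveD.
  by apply/funext => x; rewrite /ReF ReD.
rewrite ImD (_ : ImF _ = ImF f + ImF g); first exact: is_deriveD.
by apply/funext => x; rewrite /ImF ImD.
Qed.

Lemma cis_derive_cst (c : C) s : cis_derive (fun=> c) s 0.
Proof. by split; exact: is_derive_cst. Qed.

Lemma cis_deriveM (f g : R -> C) s D E : cis_derive f s D -> cis_derive g s E ->
  cis_derive (fun x => f x * g x) s (D * g s + f s * E).
Proof.
move=> [f1 f2] [g1 g2]; split.
  rewrite (_ : ReF _ = ReF f * ReF g - ImF f * ImF g); last first.
    by apply/funext => x; rewrite /ReF ReM.
  apply: is_derive_eq; rewrite ReD !ReM /GRing.scale /=; rewrite /ReF /ImF; ring.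
rewrite (_ : ImF _ = ReF f * ImF g + ImF f * ReF g); last first.
  by apply/funext => x; rewrite /ImF ImM.
apply: is_derive_eq; rewrite ImD !ImM /GRing.scale /=; rewrite /ReF /ImF; ring.
Qed.

Lemma cis_deriveZ (c : C) (f : R -> C) s D : cis_derive f s D ->
  cis_derive (fun x => c * f x) s (c * D).
Proof.
move=> df; have := cis_deriveM (cis_derive_cst c s) df.
by rewrite mul0r add0r.
Qed.

Lemma cis_derive_eq (f : R -> C) s D E : cis_derive f s D -> D = E ->
  cis_derive f s E.
Proof. by move=> ? <-. Qed.

Lemma is_derive_affine (a b s : R) : is_derive s (1 : R) (fun x => a + x * b) b.
Proof.
rewrite (_ : (fun x => _) = cst a + b \*: id); last first.
  by apply/funext => x; rewrite /GRing.scale /= mulrC.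
apply: is_derive_eq; rewrite add0r /GRing.scale /=; exact: mulr1.
Qed.

Lemma cis_derive_affine (f : R -> C) (a b s : R) D :
  cis_derive f (a + s * b) D -> cis_derive (fun x => f (a + x * b)) s (b%:C * D).
Proof.
move=> [f1 f2]; have da := is_derive_affine a b s; split.
  have := @is_derive1_comp R (ReF f) (fun x => a + x * b) s _ _ f1 da.
  by rewrite (_ : complex.Re (_ * _) = complex.Re D * b)// ReM /= mul0r subr0 mulrC.
have := @is_derive1_comp R (ImF f) (fun x => a + x * b) s _ _ f2 da.
by rewrite (_ : complex.Im (_ * _) = complex.Im D * b)// ImM /= mul0r addr0 mulrC.
Qed.

Lemma cis_derive_cexp (a b : C) s :
  cis_derive (fun x => cexp (a + x%:C * b)) s (b * cexp (a + s%:C * b)).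
Proof.
set p := fun x => complex.Re a + x * complex.Re b.
set q := fun x => complex.Im a + x * complex.Im b.
have dp : is_derive s (1 : R) p (complex.Re b) by exact: is_derive_affine.
have dq : is_derive s (1 : R) q (complex.Im b) by exact: is_derive_affine.
have E x : a + x%:C * b = p x +i* q x.
  apply/eqP; rewrite eq_complex ReD ImD ReM ImM /= /p /q !mul0r subr0 addr0.
  by rewrite !eqxx.
have e1 := is_derive1_comp (is_derive_expR (p s)) dp.
have e2 := is_derive1_comp (is_derive_cos (q s)) dq.
have e3 := is_derive1_comp (is_derive_sin (q s)) dq.
split.
  rewrite (_ : ReF _ = (expR \o p) * (cos \o q)); last first.
    by apply/funext => x; rewrite /ReF E.
  apply: is_derive_eq; rewrite E ReM /GRing.scale /=; ring.
rewrite (_ : ImF _ = (expR \o p) * (sin \o q)); last first.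
  by apply/funext => x; rewrite /ImF E.
apply: is_derive_eq; rewrite E ImM /GRing.scale /=; ring.
Qed.

Definition ccont (T : topologicalType) (f : T -> C) :=
  continuous (ReF f) /\ continuous (ImF f).

Lemma ccont_cst (T : topologicalType) (c : C) : ccont (fun _ : T => c).
Proof. by split=> x; exact: cst_continuous. Qed.

Lemma ccontM (T : topologicalType) (f g : T -> C) : ccont f -> ccont g ->
  ccont (fun x => f x * g x).
Proof.
move=> [f1 f2] [g1 g2]; split => x.
  rewrite (_ : ReF _ = (fun x => ReF f x * ReF g x - ImF f x * ImF g x)); last first.
    by apply/funext => y; rewrite /ReF ReM.
  apply: (@continuousB _ R^o _ (fun x => ReF f x * ReF g x) (fun x => ImF f x * ImF g x)).
    exact: (@continuousM _ _ (ReF f) (ReF g) x (f1 x) (g1 x)).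
  exact: (@continuousM _ _ (ImF f) (ImF g) x (f2 x) (g2 x)).
rewrite (_ : ImF _ = (fun x => ReF f x * ImF g x + ImF f x * ReF g x)); last first.
  by apply/funext => y; rewrite /ImF ImM.
apply: (@continuousD _ R^o _ (fun x => ReF f x * ImF g x) (fun x => ImF f x * ReF g x)).
  exact: (@continuousM _ _ (ReF f) (ImF g) x (f1 x) (g2 x)).
exact: (@continuousM _ _ (ImF f) (ReF g) x (f2 x) (g1 x)).
Qed.

Lemma ccontD (T : topologicalType) (f g : T -> C) : ccont f -> ccont g ->
  ccont (fun x => f x + g x).
Proof.
move=> [f1 f2] [g1 g2]; split => x.
  rewrite (_ : ReF _ = (fun x => ReF f x + ReF g x)); last first.
    by apply/funext => y; rewrite /ReF ReD.
  exact: (@continuousD _ R^o _ (ReF f) (ReF g) x (f1 x) (g1 x)).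
rewrite (_ : ImF _ = (fun x => ImF f x + ImF g x)); last first.
  by apply/funext => y; rewrite /ImF ImD.
exact: (@continuousD _ R^o _ (ImF f) (ImF g) x (f2 x) (g2 x)).
Qed.

Lemma cis_derive_ccont (f f' : R -> C) :
  (forall x, cis_derive f x (f' x)) -> ccont f.
Proof.
by move=> df; split => x; have [d1 d2] := df x;
  apply/differentiable_continuous/derivable1_diffP;
  [exact: (@ex_derive _ _ _ _ _ _ _ d1)|exact: (@ex_derive _ _ _ _ _ _ _ d2)].
Qed.

Lemma ccont_affine (f : R -> C) (a b : R) : ccont f -> ccont (fun x : R => f (a + x * b)).
Proof.
move=> [f1 f2]; have ca : continuous (fun x : R => a + x * b).
  move=> x; apply/differentiable_continuous/derivable1_diffP.
  exact: (@ex_derive _ _ _ _ _ _ _ (is_derive_affine a b x)).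
split => x.
  exact: (@continuous_comp _ _ _ (fun x : R => a + x * b) (ReF f) x (ca x) (f1 _)).
exact: (@continuous_comp _ _ _ (fun x : R => a + x * b) (ImF f) x (ca x) (f2 _)).
Qed.

Lemma ccont_cexp (a b : C) : ccont (fun x : R => cexp (a + x%:C * b)).
Proof. by apply: cis_derive_ccont => x; exact: cis_derive_cexp. Qed.

Definition csep n (F : 'rV[R]_n -> C) :=
  forall v j, ccont (fun y : R => F (v + y *: delta_mx 0 j)).

Lemma csepRe n (F : 'rV[R]_n -> C) : csep F -> sepcont (ReF F).
Proof. by move=> cF v j; have [] := cF v j. Qed.
Lemma csepIm n (F : 'rV[R]_n -> C) : csep F -> sepcont (ImF F).
Proof. by move=> cF v j; have [] := cF v j. Qed.

Lemma csep_cst n (c : C) : csep (fun _ : 'rV[R]_n => c).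
Proof. by move=> v j; exact: ccont_cst. Qed.
Lemma csepM n (F G : 'rV[R]_n -> C) : csep F -> csep G -> csep (fun v => F v * G v).
Proof. by move=> cF cG v j; exact: ccontM. Qed.
Lemma csepD n (F G : 'rV[R]_n -> C) : csep F -> csep G -> csep (fun v => F v + G v).
Proof. by move=> cF cG v j; exact: ccontD. Qed.

Lemma csepZ n (c : C) (F : 'rV[R]_n -> C) : csep F -> csep (fun v => c * F v).
Proof. by move=> cF; apply: csepM => //; exact: csep_cst. Qed.
Lemma csepB n (F G : 'rV[R]_n -> C) : csep F -> csep G -> csep (fun v => F v - G v).
Proof.
move=> cF cG; rewrite (_ : (fun v => _) = (fun v => F v + (-1) * G v)).
  by apply: csepD => //; exact: csepZ.
by apply/funext => v; rewrite mulN1r.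
Qed.

Lemma weight_le_coord n (v : 'rV[R]_n) j : weight v <= (1 + v 0 j ^+ 2)^-1.
Proof.
have i0 (x : R) : 0 <= (1 + x ^+ 2)^-1 by rewrite invr_ge0 ltW// oneDsq_gt0.
rewrite /weight (bigD1 j)//= -[leRHS]mulr1 ler_wpM2l//.
apply: prodr_ile1 => i _; rewrite i0 /= invf_le1 ?oneDsq_gt0// lerDl.
exact: sqr_ge0.
Qed.

(** Turns domination by the weight into domination along a line, with a constant
    depending on the line. *)
Lemma weight_slice_le n (v : 'rV[R]_n) j (y : R) :
  weight (v + y *: delta_mx 0 j) <= 2 * (1 + v 0 j ^+ 2) * (1 + y ^+ 2)^-1.
Proof.
apply: le_trans (weight_le_coord _ j) _; rewrite !mxE !eqxx mulr1.
rewrite ler_pdivlMr ?oneDsq_gt0// mulrC ler_pdivrMr ?oneDsq_gt0//.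
move: (v 0 j) => x.
(* 1 + y^2 <= 2 (1 + x^2) (1 + (x + y)^2), since y is the difference of x + y and x *)
have : 0 <= x ^+ 2 * (x + y) ^+ 2 by rewrite mulr_ge0 ?sqr_ge0.
have := sqr_ge0 (2 * x + y); have := sqr_ge0 x; nra.
Qed.

Definition cwdom n (K : R) (F : 'rV[R]_n -> C) := forall v, normc (F v) <= K * weight v.

Lemma cwdomRe n K (F : 'rV[R]_n -> C) : cwdom K F -> wdom K (ReF F).
Proof. by move=> FK v; exact: le_trans (Re_le_normc _) (FK v). Qed.
Lemma cwdomIm n K (F : 'rV[R]_n -> C) : cwdom K F -> wdom K (ImF F).
Proof. by move=> FK v; exact: le_trans (Im_le_normc _) (FK v). Qed.

Lemma cwdomZ n K (c : C) (F : 'rV[R]_n -> C) : cwdom K F ->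
  cwdom (normc c * K) (fun v => c * F v).
Proof.
move=> FK v; rewrite ComplexField.Normc.normcM -[leRHS]mulrA.
by apply: ler_wpM2l; [exact: normc_ge0|exact: FK].
Qed.
Lemma cwdomD n K K' (F G : 'rV[R]_n -> C) : cwdom K F -> cwdom K' G ->
  cwdom (K + K') (fun v => F v + G v).
Proof.
move=> FK GK v; rewrite mulrDl; apply: le_trans (normcD _ _) _.
by apply: lerD; [exact: FK|exact: GK].
Qed.
Lemma cwdomB n K K' (F G : 'rV[R]_n -> C) : cwdom K F -> cwdom K' G ->
  cwdom (K + K') (fun v => F v - G v).
Proof.
move=> FK GK v; rewrite mulrDl; apply: le_trans (normcB _ _) _.
by apply: lerD; [exact: FK|exact: GK].
Qed.

Lemma integralRnE n (F : 'rV[R]_n -> C) :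
  integralRn F = rint (ReF F) +i* rint (ImF F).
Proof. by []. Qed.

Lemma le_integralRn n K (F : 'rV[R]_n -> C) : csep F -> cwdom K F ->
  normc (integralRn F) <= 2 * K * pi ^+ n.
Proof.
move=> cF FK; apply: le_trans (normc_le_ReIm _) _.
rewrite integralRnE /= -mulrA [2 * _]mulr_natl mulr2n; apply: lerD.
  exact: le_rint (csepRe cF) (cwdomRe FK).
exact: le_rint (csepIm cF) (cwdomIm FK).
Qed.

Lemma integralRnD n K K' (F G : 'rV[R]_n -> C) : csep F -> cwdom K F ->
  csep G -> cwdom K' G ->
  integralRn (fun v => F v + G v) = integralRn F + integralRn G.
Proof.
move=> cF FK cG GK; rewrite !integralRnE.
apply/eqP; rewrite eq_complex ReD ImD /=.
rewrite -(rintD (csepRe cF) (cwdomRe FK) (csepRe cG) (cwdomRe GK)).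
rewrite -(rintD (csepIm cF) (cwdomIm FK) (csepIm cG) (cwdomIm GK)).
by apply/andP; split; apply/eqP; apply: eq_rint => v; rewrite /ReF /ImF ?ReD ?ImD.
Qed.

Lemma eq_integralRn n (F G : 'rV[R]_n -> C) : F =1 G -> integralRn F = integralRn G.
Proof. by move=> /funext ->. Qed.

Lemma integralRnZ n K c (F : 'rV[R]_n -> C) : csep F -> cwdom K F ->
  integralRn (fun v => c * F v) = c * integralRn F.
Proof.
move=> cF FK; rewrite !integralRnE; case: c => a b.
have c1 := csepRe cF; have c2 := csepIm cF.
have d1 := cwdomRe FK; have d2 := cwdomIm FK.
have sZ (x : R) (f : 'rV[R]_n -> R) : sepcont f -> sepcont (fun v => x * f v).
  by move=> cf; apply: sepcontM => //; exact: sepcont_cst.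
have wZ (x : R) (f : 'rV[R]_n -> R) : wdom K f -> wdom (`|x| * K) (fun v => x * f v).
  by move=> fK v; rewrite normrM -mulrA ler_wpM2l.
apply/eqP; rewrite eq_complex ReM ImM /=.
rewrite -(rintZ a c1 d1) -(rintZ b c2 d2) -(rintZ a c2 d2) -(rintZ b c1 d1).
rewrite -(rintB (sZ a _ c1) (wZ a _ d1) (sZ b _ c2) (wZ b _ d2)).
rewrite -(rintD (sZ a _ c2) (wZ a _ d2) (sZ b _ c1) (wZ b _ d1)).
by apply/andP; split; apply/eqP; apply: eq_rint => v; rewrite /ReF /ImF ?ReM ?ImM.
Qed.

Lemma integralRnB n K K' (F G : 'rV[R]_n -> C) : csep F -> cwdom K F ->
  csep G -> cwdom K' G ->
  integralRn (fun v => F v - G v) = integralRn F - integralRn G.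
Proof.
move=> cF FK cG GK.
have E v : F v - G v = F v + (-1) * G v by rewrite mulN1r.
rewrite (eq_integralRn E) (integralRnD (K' := K') cF FK).
- by rewrite (integralRnZ _ cG GK) mulN1r.
- exact: csepZ.
- by move=> v; rewrite mulN1r normc_opp.
Qed.

Lemma cis_derive_integralRn n K K' (F F' : R -> 'rV[R]_n -> C) s0 :
  (forall s, csep (F s)) -> (forall s, cwdom K (F s)) ->
  (forall s, cwdom K' (F' s)) ->
  (forall s v, cis_derive (F^~ v) s (F' s v)) ->
  cis_derive (fun s => integralRn (F s)) s0 (integralRn (F' s0)).
Proof.
move=> cF FK F'K dF; split.
  apply: (@rint_derive _ _ K K' (fun s => ReF (F s)) (fun s => ReF (F' s))).
  - by move=> s; exact: csepRe.
  - by move=> s; exact: cwdomRe.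
  - by move=> s; exact: cwdomRe.
  - by move=> s v; have [] := dF s v.
apply: (@rint_derive _ _ K K' (fun s => ImF (F s)) (fun s => ImF (F' s))).
- by move=> s; exact: csepIm.
- by move=> s; exact: cwdomIm.
- by move=> s; exact: cwdomIm.
- by move=> s v; have [] := dF s v.
Qed.

(** Integration by parts without boundary term: along each line in direction [j]
    the integral of the derivative vanishes. *)
Lemma integralRn_partial0 n K (F F' : 'rV[R]_n -> C) j :
  csep F' -> cwdom K F -> cwdom K F' ->
  (forall v s, cis_derive (fun y : R => F (v + y *: delta_mx 0 j)) s
                 (F' (v + s *: delta_mx 0 j))) ->
  integralRn F' = 0.
Proof.
move=> cF' FK F'K dF; rewrite integralRnE.
have K0 : 0 <= K by exact: wdom_ge0 (cwdomRe FK).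
have slice (G : 'rV[R]_n -> R) v : wdom K G -> forall y,
    `|G (v + y *: delta_mx 0 j)| <= K * (2 * (1 + v 0 j ^+ 2)) * (1 + y ^+ 2)^-1.
  move=> GK y; apply: le_trans (GK _) _; rewrite -mulrA.
  by apply: ler_wpM2l; [exact: K0|exact: weight_slice_le].
have -> : rint (ReF F') = 0.
  apply: (rint_slice0 (j := j) (csepRe cF') (cwdomRe F'K)) => v.
  apply: (@integral_derive0 _ (fun y => ReF F (v + y *: delta_mx 0 j)) _
    (K * (2 * (1 + v 0 j ^+ 2)))).
  - by move=> x; have [] := dF v x.
  - by have [] := cF' v j.
  - exact: slice (cwdomRe FK).
  - exact: slice (cwdomRe F'K).
have -> : rint (ImF F') = 0.
  apply: (rint_slice0 (j := j) (csepIm cF') (cwdomIm F'K)) => v.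
  apply: (@integral_derive0 _ (fun y => ImF F (v + y *: delta_mx 0 j)) _
    (K * (2 * (1 + v 0 j ^+ 2)))).
  - by move=> x; have [] := dF v x.
  - by have [] := cF' v j.
  - exact: slice (cwdomIm FK).
  - exact: slice (cwdomIm F'K).
by [].
Qed.

End complex_calculus.

(** * Euclidean norm, weight and characters *)

Section euclidean.
Context {R : realType}.
Notation C := R[i].

Lemma enorm_ge0 n (t : 'rV[R]_n) : 0 <= enorm t.
Proof. exact: sqrtr_ge0. Qed.

Lemma coord_le_enorm n (t : 'rV[R]_n) j : `|t 0 j| <= enorm t.
Proof.
rewrite /enorm -sqrtr_sqr ler_wsqrtr// (bigD1 j)//= lerDl.
by apply: sumr_ge0 => i _; exact: sqr_ge0.
Qed.

Lemma sum_coord_le n (t : 'rV[R]_n) : \sum_j `|t 0 j| <= n%:R * enorm t.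
Proof.
rewrite (_ : n%:R * _ = \sum_(j < n) enorm t); last first.
  by rewrite sumr_const card_ord mulr_natl.
by apply: ler_sum => j _; exact: coord_le_enorm.
Qed.

Lemma enorm_le_sum n (t : 'rV[R]_n) : enorm t <= \sum_j `|t 0 j|.
Proof.
have s0 : 0 <= \sum_j `|t 0 j| by apply: sumr_ge0.
rewrite /enorm -[leRHS]ger0_norm// -sqrtr_sqr ler_wsqrtr//.
rewrite expr2 mulr_suml; apply: ler_sum => j _.
rewrite -[t 0 j ^+ 2]real_normK ?num_real// expr2 ler_wpM2l//.
by rewrite (bigD1 j)//= lerDl sumr_ge0.
Qed.

(** The crude constant [n] replaces the Cauchy-Schwarz inequality, since constants
    do not matter. *)
Lemma dot_le n (u t : 'rV[R]_n) : enorm u = 1 -> `|dot u t| <= n%:R * enorm t.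
Proof.
move=> u1; apply: le_trans (ler_norm_sum _ _ _) _; apply: le_trans (sum_coord_le t).
apply: ler_sum => j _; rewrite normrM -[leRHS]mul1r ler_wpM2r//.
by rewrite -u1 coord_le_enorm.
Qed.

Lemma dot_slice n (u t : 'rV[R]_n) j y :
  dot u (t + y *: delta_mx 0 j) = dot u t + y * u 0 j.
Proof.
rewrite /dot; under eq_bigr do rewrite !mxE eqxx mulrDr.
rewrite big_split /=; congr (_ + _); rewrite (bigD1 j)//= eqxx mulr1 mulrC.
by rewrite big1 ?addr0// => i /negPf ->; rewrite !mulr0.
Qed.

Lemma cdot_slice n (t : 'rV[R]_n) (z : 'rV[C]_n) j (y : R) :
  dot (toC (t + y *: delta_mx 0 j)) z = dot (toC t) z + y%:C * z 0 j.
Proof.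
rewrite /dot; under eq_bigr => i _.
  rewrite (_ : _ * _ = toC t 0 i * z 0 i + (y * (i == j)%:R)%:C * z 0 i); last first.
    by rewrite !mxE eqxx /= rmorphD mulrDl.
  over.
rewrite big_split /=; congr (_ + _); rewrite (bigD1 j)//= eqxx mulr1.
by rewrite big1 ?addr0// => i /negPf ->; rewrite mulr0 mul0r.
Qed.

Lemma cdotDr n (t z w : 'rV[C]_n) : dot t (z + w) = dot t z + dot t w.
Proof. by rewrite /dot -big_split /=; apply: eq_bigr => j _; rewrite mxE mulrDr. Qed.

Lemma twopi_le8 : 2 * pi <= 8 :> R.
Proof. by have := @pihalf_lt2 R; lra. Qed.

Lemma sqr_le_expR (x : R) : 0 <= x -> x ^+ 2 <= 2 * expR x.
Proof.
move=> x0; have := expR_ge1Dxn 1 x0.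
by rewrite (_ : 2`!%:R = 2 :> R)//; lra.
Qed.

Lemma oneDsq_le_expR (x : R) : 1 + x ^+ 2 <= 2 * expR `|x|.
Proof.
have := @expR_ge1Dxn R `|x| 1 (normr_ge0 x).
by rewrite real_normK ?num_real// (_ : 2`!%:R = 2 :> R)//; lra.
Qed.

(** Integrability is bought at the price of [n] units of exponential decay. *)
Lemma weight_ge_expR n (t : 'rV[R]_n) :
  1 <= 2 ^+ n * expR (n%:R * enorm t) * weight t.
Proof.
have p0 : 0 < \prod_j (1 + t 0 j ^+ 2).
  by apply: prodr_gt0 => j _; exact: oneDsq_gt0.
rewrite /weight prodfV ler_pdivlMr// mul1r.
apply: (@le_trans _ _ (\prod_(j < n) (2 * expR `|t 0 j|))).
  by apply: ler_prod => j _; rewrite oneDsq_le_expR andbT ltW// oneDsq_gt0.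
rewrite big_split /= prodr_const card_ord ler_wpM2l ?exprn_ge0//.
by rewrite -expR_sum ler_expR sum_coord_le.
Qed.

Lemma Re_twopii (t : R) (z : C) :
  complex.Re (- twopii R * (t%:C * z)) = 2 * pi * t * complex.Im z.
Proof. by rewrite !(ReM, ImM, ReN, ImN) /=; ring. Qed.

Lemma normc_twopii : normc (twopii R) = 2 * pi.
Proof.
by rewrite /= expr0n add0r sqrtr_sqr ger0_norm// mulr_ge0// pi_ge0.
Qed.

(** Only the imaginary part of [z] contributes to the modulus, and [2 pi <= 8]. *)
Lemma normc_char n k (t : 'rV[R]_n) z : strip k z ->
  normc (cexp (- twopii R * dot (toC t) z)) <= expR ((8 * k * n)%:R * enorm t).
Proof.
move=> kz; rewrite normc_cexp ler_expR /dot mulr_sumr.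
rewrite (big_morph _ ReD (erefl _)).
apply: (@le_trans _ _ (\sum_(j < n) 8 * k%:R * enorm t)); last first.
  by rewrite sumr_const card_ord -mulr_natl !natrM; lra.
apply: ler_sum => j _; rewrite mxE Re_twopii.
apply: le_trans (ler_norm _) _.
have p0 : 0 <= 2 * pi :> R by rewrite mulr_ge0// pi_ge0.
rewrite normrM [X in X * _]normrM (ger0_norm p0) -mulrA -[8 * _ * _]mulrA.
apply: ler_pM => //; first exact: twopi_le8.
by rewrite mulrC; apply: ler_pM => //; exact: coord_le_enorm.
Qed.

End euclidean.

(** * Exponential decay of the integrand *)

Section exponential_bounds.
Context {R : realType}.
Notation C := R[i].

Definition exp_le n k M (psi : 'rV[R]_n -> C) := forall t,
  expR (k%:R * enorm t) * normc (psi t) <= M.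

Lemma exp_le_cwdom n k c M (psi G : 'rV[R]_n -> C) : 0 <= c ->
  exp_le (k + n) M psi ->
  (forall t, normc (G t) <= c * (expR (k%:R * enorm t) * normc (psi t))) ->
  cwdom (c * M * 2 ^+ n) G.
Proof.
move=> c0 psiM GM t; apply: le_trans (GM t) _; rewrite -!mulrA ler_wpM2l//.
have w0 := weight_gt0 t; have := psiM t; rewrite natrD mulrDl expRD => h.
have h1 := weight_ge_expR t.
have e0 : 0 <= expR (k%:R * enorm t) * normc (psi t).
  by rewrite mulr_ge0 ?expR_ge0 ?normc_ge0.
apply: (@le_trans _ _ (expR (k%:R * enorm t) * normc (psi t) *
    (2 ^+ n * expR (n%:R * enorm t) * weight t))).
  by rewrite -[leLHS]mulr1 ler_wpM2l.
rewrite [leLHS](_ : _ = (expR (k%:R * enorm t) * expR (n%:R * enorm t) * normc (psi t)) *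
   (2 ^+ n * weight t)); last by ring.
by rewrite ler_wpM2r// mulr_ge0 ?exprn_ge0// ltW.
Qed.

(** The successive derivatives of a function of K_1(R), given as a sequence so that
    passing to the derivative is a shift of the index. *)
Record tower (hs : nat -> R -> C) := Tower {
  tower_derive : forall l y, cis_derive (hs l) y (hs l.+1 y) ;
  tower_bound : forall l k, exists2 M, 0 <= M &
    forall y, expR (k%:R * `|y|) * normc (hs l y) <= M }.

Lemma tower_ccont hs l : tower hs -> ccont (hs l).
Proof. by move=> th; apply: cis_derive_ccont => y; exact: tower_derive. Qed.

Lemma csep_dot (h : R -> C) n (u : 'rV[R]_n) x : ccont h ->
  csep (fun t => h (dot u t - x)).
Proof.
move=> ch v j; rewrite (_ : (fun y : R => _) = fun y : R => h ((dot u v - x) + y * u 0 j)).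
  exact: ccont_affine.
by apply/funext => y; rewrite dot_slice addrAC.
Qed.

Lemma csep_char n (z : 'rV[C]_n) :
  csep (fun t => cexp (- twopii R * dot (toC t) z)).
Proof.
move=> v j; rewrite (_ : (fun y : R => _) = fun y : R =>
    cexp (- twopii R * dot (toC v) z + y%:C * (- twopii R * z 0 j))).
  exact: ccont_cexp.
by apply/funext => y; rewrite cdot_slice mulrDr [_ * (y%:C * _)]mulrCA.
Qed.

Definition DS_integrand n (h : R -> C) (u : 'rV[R]_n) (psi : 'rV[R]_n -> C) (x : R)
    (z : 'rV[C]_n) (t : 'rV[R]_n) :=
  psi t * h (dot u t - x) * cexp (- twopii R * dot (toC t) z).

(** The transform with window [h] itself instead of its conjugate, for an arbitrary
    [psi] and curried. *)
Definition dstft n (h : R -> C) (u : 'rV[R]_n) (psi : 'rV[R]_n -> C)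
    (x : R) (z : 'rV[C]_n) : C := integralRn (DS_integrand h u psi x z).

Lemma csep_DS_integrand n h (u : 'rV[R]_n) psi x z : ccont h -> csep psi ->
  csep (DS_integrand h u psi x z).
Proof.
by move=> ch cp; apply: csepM; [apply: csepM => //; exact: csep_dot|exact: csep_char].
Qed.

(** As [|x| <= |u.t| + |u.t - x|], the decay of [h] gives the factor
    [exp(- k |x|)] at the price of [exp(k |u.t|)]; the character costs
    [exp(8 k n |t|)]. *)
Lemma DS_integrand_le n (h : R -> C) (u : 'rV[R]_n) psi k Mh x z t : enorm u = 1 ->
  (forall y, expR (k%:R * `|y|) * normc (h y) <= Mh) -> strip k z ->
  normc (DS_integrand h u psi x z t) <= (expR (- (k%:R * `|x|)) * Mh) *
    (expR ((9 * k * n)%:R * enorm t) * normc (psi t)).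
Proof.
move=> u1 hM kz; rewrite /DS_integrand !ComplexField.Normc.normcM.
have h1 := normc_char t kz.
have h2 : normc (h (dot u t - x)) <=
    expR (- (k%:R * `|x|)) * Mh * expR ((k * n)%:R * enorm t).
  have := hM (dot u t - x).
  rewrite -ler_pdivlMl ?expR_gt0// -expRN => /le_trans; apply.
  have M0 : 0 <= Mh.
    by apply: le_trans (hM 0); rewrite mulr_ge0 ?expR_ge0 ?normc_ge0.
  rewrite mulrAC ler_wpM2r// -expRD ler_expR.
  have := dot_le t u1; have := ler_distD (dot u t) 0 x; rewrite !sub0r normrN => d1 d2.
  have : `|x| <= n%:R * enorm t + `|dot u t - x|.
    by rewrite (le_trans d1)// normrN lerD2r.
  move=> /(ler_wpM2l (ler0n R k)); rewrite natrM; lra.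
apply: (@le_trans _ _ (normc (psi t) * (expR (- (k%:R * `|x|)) * Mh *
    expR ((k * n)%:R * enorm t)) * expR ((8 * k * n)%:R * enorm t))).
  apply: ler_pM => //; rewrite ?mulr_ge0 ?normc_ge0//.
  by rewrite ler_wpM2l ?normc_ge0.
rewrite (_ : (9 * k * n)%N = (k * n + 8 * k * n)%N); last first.
  by rewrite -mulnDl -{2}[k]mul1n -mulnDl.
rewrite natrD mulrDl expRD le_eqVlt; apply/orP; left; apply/eqP; ring.
Qed.

End exponential_bounds.

(** * Differentiability over a normed field *)

Section frechet.
Context {K : numFieldType}.

Lemma coord_le_norm n (w : 'rV[K]_n) j : `|w 0 j| <= `|w|.
Proof.
rewrite [leRHS]/Num.Def.normr /= mx_normE -[leLHS]nngE num_le.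
exact: (@le_bigmax _ _ _ _ (fun i : 'I_1 * 'I_n => _) (0, j)).
Qed.

(** A quadratic bound on the Taylor remainder is the form in which differentiability
    of an integral depending on a parameter is obtained. *)
Lemma differentiable_quadratic n (F : 'rV[K]_n -> K) (z : 'rV[K]_n)
    (D : 'I_n -> K) (M : K) : 0 <= M ->
  (forall (w : 'rV[K]_n) (r : K), 0 <= r <= 1 -> (forall j, `|w 0 j| <= r) ->
    `|F (z + w) - F z - \sum_j w 0 j * D j| <= M * r ^+ 2) ->
  differentiable (F : 'rV[K]_n -> K^o) z.
Proof.
move=> M0 FD.
pose L (w : 'rV[K]_n) : K^o := \sum_j w 0 j * D j.
have Ll : linear L.
  move=> a v w; rewrite /L scaler_sumr -big_split /=; apply: eq_bigr => j _.
  by rewrite !mxE mulrDl -mulrA.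
pose Lm := GRing.isLinear.Build _ _ _ _ L Ll.
pose Lp : {linear 'rV[K]_n -> K^o} := HB.pack L Lm.
have cL : continuous Lp.
  have cs (s : seq 'I_n) : continuous (fun w : 'rV[K]_n => \sum_(j <- s) w 0 j * D j : K^o).
    elim: s => [|j s ih].
      rewrite (_ : (fun w => _) = cst 0); last first.
        by apply/funext => w; rewrite big_nil.
      by move=> w; exact: (@cst_continuous _ K^o).
    rewrite (_ : (fun w => _) = (fun w : 'rV[K]_n => w 0 j * D j : K^o) +
        (fun w => \sum_(j <- s) w 0 j * D j : K^o)); last first.
      by apply/funext => w; rewrite big_cons.
    move=> w; apply: (@continuousD K K^o _ (fun w : 'rV[K]_n => w 0 j * D j : K^o));
      last exact: ih.
    apply: (@continuousM K _ (fun w : 'rV[K]_n => w 0 j) (fun=> D j)).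
      exact: coord_continuous.
    exact: cst_continuous.
  exact: cs.
have oL : F \o shift z = cst (F z : K^o) + Lp +o_ (0 : 'rV[K]_n) id.
  apply/eqaddoP => e e0.
  have M1 : 0 < M + 1 by rewrite ltr_wpDl.
  have n1 : \forall w \near (0 : 'rV[K]_n), `|w| < 1.
    by apply/nbhs_norm0P; exists 1 => /=.
  have n2 : \forall w \near (0 : 'rV[K]_n), `|w| < e / (M + 1).
    by apply/nbhs_norm0P; exists (e / (M + 1)) => //=; rewrite divr_gt0.
  apply: filterS (filterI n1 n2) => w [w1 wr].
  have := FD w `|w|; rewrite normr_ge0 (ltW w1) => /(_ isT (coord_le_norm w)) h.
  rewrite (_ : (_ - _) w = F (z + w) - F z - \sum_j w 0 j * D j); last first.
    by rewrite /= !fctE /= /shift /= opprD addrA [w + z]addrC.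
  apply: le_trans h _; rewrite expr2 mulrA ler_wpM2r//.
  move: wr; rewrite ltr_pdivlMr// mulrDr mulr1 => wr.
  by rewrite mulrC; apply: le_trans (ltW wr); rewrite lerDl.
by apply/diff_locallyP; rewrite (diff_unique cL oL).
Qed.

(** The little-o condition in explicit form, along one coordinate line. *)
Lemma differentiable_line n (F : 'rV[K]_n -> K) (z : 'rV[K]_n) j :
  differentiable (F : 'rV[K]_n -> K^o) z ->
  exists D : K, forall e : K, 0 < e -> exists2 d : K, 0 < d & forall s : K,
    `|s| < d -> `|F (z + s *: delta_mx 0 j) - F z - D * s| <= e * `|s|.
Proof.
move=> dF; have /eqaddoP h := diff_locally dF.
set df := 'd _ _ in h; exists (df (delta_mx 0 j)) => e e0.
have E0 : 0 < `|delta_mx 0 j : 'rV[K]_n|.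
  rewrite normr_gt0; apply/eqP => /rowP /(_ j); rewrite !mxE !eqxx => /eqP.
  by rewrite oner_eq0.
have e'0 : 0 < e / `|delta_mx 0 j : 'rV[K]_n| by rewrite divr_gt0.
have /nbhs_norm0P[d /= d0 hd] := h _ e'0.
exists (d / `|delta_mx 0 j : 'rV[K]_n|); first by rewrite divr_gt0.
move=> s; rewrite ltr_pdivlMr// -normrZ => /hd /=.
rewrite normrZ mulrCA mulrC divfK ?gt_eqF// mulrC.
rewrite (_ : (_ - _) _ = F (z + s *: delta_mx 0 j) - F z - df (delta_mx 0 j) * s)//.
by rewrite /= !fctE /= /shift /= opprD addrA [_ + z]addrC linearZ /= [_ * s]mulrC.
Qed.

End frechet.

(** * Derivatives along lines and sequences of derivatives *)

Section differentiability_lemmas.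
Context {R : realType}.
Notation C := R[i].

Lemma slice_is_derive n (f : 'rV[R]_n -> R) v j (s : R) :
  (forall t, derivable f t (delta_mx 0 j)) ->
  is_derive s (1 : R) (fun y : R => f (v + y *: delta_mx 0 j))
    (partial j f (v + s *: delta_mx 0 j)).
Proof.
move=> df; set e := delta_mx 0 j; set w := v + s *: e.
have E : (fun h : R => h^-1 *: (((fun y : R => f (v + y *: e)) \o shift s) (h *: 1)
    - f (v + s *: e))) = (fun h : R => h^-1 *: ((f \o shift w) (h *: e) - f w)).
  apply/funext => h /=; rewrite -/w; congr (_ *: (f _ - _)).
  by rewrite /w [h *: 1]mulr1 addrCA -scalerDl addrC.
have := df w; rewrite /partial.
split; first by rewrite /derivable E.
by rewrite /derive E.
Qed.

Lemma cderive1n_seq (G : nat -> R -> C) :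
  (forall l x, cis_derive (G l) x (G l.+1 x)) ->
  forall l, derive1n l (ReF (G 0)) = ReF (G l) /\ derive1n l (ImF (G 0)) = ImF (G l).
Proof.
move=> dG; elim=> [//|l [ih1 ih2]]; rewrite !derive1nS ih1 ih2.
split; apply/funext => x; have [d1 d2] := dG l x; rewrite derive1E.
  exact: (@derive_val _ _ _ _ _ _ _ d1).
exact: (@derive_val _ _ _ _ _ _ _ d2).
Qed.

Lemma cCinfty1_seq (G : nat -> R -> C) :
  (forall l x, cis_derive (G l) x (G l.+1 x)) -> cCinfty1 (G 0).
Proof.
move=> dG l x; have [-> ->] := cderive1n_seq dG l; have [d1 d2] := dG l x.
split; first exact: (@ex_derive _ _ _ _ _ _ _ d1).
exact: (@ex_derive _ _ _ _ _ _ _ d2).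
Qed.

Lemma cderive1n_seqE (G : nat -> R -> C) l x :
  (forall l x, cis_derive (G l) x (G l.+1 x)) -> cderive1n l (G 0) x = G l x.
Proof.
move=> dG; rewrite /cderive1n; have [-> ->] := cderive1n_seq dG l.
by rewrite /ReF /ImF; case: (G l x).
Qed.

End differentiability_lemmas.

(** * Derivatives, analyticity and decay of the transform *)

Section DS_estimates.
Context {R : realType} {n : nat} (u : 'rV[R]_n) (u1 : enorm u = 1).
Context (hs : nat -> R -> R[i]) (th : tower hs).
Notation C := R[i].

(** What is used of [phi] and of each pure derivative [d_j ^ m phi]. *)
Record testfun (psi : 'rV[R]_n -> C) := TestFun {
  testfun_csep : csep psi ;
  testfun_bound : forall k, exists M, exp_le k M psi }.

Lemma exp_le_ge0 k M (psi : 'rV[R]_n -> C) : exp_le k M psi -> 0 <= M.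
Proof. by move=> /(_ 0); apply: le_trans; rewrite mulr_ge0 ?expR_ge0 ?normc_ge0. Qed.

Lemma strip_exists (z : 'rV[C]_n) : exists k, strip k z.
Proof.
have [k hk] : exists k : nat, \sum_j `|complex.Im (z 0 j)| <= k%:R.
  exists (Num.truncn (\sum_j `|complex.Im (z 0 j)|)).+1.
  by rewrite ltW// truncnS_gt.
exists k => j; apply: le_trans hk; rewrite (bigD1 j)//= lerDl.
exact: sumr_ge0.
Qed.

Lemma strip_le k k' (z : 'rV[C]_n) : (k <= k')%N -> strip k z -> strip k' z.
Proof. by move=> kk' kz j; apply: le_trans (kz j) _; rewrite ler_nat. Qed.

Lemma cwdom_DS_integrand l k Mh M psi x (z : 'rV[C]_n) :
  (forall y, expR (k%:R * `|y|) * normc (hs l y) <= Mh) ->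
  exp_le (9 * k * n + n) M psi -> strip k z ->
  cwdom (expR (- (k%:R * `|x|)) * Mh * M * 2 ^+ n) (DS_integrand (hs l) u psi x z).
Proof.
move=> hM psiM kz; apply: exp_le_cwdom psiM _ => [|t]; last exact: DS_integrand_le.
rewrite mulr_ge0 ?expR_ge0//; apply: le_trans (hM 0).
by rewrite mulr_ge0 ?expR_ge0 ?normc_ge0.
Qed.

(** The domination is uniform in [x], as differentiation under the integral sign
    requires. *)
Lemma cwdom_DS_integrand_unif l psi (z : 'rV[C]_n) : testfun psi ->
  exists M, forall x, cwdom M (DS_integrand (hs l) u psi x z).
Proof.
move=> [_ tp]; have [k kz] := strip_exists z.
have [Mh Mh0 hM] := tower_bound th l k; have [M psiM] := tp (9 * k * n + n)%N.
exists (Mh * M * 2 ^+ n) => x t; apply: le_trans (cwdom_DS_integrand x hM psiM kz t) _.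
rewrite ler_wpM2r ?(ltW (weight_gt0 _))// -!mulrA.
apply: ler_piMl; last by rewrite expR_le1 oppr_le0 mulr_ge0.
by rewrite !mulr_ge0 ?(exp_le_ge0 psiM) ?exprn_ge0.
Qed.

Lemma dstft_bound l k Mh M psi x (z : 'rV[C]_n) : csep psi ->
  (forall y, expR (k%:R * `|y|) * normc (hs l y) <= Mh) ->
  exp_le (9 * k * n + n) M psi -> strip k z ->
  expR (k%:R * `|x|) * normc (dstft (hs l) u psi x z) <= 2 * Mh * 2 ^+ n * pi ^+ n * M.
Proof.
move=> cpsi hM psiM kz.
have h := le_integralRn (csep_DS_integrand u x z (tower_ccont l th) cpsi)
  (cwdom_DS_integrand x hM psiM kz).
rewrite -/(dstft _ _ _ _ _) in h.
apply: (le_trans (ler_wpM2l (expR_ge0 _) h)).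
have E : expR (k%:R * `|x|) * expR (- (k%:R * `|x|)) = 1.
  by rewrite -expRD subrr expR0.
rewrite [leLHS](_ : _ = (expR (k%:R * `|x|) * expR (- (k%:R * `|x|))) *
  (2 * Mh * 2 ^+ n * pi ^+ n * M)); last by ring.
by rewrite E mul1r.
Qed.

(** [x] occurs only in [h(u.t - x)]. *)
Lemma cis_derive_dstft l psi (z : 'rV[C]_n) x : testfun psi ->
  cis_derive (fun x => dstft (hs l) u psi x z) x (- dstft (hs l.+1) u psi x z).
Proof.
move=> tp; have [M hM] := cwdom_DS_integrand_unif l z tp.
have [M' hM'] := cwdom_DS_integrand_unif l.+1 z tp.
have cp := testfun_csep tp.
have cs l' y := csep_DS_integrand u y z (tower_ccont l' th) cp.
rewrite -mulN1r -(integralRnZ (-1) (cs l.+1 x) (hM' x)).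
apply: (@cis_derive_integralRn _ _ M M' (fun s => DS_integrand (hs l) u psi s z)
  (fun s t => -1 * DS_integrand (hs l.+1) u psi s z t)) => //.
- by move=> s t; rewrite mulN1r normc_opp; exact: hM'.
move=> s t; rewrite /DS_integrand.
have d : cis_derive (fun x => hs l (dot u t - x)) s (- hs l.+1 (dot u t - s)).
  have := @cis_derive_affine R (hs l) (dot u t) (-1) s (hs l.+1 (dot u t - s)).
  rewrite mulrN1 => /(_ (tower_derive th l _)).
  under eq_fun do rewrite mulrN1.
  by move=> h; apply: cis_derive_eq h _; rewrite rmorphN1 mulN1r.
rewrite (_ : (fun s => _) = (fun s => (psi t * cexp (- twopii R * dot (toC t) z)) *
    hs l (dot u t - s))); last by apply/funext => y; rewrite mulrAC.
apply: cis_derive_eq (cis_deriveZ _ d) _.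
by rewrite mulN1r mulrN mulrAC.
Qed.

Lemma dstft_seq psi (z : 'rV[C]_n) : testfun psi ->
  forall l x, cis_derive (fun x => (-1) ^+ l * dstft (hs l) u psi x z) x
    ((-1) ^+ l.+1 * dstft (hs l.+1) u psi x z).
Proof.
move=> tp l x; apply: cis_derive_eq (cis_deriveZ _ (cis_derive_dstft l z x tp)) _.
by rewrite exprSr mulrN mulrN1 mulNr.
Qed.

Lemma cCinfty1_dstft psi (z : 'rV[C]_n) : testfun psi ->
  cCinfty1 (fun x => dstft (hs 0) u psi x z).
Proof.
move=> /(dstft_seq z) /(@cCinfty1_seq R (fun l x => (-1) ^+ l * dstft (hs l) u psi x z)).
by under eq_fun do rewrite expr0 mul1r.
Qed.

Lemma normc_cderive1n_dstft psi (z : 'rV[C]_n) l x : testfun psi ->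
  normc (cderive1n l (fun x => dstft (hs 0) u psi x z) x) =
  normc (dstft (hs l) u psi x z).
Proof.
move=> /(dstft_seq z) h.
have := @cderive1n_seqE R (fun l x => (-1) ^+ l * dstft (hs l) u psi x z) l x h.
under [X in cderive1n _ X _]eq_fun do rewrite expr0 mul1r.
move=> ->; rewrite ComplexField.Normc.normcM normcX normc_opp.
by rewrite ComplexField.Normc.normc1 expr1n mul1r.
Qed.

(** The derivative of the integrand in [t_j] has three terms, from [psi], from
    [h(u.t - x)] and from the character; the last one is [- 2 pi i z_j] times the
    integrand, and the integral of the sum vanishes. *)
Lemma dstft_parts l psi psi' (z : 'rV[C]_n) x j : testfun psi -> testfun psi' ->
  (forall v s, cis_derive (fun y : R => psi (v + y *: delta_mx 0 j)) s
                 (psi' (v + s *: delta_mx 0 j))) ->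
  twopii R * z 0 j * dstft (hs l) u psi x z =
  dstft (hs l) u psi' x z + (u 0 j)%:C * dstft (hs l.+1) u psi x z.
Proof.
move=> tp tp' dpsi.
have [M hM] := cwdom_DS_integrand_unif l z tp; have [M1 hM1] := cwdom_DS_integrand_unif l.+1 z tp.
have [M' hM'] := cwdom_DS_integrand_unif l z tp'.
have cs l' := csep_DS_integrand u x z (tower_ccont l' th) (testfun_csep tp).
have cs' := csep_DS_integrand u x z (tower_ccont l th) (testfun_csep tp').
pose c1 := (u 0 j)%:C; pose c2 := - twopii R * z 0 j.
have w1 := cwdomD (hM' x) (cwdomZ c1 (hM1 x)).
have s1 := csepD cs' (csepZ c1 (cs l.+1)).
have s2 := csepZ c2 (cs l); have w2 := cwdomZ c2 (hM x).
have s3 := csepD s1 s2; have w3 := cwdomD w1 w2.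
pose K := M + (M' + normc c1 * M1 + normc c2 * M).
have KM : cwdom K (DS_integrand (hs l) u psi x z).
  move=> t; apply: le_trans (hM x t) _; rewrite ler_wpM2r ?(ltW (weight_gt0 _))//.
  by rewrite lerDl; exact: wdom_ge0 (cwdomRe w3).
have KM' : cwdom K (fun t => DS_integrand (hs l) u psi' x z t +
    c1 * DS_integrand (hs l.+1) u psi x z t + c2 * DS_integrand (hs l) u psi x z t).
  move=> t; apply: le_trans (w3 t) _; rewrite ler_wpM2r ?(ltW (weight_gt0 _))//.
  by rewrite lerDr; exact: wdom_ge0 (cwdomRe (hM x)).
have E0 : integralRn (fun t => DS_integrand (hs l) u psi' x z t +
    c1 * DS_integrand (hs l.+1) u psi x z t + c2 * DS_integrand (hs l) u psi x z t) = 0.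
  apply: (@integralRn_partial0 R n K (DS_integrand (hs l) u psi x z) _ j s3 KM KM') => v s.
  rewrite /DS_integrand; have d1 := dpsi v s.
  have d2 : cis_derive (fun y : R => hs l (dot u (v + y *: delta_mx 0 j) - x)) s
      (c1 * hs l.+1 (dot u (v + s *: delta_mx 0 j) - x)).
    under eq_fun do rewrite dot_slice addrAC.
    by apply: cis_derive_affine; rewrite dot_slice addrAC; exact: tower_derive.
  have d3 : cis_derive (fun y : R => cexp (- twopii R * dot (toC (v + y *: delta_mx 0 j)) z)) s
      (c2 * cexp (- twopii R * dot (toC (v + s *: delta_mx 0 j)) z)).
    under eq_fun do rewrite cdot_slice mulrDr [_ * (_%:C * _)]mulrCA.
    by rewrite cdot_slice mulrDr [_ * (_%:C * _)]mulrCA; exact: cis_derive_cexp.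
  apply: cis_derive_eq (cis_deriveM (cis_deriveM d1 d2) d3) _.
  ring.
move: E0; rewrite (integralRnD s1 w1 s2 w2).
rewrite (integralRnD cs' (hM' x) (csepZ c1 (cs l.+1)) (cwdomZ c1 (hM1 x))).
rewrite (integralRnZ c1 (cs l.+1) (hM1 x)) (integralRnZ c2 (cs l) (hM x)).
rewrite -!/(dstft _ _ _ _ _) /c2 mulNr mulNr => /eqP.
by rewrite subr_eq0 => /eqP.
Qed.

Lemma csep_lin (w : 'rV[C]_n) : csep (fun t => - twopii R * dot (toC t) w).
Proof.
move=> v j; rewrite (_ : (fun y : R => _) = fun y : R =>
    - twopii R * dot (toC v) w + y%:C * (- twopii R * w 0 j)); last first.
  by apply/funext => y; rewrite cdot_slice mulrDr [_ * (y%:C * _)]mulrCA.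
apply: (@cis_derive_ccont R _ (fun=> 0 + - twopii R * w 0 j)) => y.
apply: cis_deriveD; first exact: cis_derive_cst.
have h : cis_derive (fun y : R => y%:C) y 1.
  split; first exact: is_derive_id.
  exact: is_derive_cst.
have := cis_deriveM h (cis_derive_cst (- twopii R * w 0 j) y).
by rewrite mul1r mulr0 addr0.
Qed.

Lemma normc_lin (w : 'rV[C]_n) r t : (forall j, normc (w 0 j) <= r) -> 0 <= r ->
  normc (- twopii R * dot (toC t) w) <= r * ((8 * n)%:R * enorm t).
Proof.
move=> wr r0; rewrite ComplexField.Normc.normcM normc_opp normc_twopii.
have h : normc (dot (toC t) w) <= r * (n%:R * enorm t).
  apply: le_trans (normc_sum _ _) _.
  apply: le_trans (ler_wpM2l r0 (sum_coord_le t)); rewrite mulr_sumr.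
  apply: ler_sum => j _; rewrite mxE ComplexField.Normc.normcM normc_real mulrC.
  by rewrite ler_wpM2r.
rewrite natrM -[X in _ <= r * X]mulrA mulrCA ler_pM ?twopi_le8 ?normc_ge0//.
by rewrite mulr_ge0// pi_ge0.
Qed.

Lemma integralRn_sum (I : Type) (s : seq I) (F : I -> 'rV[R]_n -> C) :
  (forall i, csep (F i)) -> (forall i, exists K, cwdom K (F i)) ->
  [/\ csep (fun t => \sum_(i <- s) F i t),
      exists K, cwdom K (fun t => \sum_(i <- s) F i t) &
      integralRn (fun t => \sum_(i <- s) F i t) = \sum_(i <- s) integralRn (F i)].
Proof.
move=> cF dF; elim: s => [|i s [ih1 [K ihK] ih2]].
  have E : (fun t : 'rV[R]_n => \sum_(i <- [::]) F i t) = fun=> 0.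
    by apply/funext => t; rewrite big_nil.
  rewrite E big_nil; split; first exact: csep_cst.
    by exists 0 => t; rewrite mul0r ComplexField.Normc.normc0.
  have w0 : cwdom 0 (fun _ : 'rV[R]_n => 0 : C).
    by move=> t; rewrite mul0r ComplexField.Normc.normc0.
  have := integralRnZ 0 (csep_cst 0) w0.
  by rewrite (eq_integralRn (G := fun=> 0)) ?mul0r// => t; rewrite mul0r.
have [K' FK'] := dF i.
have E : (fun t => \sum_(i <- i :: s) F i t) = (fun t => F i t + \sum_(i <- s) F i t).
  by apply/funext => t; rewrite big_cons.
rewrite E big_cons (integralRnD (cF i) FK' ih1 ihK) ih2; split => //.
  exact: csepD.
by exists (K' + K); exact: cwdomD.
Qed.

(** With [e] the exponent [- 2 pi i t.w], the difference of the integrands at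
    [z + w] and [z] is [a (exp e - 1)], where [a] is the integrand at [z]; the
    differential is the integral of [a e], and the remainder is
    [O(|w| ^ 2)] because [|exp e - 1 - e| <= 4 |e| ^ 2 exp |e|] with
    [|e| <= 8 n |w| |t|]. *)
Lemma entire_dstft l psi x : testfun psi -> entire (fun z => dstft (hs l) u psi x z).
Proof.
move=> tp z; have [k kz] := strip_exists z.
have [Mh Mh0 hM] := tower_bound th l k.
(* 9 k n for the integrand at z, 16 n for the remainder, n for integrability *)
have [M psiM] := testfun_bound tp (9 * k * n + 16 * n + n)%N.
have M0 := exp_le_ge0 psiM.
pose a := DS_integrand (hs l) u psi x z.
have ca : csep a := csep_DS_integrand u x z (tower_ccont l th) (testfun_csep tp).
have a_le t : normc (a t) <= Mh * (expR ((9 * k * n)%:R * enorm t) * normc (psi t)).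
  apply: le_trans (DS_integrand_le _ x t u1 hM kz) _.
  apply: ler_wpM2r; first by rewrite mulr_ge0 ?expR_ge0 ?normc_ge0.
  by apply: ler_piMl => //; rewrite expR_le1 oppr_le0 mulr_ge0.
have G_le (b : 'rV[R]_n -> C) c : 0 <= c ->
    (forall t, normc (b t) <= c * expR ((16 * n)%:R * enorm t)) ->
    cwdom (c * Mh * M * 2 ^+ n) (fun t => a t * b t).
  move=> c0 bc; apply: (@exp_le_cwdom _ _ _ _ _ _ _ _ psiM); first by rewrite mulr_ge0.
  move=> t; rewrite ComplexField.Normc.normcM natrD mulrDl expRD.
  apply: le_trans (ler_pM _ _ (a_le t) (bc t)) _; rewrite ?normc_ge0//.
  by rewrite le_eqVlt; apply/orP; left; apply/eqP; ring.
pose D j := integralRn (fun t : 'rV[R]_n => a t * (- twopii R * (t 0 j)%:C)).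
pose e (w : 'rV[C]_n) (t : 'rV[R]_n) : C := - twopii R * dot (toC t) w.
have ce w : csep (e w) by exact: csep_lin.
have e_le (w : 'rV[C]_n) r t : (forall j, normc (w 0 j) <= r) -> 0 <= r ->
    normc (e w t) <= r * expR ((16 * n)%:R * enorm t).
  move=> wr r0; apply: le_trans (normc_lin t wr r0) _; rewrite ler_wpM2l//.
  apply: (@le_trans _ _ (1 + (16 * n)%:R * enorm t)); last exact: expR_ge1Dx.
  have -> : (16 * n)%N = (8 * n + 8 * n)%N by rewrite -mulnDl.
  rewrite natrD mulrDl addrA lerDr.
  by rewrite addr_ge0// mulr_ge0// enorm_ge0.
have DE w : integralRn (fun t => a t * e w t) = \sum_j w 0 j * D j /\
    exists K, cwdom K (fun t => a t * e w t).
  pose F j t : C := w 0 j * (a t * (- twopii R * (t 0 j)%:C)).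
  have dE j (t : 'rV[R]_n) : - twopii R * (t 0 j)%:C = e (delta_mx 0 j) t.
    rewrite /e /dot (bigD1 j)//= !mxE !eqxx mulr1 big1 ?addr0// => i /negPf ij.
    by rewrite !mxE ij mulr0.
  have cD j : csep (fun t : 'rV[R]_n => a t * (- twopii R * (t 0 j)%:C)).
    by under eq_fun do rewrite dE; exact: csepM.
  have wD j : cwdom (1 * Mh * M * 2 ^+ n) (fun t : 'rV[R]_n => a t * (- twopii R * (t 0 j)%:C)).
    apply: G_le => // t; rewrite dE; apply: e_le => // i; rewrite mxE eqxx /=.
    by case: eqP => _; rewrite ?ComplexField.Normc.normc0 ?ComplexField.Normc.normc1.
  have cF j : csep (F j) by exact: csepZ.
  have wF j : exists K, cwdom K (F j).
    by exists (normc (w 0 j) * (1 * Mh * M * 2 ^+ n)); exact: cwdomZ.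
  have [_ h1 h2] := integralRn_sum (index_enum 'I_n) cF wF.
  have E : (fun t => a t * e w t) = fun t => \sum_j F j t.
    apply/funext => t; rewrite /e /dot !mulr_sumr; apply: eq_bigr => j _.
    by rewrite /F mxE; ring.
  rewrite E; split => //; rewrite h2; apply: eq_bigr => j _.
  exact: integralRnZ (cD j) (wD j).
apply: (@differentiable_quadratic _ n _ z D (2 * (8 * Mh * M * 2 ^+ n) * pi ^+ n)%:C).
  by rewrite lecR !mulr_ge0 ?exprn_ge0 ?pi_ge0.
move=> w r' /andP[r0 r1] wr'.
have [r rE] : exists r : R, r' = r%:C.
  by exists (complex.Re r'); case: r' r0 {r1 wr'} => p q; rewrite lecE /= => /andP[/eqP ->].
move: r0 r1 wr'; rewrite {r'}rE !lecR => r0 r1 wr'.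
have wr j : normc (w 0 j) <= r by rewrite -lecR -normC_normc; exact: wr'.
have -> (A : R) : A%:C * r%:C ^+ 2 = (A * r ^+ 2)%:C.
  by rewrite (rmorphM (real_complex R)) (rmorphXn (real_complex R)).
rewrite normC_normc lecR.
have [DwE [K wK]] := DE w; rewrite -DwE.
have [K1 hK1] := cwdom_DS_integrand_unif l z tp.
have [K2 hK2] := cwdom_DS_integrand_unif l (z + w) tp.
have ca2 : csep (DS_integrand (hs l) u psi x (z + w)).
  exact: (csep_DS_integrand u x (z + w) (tower_ccont l th) (testfun_csep tp)).
rewrite /dstft -(integralRnB ca2 (hK2 x) ca (hK1 x)).
rewrite -(integralRnB (csepB ca2 ca) (cwdomB (hK2 x) (hK1 x)) (csepM ca (ce w)) wK).
have E : (fun t => DS_integrand (hs l) u psi x (z + w) t - a t - a t * e w t) =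
    (fun t => a t * (cexp (e w t) - 1 - e w t)).
  apply/funext => t; rewrite !mulrBr mulr1; congr (_ - _ - _).
  by rewrite /a /DS_integrand /e cdotDr mulrDr cexpD mulrA.
rewrite E.
have cG : csep (fun t => a t * (cexp (e w t) - 1 - e w t)).
  apply: csepM => //; apply: csepB => //; apply: csepB; last exact: csep_cst.
  exact: csep_char.
have wG : cwdom (8 * r ^+ 2 * Mh * M * 2 ^+ n)
    (fun t => a t * (cexp (e w t) - 1 - e w t)).
  apply: G_le => [|t]; first by rewrite mulr_ge0// sqr_ge0.
  apply: le_trans (normc_cexpB1 _) _.
  have h := normc_lin t wr r0; set q := (8 * n)%:R * enorm t in h.
  have q0 : 0 <= q by rewrite mulr_ge0// enorm_ge0.
  have eq : expR ((16 * n)%:R * enorm t) = expR q * expR q.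
    by rewrite -expRD -mulrDl -natrD -mulnDl.
  rewrite eq.
  have h1 : normc (e w t) ^+ 2 <= r ^+ 2 * (2 * expR q).
    apply: (@le_trans _ _ ((r * q) ^+ 2)).
      by rewrite lerXn2r// nnegrE ?normc_ge0// mulr_ge0.
    by rewrite exprMn ler_wpM2l ?sqr_ge0// sqr_le_expR.
  have h2 : expR (normc (e w t)) <= expR q.
    by rewrite ler_expR (le_trans h)// ler_piMl.
  rewrite (_ : 8 * r ^+ 2 * (expR q * expR q) = 4 * (r ^+ 2 * (2 * expR q)) * expR q); last by ring.
  apply: ler_pM => //; rewrite ?expR_ge0 //.
    by rewrite mulr_ge0 // sqr_ge0.
  by rewrite ler_wpM2l.
apply: le_trans (le_integralRn cG wG) _.
by rewrite le_eqVlt; apply/orP; left; apply/eqP; ring.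
Qed.

End DS_estimates.

(** * Functions of K_1 *)

Section K1_functions.
Context {R : realType} {n : nat}.
Notation C := R[i].
Implicit Type phi : 'rV[R]_n -> C.

(** The inequality [rho k phi <= N] without suprema. *)
Definition rho_le k (N : R) phi := forall t (al : {ffun 'I_n -> nat}),
  (\sum_i al i <= k)%N ->
  expR (k%:R * enorm t) * normc (cmulti_partial al phi t) <= N.

Lemma rho_leP k N phi : (rho k phi <= N%:E)%E <-> rho_le k N phi.
Proof.
split=> [h t al alk|h].
  rewrite -lee_fin; apply: le_trans h; apply: ereal_sup_ubound.
  by exists (t, al).
by apply: ge_ereal_sup => _ [[t al] /= alk <-]; rewrite lee_fin; exact: h.
Qed.

Lemma rho_le_mono k k' N phi : (k <= k')%N -> rho_le k' N phi -> rho_le k N phi.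
Proof.
move=> kk' h t al alk; apply: le_trans (h t al (leq_trans alk kk')).
rewrite ler_wpM2r ?normc_ge0// ler_expR ler_wpM2r ?enorm_ge0// ler_nat//.
Qed.

(** The pure derivative of order [m] in the variable [t_j]. *)
Definition dpow (j : 'I_n) m phi : 'rV[R]_n -> C := fun t =>
  iter m (partial j) (ReF phi) t +i* iter m (partial j) (ImF phi) t.

Lemma dpow0 j phi : dpow j 0 phi = phi.
Proof. by apply/funext => t; rewrite /dpow /ReF /ImF /=; case: (phi t). Qed.

Lemma Cinfty_iter_partial (j : 'I_n) m (f : 'rV[R]_n -> R) :
  Cinfty f -> Cinfty (iter m (partial j) f).
Proof. by move=> cf; elim: m => //= m ih; exact: Cinfty_partial. Qed.

Lemma dpow_slice j m phi v s : cCinfty phi ->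
  cis_derive (fun y : R => dpow j m phi (v + y *: delta_mx 0 j)) s
    (dpow j m.+1 phi (v + s *: delta_mx 0 j)).
Proof.
move=> [c1 c2]; split => /=; apply: slice_is_derive => t.
  exact/Cinfty_derivable/Cinfty_iter_partial.
exact/Cinfty_derivable/Cinfty_iter_partial.
Qed.

Lemma csep_dpow j m phi : cCinfty phi -> csep (dpow j m phi).
Proof.
move=> [c1 c2] v i; apply: (@cis_derive_ccont R _ (fun s =>
  partial i (iter m (partial j) (ReF phi)) (v + s *: delta_mx 0 i) +i*
  partial i (iter m (partial j) (ImF phi)) (v + s *: delta_mx 0 i))) => s.
split => /=; apply: slice_is_derive => t.
  exact/Cinfty_derivable/Cinfty_iter_partial.
exact/Cinfty_derivable/Cinfty_iter_partial.
Qed.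

(** In the composite over all variables only the variable [j] acts. *)
Lemma multi_partial_pure j m (f : 'rV[R]_n -> R) :
  multi_partial [ffun i => if i == j then m else 0%N] f = iter m (partial j) f.
Proof.
rewrite /multi_partial; 
pose F (i : 'I_n) := @iter ('rV[R]_n -> R)
  ([ffun i => if i == j then m else 0%N] i) (partial i).
rewrite -/F.
have F0 (s : seq 'I_n) : j \notin s -> foldr F f s = f.
  elim: s => //= i s ih; rewrite inE negb_or => /andP[ij /ih ->].
  by rewrite /F ffunE eq_sym (negPf ij).
have : uniq (enum 'I_n) by exact: enum_uniq.
have : j \in enum 'I_n by rewrite mem_enum.
elim: (enum 'I_n) => //= i s ih; rewrite inE => /predU1P[<- /andP[js _]|js /andP[ns us]].
  by rewrite F0// /F ffunE eqxx.
rewrite ih// /F ffunE; case: eqP => // ij; by rewrite ij js in ns.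
Qed.

Lemma exp_le_dpow j m k N phi : rho_le (maxn k m) N phi -> exp_le k N (dpow j m phi).
Proof.
move=> h t; have := h t [ffun i => if i == j then m else 0%N].
rewrite (bigD1 j)//= ffunE eqxx big1 ?addn0 ?leq_maxr; last first.
  by move=> i /negPf ij; rewrite ffunE ij.
rewrite /cmulti_partial !multi_partial_pure => /(_ isT); apply: le_trans.
rewrite ler_wpM2r ?normc_ge0// ler_expR ler_wpM2r ?enorm_ge0// ler_nat//.
exact: leq_maxl.
Qed.

Lemma rho_lt_le k phi : (rho k phi < +oo)%E -> exists N, rho_le k N phi.
Proof.
move=> h; exists (fine (rho k phi)); apply/rho_leP.
rewrite fineK// fin_numElt h andbT.
apply: (@lt_le_trans _ _ (expR (k%:R * enorm (0 : 'rV[R]_n)) *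
    normc (cmulti_partial [ffun=> 0%N] phi 0))%:E).
  exact: ltNyr.
apply: ereal_sup_ubound; exists (0, [ffun=> 0%N]) => //=.
by rewrite big1// => i _; rewrite ffunE.
Qed.

Lemma testfun_dpow j m phi : phi \in @K1_pred R n -> testfun (dpow j m phi).
Proof.
rewrite inE => -[cphi rphi]; split; first exact: csep_dpow.
move=> k; have [N hN] := rho_lt_le (rphi (maxn k m)).
by exists N; exact: exp_le_dpow hN.
Qed.

End K1_functions.

(** In dimension 1 the line through the origin is the whole space, so the pure
    derivatives restricted to it form the sequence of derivatives. *)
Lemma K1_line_tower (R : realType) (g : R -> R[i]) : g \in @K1_line R ->
  exists2 hs, tower hs & hs 0%N = g.
Proof.
move=> gK; set G := (fun t : 'rV[R]_1 => g (t 0 0)).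
have GK : G \in @K1_pred R 1 by move: gK; rewrite inE.
have cG : cCinfty G by move: GK; rewrite inE => -[].
have E (y : R) : (0 : 'rV[R]_1) + y *: delta_mx 0 0 = const_mx y.
  by apply/rowP => j; rewrite !mxE add0r ord1 !eqxx mulr1.
exists (fun l x => dpow 0 l G (const_mx x)); last first.
  by apply/funext => x; rewrite dpow0 /G mxE.
split=> [l y|l k].
  have := @dpow_slice R 1 0 l G 0 y cG; rewrite E.
  by under eq_fun do rewrite E.
have [_ /(_ k)[M hM]] := testfun_dpow 0 l GK.
exists M => [|y]; first exact: exp_le_ge0 hM.
have := hM (const_mx y).
by rewrite /enorm big_ord_recl big_ord0 mxE addr0 sqrtr_sqr.
Qed.

Lemma tower_conj (R : realType) (hs : nat -> R -> R[i]) : tower hs ->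
  tower (fun l x => conjc (hs l x)).
Proof.
move=> [dh bh]; split=> [l y|l k].
  have [d1 d2] := dh l y; split.
    rewrite (_ : ReF _ = ReF (hs l)); last first.
      by apply/funext => x; rewrite /ReF; case: (hs l x).
    by move: d1; case: (hs l.+1 y).
  rewrite (_ : ImF _ = - ImF (hs l)); last first.
    by apply/funext => x; rewrite /ImF !fctE; case: (hs l x).
  rewrite (_ : complex.Im _ = - complex.Im (hs l.+1 y)); last by case: (hs l.+1 y).
  exact: is_deriveN.
have [M M0 hM] := bh l k; exists M => // y.
by rewrite normc_conj.
Qed.

(** * The transform maps K_1 to KU *)

Section D_operator.
Context {R : realType} {n : nat} (u : 'rV[R]_n) (u1 : enorm u = 1).
Context (hs : nat -> R -> R[i]) (th : tower hs).
Notation C := R[i].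

(** Each factor [z_j] is traded, by [dstft_parts], for one more derivative of [phi]
    in [t_j] or of the window; the factors [1 / (2 pi)] and [u_j] are at most 1 in
    modulus. *)
Lemma dstft_zpow k j q : forall l m, exists K Cst, 0 <= Cst /\
  forall phi N, phi \in @K1_pred R n -> rho_le K N phi ->
  forall x (z : 'rV[C]_n), strip k z ->
  expR (k%:R * `|x|) *
    (normc (z 0 j) ^+ q * normc (dstft (hs l) u (dpow j m phi) x z)) <= Cst * N.
Proof.
elim: q => [|q ih] l m.
  have [Mh Mh0 hM] := tower_bound th l k.
  exists (maxn (9 * k * n + n) m), (2 * Mh * 2 ^+ n * pi ^+ n); split.
    by rewrite !mulr_ge0 ?exprn_ge0 ?pi_ge0.
  move=> phi N pK hN x z kz; rewrite expr0 mul1r.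
  apply: (dstft_bound u1 th x _ hM (exp_le_dpow j hN) kz).
  by apply: csep_dpow; move: pK; rewrite inE => -[].
have [K1 [C1 [C10 h1]]] := ih l m.+1; have [K2 [C2 [C20 h2]]] := ih l.+1 m.
exists (maxn K1 K2), (C1 + C2); split; first exact: addr_ge0.
move=> phi N pK hN x z kz.
have {h1} := h1 phi N pK (rho_le_mono (leq_maxl _ _) hN) x z kz.
have {h2} := h2 phi N pK (rho_le_mono (leq_maxr _ _) hN) x z kz.
set A := normc (dstft (hs l.+1) _ _ _ _); set B := normc (dstft (hs l) _ _ _ _).
move=> h2 h1.
have cphi : cCinfty phi by move: pK; rewrite inE => -[].
have := dstft_parts u1 th l z x (testfun_dpow j m pK) (testfun_dpow j m.+1 pK)
  (fun v s => dpow_slice j m v s cphi).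
move=> /(congr1 (@ComplexField.Normc.normc R)).
rewrite !ComplexField.Normc.normcM normc_twopii => E.
set D := normc (dstft (hs l) u (dpow j m phi) x z) in E *.
have zD : normc (z 0 j) * D <= B + A.
  have h : 2 * pi * normc (z 0 j) * D <= B + A.
    rewrite E; apply: le_trans (normcD _ _) _; rewrite lerD2l.
    rewrite ComplexField.Normc.normcM normc_real ler_piMl ?normc_ge0//.
    by rewrite -u1 coord_le_enorm.
  apply: le_trans h; rewrite -mulrA ler_peMl ?mulr_ge0 ?normc_ge0//.
  by have := @pihalf_ge1 R; lra.
have e0 : 0 <= expR (k%:R * `|x|) * normc (z 0 j) ^+ q.
  by rewrite mulr_ge0 ?expR_ge0 ?exprn_ge0 ?normc_ge0.
rewrite exprSr (_ : _ * (_ * _ * D) =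
  expR (k%:R * `|x|) * normc (z 0 j) ^+ q * (normc (z 0 j) * D)); last by ring.
apply: le_trans (ler_wpM2l e0 zD) _.
by rewrite mulrDr mulrDl; apply: lerD; rewrite -mulrA.
Qed.

(** If [M] is the maximum of 1 and the [a j], then [1 + \sum_j a j <= (n + 1) M],
    and [M ^ k X] is bounded by one of the hypotheses. *)
Lemma poly_weight_le (a : 'I_n -> R) k X B : 0 <= X -> (forall j, 0 <= a j) -> X <= B ->
  (forall j, a j ^+ k * X <= B) ->
  (1 + \sum_j a j) ^+ k * X <= n.+1%:R ^+ k * B.
Proof.
move=> X0 a0 XB aB.
have [M [M1 aM MB]] : exists M, [/\ 1 <= M, forall j, a j <= M & M ^+ k * X <= B].
  have : forall s : seq 'I_n, exists M,
      [/\ 1 <= M, forall j, j \in s -> a j <= M & M ^+ k * X <= B].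
    elim=> [|i s [M [M1 aM MB]]]; first by exists 1; split; rewrite ?expr1n ?mul1r.
    have [iM|/ltW Mi] := leP (a i) M.
      by exists M; split => // j; rewrite inE => /predU1P[->//|/aM].
    exists (a i); split => //; first exact: le_trans Mi.
    by move=> j; rewrite inE => /predU1P[->//|/aM /le_trans]; apply.
  move=> /(_ (enum 'I_n)) [M [M1 aM MB]]; exists M; split => // j.
  by apply: aM; rewrite mem_enum.
have M0 : 0 <= M by exact: le_trans M1.
apply: (@le_trans _ _ ((n.+1%:R * M) ^+ k * X)); last first.
  by rewrite exprMn -mulrA ler_wpM2l// exprn_ge0.
apply: ler_wpM2r => //; apply: lerXn2r.
- by rewrite nnegrE addr_ge0// sumr_ge0.
- by rewrite nnegrE mulr_ge0.
rewrite -natr1 mulrDl mul1r addrC lerD// mulr_natl.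
rewrite (_ : M *+ n = \sum_(j < n) M); last by rewrite sumr_const card_ord.
by apply: ler_sum => j _; exact: aM.
Qed.

Lemma sqnormc_weight_le (z : 'rV[C]_n) k :
  (1 + sqnormc z) `^ (k%:R / 2) <= (1 + \sum_j normc (z 0 j)) ^+ k.
Proof.
set S := (X in _ <= X ^+ k).
have s0 : 0 <= \sum_j normc (z 0 j) by apply: sumr_ge0 => j _; exact: normc_ge0.
have S1 : 0 <= S by rewrite addr_ge0.
have -> : S ^+ k = (S ^+ 2) `^ (k%:R / 2).
  by rewrite -[S ^+ 2]powR_mulrn// -powRrM mulrC divfK// powR_mulrn.
apply: ge0_ler_powR; rewrite ?nnegrE ?sqr_ge0 ?divr_ge0//.
  by rewrite addr_ge0// sumr_ge0// => j _; rewrite sqr_ge0.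
rewrite /S sqrrD expr1n mul1r -addrA lerD2l.
apply: (@le_trans _ _ ((\sum_j normc (z 0 j)) ^+ 2)); last by rewrite lerDr mulrn_wge0.
rewrite expr2 mulr_suml /sqnormc; apply: ler_sum => j _.
rewrite expr2 ler_wpM2l ?normc_ge0// (bigD1 j)//= lerDl.
by apply: sumr_ge0 => i _; exact: normc_ge0.
Qed.

Lemma enorm1_dim m (v : 'rV[R]_m) : enorm v = 1 -> (0 < m)%N.
Proof.
case: m v => // v; rewrite /enorm big_ord0 sqrtr0 => /esym/eqP.
by rewrite oner_eq0.
Qed.

(** The constants obtained for the various [j] are combined by taking the maximum of
    the orders and the sum of the factors. *)
Lemma dstft_KU_bound k l : (0 < n)%N -> exists K Cst, 0 <= Cst /\
  forall phi N, phi \in @K1_pred R n -> rho_le K N phi ->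
  forall x (z : 'rV[C]_n), strip k z ->
  expR (k%:R * `|x|) * (1 + sqnormc z) `^ (k%:R / 2) *
    normc (dstft (hs l) u phi x z) <= Cst * N.
Proof.
move=> n0.
have hj j := dstft_zpow k j k l 0.
have [K0 [C0 [C00 h0]]] := dstft_zpow k (Ordinal n0) 0 l 0.
have [Kf] := choice hj => /choice[Cf] hKC.
pose K := maxn K0 (\max_j Kf j); pose Cst := C0 + \sum_j Cf j.
have Cf0 j : 0 <= Cf j by have [] := hKC j.
have s0 : 0 <= \sum_j Cf j by exact: sumr_ge0.
exists K, (n.+1%:R ^+ k * Cst); split; first by rewrite mulr_ge0// ?exprn_ge0// addr_ge0.
move=> phi N pK hN x z kz.
have N0 : 0 <= N.
  apply: le_trans (hN 0 [ffun=> 0%N] _); last by rewrite big1// => i _; rewrite ffunE.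
  by rewrite mulr_ge0 ?expR_ge0 ?normc_ge0.
set X := expR (k%:R * `|x|) * normc (dstft (hs l) u phi x z).
have X0 : 0 <= X by rewrite mulr_ge0 ?expR_ge0 ?normc_ge0.
apply: (@le_trans _ _ ((1 + \sum_j normc (z 0 j)) ^+ k * X)).
  rewrite mulrAC mulrC; apply: ler_wpM2r => //; exact: sqnormc_weight_le.
rewrite -mulrA; apply: poly_weight_le => //.
- by move=> j; exact: normc_ge0.
- have := h0 phi N pK (rho_le_mono (leq_maxl _ _) hN) x z kz.
  rewrite dpow0 expr0 mul1r => /le_trans; apply.
  by rewrite ler_wpM2r// lerDl.
move=> j; have [_ hj'] := hKC j.
have jK : (Kf j <= K)%N by rewrite leq_max leq_bigmax orbT.
have := hj' phi N pK (rho_le_mono jK hN) x z kz.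
rewrite dpow0 /X mulrCA => /le_trans; apply.
rewrite ler_wpM2r// /Cst (bigD1 j)//= addrCA lerDl addr_ge0//.
by rewrite sumr_ge0.
Qed.

Lemma dstft_in_KU phi : phi \in @K1_pred R n ->
  (fun xz => dstft (hs 0) u phi xz.1 xz.2) \in @KU_pred R n.
Proof.
move=> pK.
have n0 : (0 < n)%N by exact: enorm1_dim u1.
have tp : testfun phi.
  by rewrite -(dpow0 (Ordinal n0) phi); exact: testfun_dpow.
rewrite inE; split.
- by move=> z; exact: cCinfty1_dstft.
- by move=> x; exact: entire_dstft.
move=> [k l]; have [K [Cst [C0 h]]] := dstft_KU_bound k l n0.
have [N hN] : exists N, rho_le K N phi.
  by move: pK; rewrite inE => -[_ /(_ K)]; exact: rho_lt_le.
apply: (@le_lt_trans _ _ (Cst * N)%:E); last exact: ltry.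
apply: ge_ereal_sup => _ [[x z] /= kz <-]; rewrite lee_fin.
rewrite [X in _ * X](_ : _ = normc (dstft (hs l) u phi x z)); first exact: h.
exact: normc_cderive1n_dstft.
Qed.

End D_operator.

(** * Holomorphic functions of one variable and contour shift *)

Section holomorphic.
Context {R : realType}.
Notation C := R[i].
Notation leb := (@lebesgue_measure R).
Implicit Types f g : C -> C.

(** Complex differentiability in terms of the real-valued modulus, so that real and
    imaginary parts can be estimated directly. *)
Definition hol f := forall s0, exists D : C, forall e : R, 0 < e ->
  exists2 d : R, 0 < d & forall s, normc s < d ->
    normc (f (s0 + s) - f s0 - D * s) <= e * normc s.

Lemma hol_lip f s0 : hol f -> exists2 L : R, 0 < L & exists2 d : R, 0 < d &
  forall s, normc s < d -> normc (f (s0 + s) - f s0) <= L * normc s.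
Proof.
move=> /(_ s0)[D /(_ 1 ltr01)[d d0 hD]].
exists (normc D + 1); first by rewrite ltr_wpDl ?normc_ge0.
exists d => // s /hD h.
rewrite -[X in normc X](subrK (D * s)); apply: le_trans (normcD _ _) _.
by rewrite ComplexField.Normc.normcM mulrDl addrC lerD2l.
Qed.

Lemma hol_quadratic f : (forall s0, exists D : C, exists2 M : R, 0 <= M &
    forall s, normc s <= 1 -> normc (f (s0 + s) - f s0 - D * s) <= M * normc s ^+ 2) ->
  hol f.
Proof.
move=> h s0; have [D [K K0 hD]] := h s0; exists D => e e0.
have K1 : 0 < K + 1 by rewrite ltr_wpDl.
exists (Num.min 1 (e / (K + 1))); first by rewrite lt_min ltr01 divr_gt0.
move=> s; rewrite lt_min => /andP[s1]; rewrite ltr_pdivlMr// => se.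
apply: le_trans (hD _ (ltW s1)) _; rewrite expr2 mulrA ler_wpM2r ?normc_ge0//.
apply: le_trans (ltW se); rewrite mulrC ler_wpM2l ?normc_ge0//.
by rewrite lerDl.
Qed.

Lemma hol_cst (c : C) : hol (fun=> c).
Proof.
apply: hol_quadratic => s0; exists 0, 0 => // s _.
by rewrite subrr mul0r subr0 ComplexField.Normc.normc0 mul0r.
Qed.

Lemma hol_affine (a b : C) : hol (fun s => a + s * b).
Proof.
apply: hol_quadratic => s0; exists b, 0 => // s _.
rewrite (_ : _ - _ = 0) ?ComplexField.Normc.normc0 ?mul0r//; ring.
Qed.

Lemma hol_cexp (a b : C) : hol (fun s => cexp (a + s * b)).
Proof.
apply: hol_quadratic => s0; pose w := a + s0 * b.
exists (cexp w * b), (normc (cexp w) * (4 * normc b ^+ 2 * expR (normc b))).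
  by rewrite !mulr_ge0 ?normc_ge0 ?expR_ge0 ?exprn_ge0 ?normc_ge0.
move=> s s1.
have -> : cexp (a + (s0 + s) * b) - cexp (a + s0 * b) - cexp w * b * s =
    cexp w * (cexp (s * b) - 1 - s * b).
  rewrite (_ : a + (s0 + s) * b = w + s * b); last by rewrite /w; ring.
  by rewrite cexpD -/w; ring.
rewrite ComplexField.Normc.normcM -[leRHS]mulrA; apply: ler_wpM2l; first exact: normc_ge0.
apply: le_trans (normc_cexpB1 _) _; rewrite ComplexField.Normc.normcM exprMn.
have eb : expR (normc s * normc b) <= expR (normc b).
  by rewrite ler_expR ler_piMl ?normc_ge0.
rewrite [leRHS](_ : _ = 4 * (normc s ^+ 2 * normc b ^+ 2) * expR (normc b)); last by ring.
by rewrite ler_wpM2l// !mulr_ge0 ?exprn_ge0 ?normc_ge0.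
Qed.

Lemma holM f g : hol f -> hol g -> hol (fun s => f s * g s).
Proof.
move=> hf hg s0.
have [L1 L10 [d1 d10 l1]] := hol_lip s0 hf; have [L2 L20 [d2 d20 l2]] := hol_lip s0 hg.
have [D hD] := hf s0; have [E hE] := hg s0.
exists (D * g s0 + f s0 * E) => e e0.
pose K := normc (g s0) + normc (f s0) + L1 * L2.
have K0 : 0 < K by rewrite ltr_wpDl ?addr_ge0 ?normc_ge0// mulr_gt0.
have eK : 0 < e / K by rewrite divr_gt0.
have [d3 d30 h3] := hD _ eK; have [d4 d40 h4] := hE _ eK.
exists (Num.min (Num.min d1 d2) (Num.min (Num.min d3 d4) (e / K))).
  by rewrite !lt_min d10 d20 d30 d40 eK.
move=> s; rewrite !lt_min => /andP[/andP[s1 s2] /andP[/andP[s3 s4] s5]].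
have {}l1 := l1 s s1; have {}l2 := l2 s s2.
have {}h3 := h3 s s3; have {}h4 := h4 s s4.
have -> : f (s0 + s) * g (s0 + s) - f s0 * g s0 - (D * g s0 + f s0 * E) * s =
    (f (s0 + s) - f s0 - D * s) * g s0 + f s0 * (g (s0 + s) - g s0 - E * s) +
    (f (s0 + s) - f s0) * (g (s0 + s) - g s0) by ring.

have n3 (X Y Z : C) : normc (X + Y + Z) <= normc X + normc Y + normc Z.
  by rewrite (le_trans (normcD _ _))// lerD2r normcD.
apply: le_trans (n3 _ _ _) _; rewrite !ComplexField.Normc.normcM.
have E1 : e * normc s = e / K * normc s * normc (g s0) +
    normc (f s0) * (e / K * normc s) + (L1 * L2) * (e / K * normc s).
  rewrite -{1}(divfK (lt0r_neq0 K0) e) {2}/K; ring.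
rewrite E1; apply: lerD; first by apply: lerD;
  [rewrite ler_wpM2r ?normc_ge0|rewrite ler_wpM2l ?normc_ge0].
apply: le_trans (ler_pM (normc_ge0 _) (normc_ge0 _) l1 l2) _.
rewrite mulrACA; apply: ler_wpM2l; first by rewrite mulr_ge0 ?ltW.
by apply: ler_wpM2r; [exact: normc_ge0|exact: ltW].
Qed.

Lemma continuous_loclip (f : R -> R) : (forall x0, exists2 L : R, 0 < L &
    exists2 d : R, 0 < d & forall x, `|x - x0| < d -> `|f x - f x0| <= L * `|x - x0|) ->
  continuous f.
Proof.
move=> h x0; have [L L0 [d d0 hL]] := h x0.
apply/cvgrPdist_le => e e0.
have eL : 0 < e / L by rewrite divr_gt0.
apply/nbhs_ballP; exists (Num.min d (e / L)) => /=; first by rewrite lt_min d0.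
move=> x; rewrite /ball /= lt_min distrC => /andP[xd xe].
rewrite distrC; apply: le_trans (hL _ xd) _.
by rewrite -ler_pdivlMl// mulrC ltW.
Qed.

(** The restriction to a real line [a + x b] of the complex plane. *)
Lemma hol_ccont f (a b : C) : hol f -> ccont (fun x : R => f (a + x%:C * b)).
Proof.
move=> hf.
have main x0 : exists2 L : R, 0 < L & exists2 d : R, 0 < d & forall x : R, `|x - x0| < d ->
    normc (f (a + x%:C * b) - f (a + x0%:C * b)) <= L * `|x - x0|.
  have [L L0 [d d0 hL]] := hol_lip (a + x0%:C * b) hf.
  have b1 : 0 < normc b + 1 by rewrite ltr_wpDl ?normc_ge0.
  exists (L * (normc b + 1)); first exact: mulr_gt0.
  exists (d / (normc b + 1)); first exact: divr_gt0.
  move=> x; rewrite ltr_pdivlMr// => xd.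
  have xb : normc ((x - x0)%:C * b) <= `|x - x0| * (normc b + 1).
    by rewrite ComplexField.Normc.normcM normc_real ler_wpM2l// lerDl.
  have := hL _ (le_lt_trans xb xd).
  have -> : a + x0%:C * b + (x - x0)%:C * b = a + x%:C * b.
    by rewrite (rmorphB (real_complex R)) /=; ring.
  move=> /le_trans; apply.
  by rewrite -mulrA [(_ + 1) * _]mulrC ler_wpM2l// ltW.
split; apply: continuous_loclip => x0; have [L L0 [d d0 h]] := main x0;
  exists L => //; exists d => // x /h; apply: le_trans.
  by rewrite /ReF -ReN -ReD Re_le_normc.
by rewrite /ImF -ImN -ImD Im_le_normc.
Qed.

(** The Cauchy-Riemann equations say that [Re f dx - Im f dy] is closed. *)
Lemma hol_shiftRe f K (S : R) : hol f -> 0 <= S ->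
  (forall x y : R, `|y| <= S -> normc (f (x +i* y)) <= K * (1 + x ^+ 2)^-1) ->
  forall s : R, `|s| <= S ->
  \int[leb]_x complex.Re (f (x +i* s)) = \int[leb]_x complex.Re (f (x +i* 0)).
Proof.
move=> hf S0 fK s sS.
pose P x y := complex.Re (f (x +i* y)); pose Q x y := complex.Im (f (x +i* y)).
have Ex (x y : R) : x +i* y = 0 +i* y + x%:C * 1.
  by apply/eqP; rewrite eq_complex ReD ImD ReM ImM /=; apply/andP; split; apply/eqP; ring.
have Ey (x y : R) : x +i* y = x +i* 0 + y%:C * (0 +i* 1).
  by apply/eqP; rewrite eq_complex ReD ImD ReM ImM /=; apply/andP; split; apply/eqP; ring.
have cP y : continuous (fun x => P x y).
  rewrite /P; under eq_fun do rewrite Ex.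
  by have [] := hol_ccont (0 +i* y) 1 hf.
have cQ x : continuous (Q x).
  rewrite /Q; under eq_fun do rewrite Ey.
  by have [] := hol_ccont (x +i* 0) (0 +i* 1) hf.
have dPQ x0 y0 : exists p1 p2 q2, forall e, 0 < e ->
     exists2 dl, 0 < dl & forall x y, `|x - x0| < dl -> `|y - y0| < dl ->
       `|P x y - P x0 y0 - p1 * (x - x0) - p2 * (y - y0)| <=
         e * (`|x - x0| + `|y - y0|) /\
       `|Q x y - Q x0 y0 + p2 * (x - x0) - q2 * (y - y0)| <=
         e * (`|x - x0| + `|y - y0|).
  have [D hD] := hf (x0 +i* y0).
  exists (complex.Re D), (- complex.Im D), (complex.Re D) => e e0.
  have [d d0 h] := hD e e0; exists (d / 2); first by rewrite divr_gt0.
  move=> x y xd yd.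
  have nxy : normc ((x - x0) +i* (y - y0)) <= `|x - x0| + `|y - y0|.
    exact: normc_le_ReIm.
  have := h ((x - x0) +i* (y - y0)).
  have -> : x0 +i* y0 + ((x - x0) +i* (y - y0)) = x +i* y.
    by apply/eqP; rewrite eq_complex ReD ImD /=; apply/andP; split; apply/eqP; ring.
  have nd : normc ((x - x0) +i* (y - y0)) < d.
    by apply: le_lt_trans nxy _; rewrite [d]splitr ltrD.
  move=> /(_ nd) {}h.
  have {}h := le_trans h (ler_wpM2l (ltW e0) nxy).
  split.
    apply: le_trans h; apply: le_trans (Re_le_normc _).
    rewrite !(ReD, ReN, ReM) /= le_eqVlt; apply/orP; left; apply/eqP; congr `|_|.
    rewrite /P; ring.
  apply: le_trans h; apply: le_trans (Im_le_normc _).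
  rewrite !(ImD, ImN, ImM) /= le_eqVlt; apply/orP; left; apply/eqP; congr `|_|.
  rewrite /Q; ring.
have PQK c d x y : `|c| <= S -> `|d| <= S -> c <= y <= d ->
    `|P x y| <= K * (1 + x ^+ 2)^-1 /\ `|Q x y| <= K * (1 + x ^+ 2)^-1.
  move=> /ler_normlP[c1 c2] /ler_normlP[d1 d2] /andP[cy yd].
  have yS : `|y| <= S by apply/ler_normlP; split; lra.
  split; apply: le_trans (fK x y yS); [exact: Re_le_normc|exact: Im_le_normc].
have s00 : `|0 : R| <= S by rewrite normr0.
have [s0|/ltW s0] := leP 0 s.
  apply/esym; exact: (integral_shift s0 cP cQ dPQ (fun x y => @PQK 0 s x y s00 sS)).
exact: (integral_shift s0 cP cQ dPQ (fun x y => @PQK s 0 x y sS s00)).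
Qed.

(** The imaginary part of [f] is the real part of [- i f]. *)
Lemma hol_shiftIm f K (S : R) : hol f -> 0 <= S ->
  (forall x y : R, `|y| <= S -> normc (f (x +i* y)) <= K * (1 + x ^+ 2)^-1) ->
  forall s : R, `|s| <= S ->
  \int[leb]_x complex.Im (f (x +i* s)) = \int[leb]_x complex.Im (f (x +i* 0)).
Proof.
move=> hf S0 fK s sS; pose g s := (0 -i* 1) * f s.
have hg : hol g by apply: holM => //; exact: hol_cst.
have Eg z : complex.Re (g z) = complex.Im (f z).
  by rewrite /g ReM /= mul0r sub0r mulN1r opprK.
have gK x y : `|y| <= S -> normc (g (x +i* y)) <= K * (1 + x ^+ 2)^-1.
  move=> yS; rewrite /g ComplexField.Normc.normcM /= expr0n add0r sqrrN expr1n sqrtr1 mul1r.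
  exact: fK.
have := hol_shiftRe hg S0 gK sS.
by under eq_Rintegral do rewrite Eg; under [in RHS]eq_Rintegral do rewrite Eg.
Qed.

End holomorphic.

(** * Functions of KU *)

Section admissible.
Context {R : realType} {n : nat}.
Notation C := R[i].
Implicit Type Phi : R * 'rV[C]_n -> C.

Definition row_tail (p : 'rV[R]_n.+1) : 'rV[R]_n := \row_k p 0 (lift ord0 k).

Lemma row_tail_consr x (v : 'rV[R]_n) : row_tail (consr x v) = v.
Proof. by apply/rowP => k; rewrite mxE consrS. Qed.

Lemma consr_row_tail (p : 'rV[R]_n.+1) : consr (p 0 ord0) (row_tail p) = p.
Proof.
by apply/rowP => j; case: (unliftP ord0 j) => [k|] ->; rewrite ?consr0// consrS mxE.
Qed.

Lemma slice0E (p : 'rV[R]_n.+1) y :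
  p + y *: delta_mx 0 ord0 = consr (p 0 ord0 + y) (row_tail p).
Proof. by rewrite -{1}(consr_row_tail p) consr_slice0. Qed.

Lemma sliceSE (p : 'rV[R]_n.+1) y k :
  p + y *: delta_mx 0 (lift ord0 k) =
  consr (p 0 ord0) (row_tail p + y *: delta_mx 0 k).
Proof. by rewrite -{1}(consr_row_tail p) consr_sliceS. Qed.

Lemma toC_slice (v : 'rV[R]_n) y k :
  toC (v + y *: delta_mx 0 k) = toC v + y%:C *: delta_mx 0 k.
Proof.
apply/rowP => i; rewrite !mxE rmorphD rmorphM; congr (_ + _ * _).
by case: (_ && _).
Qed.

(** The norm of index [(k, 0)]: derivatives in [x] are not involved in the estimates
    of the synthesis map. *)
Definition decay_le k (M : R) Phi := forall x z, strip k z ->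
  expR (k%:R * `|x|) * (1 + sqnormc z) `^ (k%:R / 2) * normc (Phi (x, z)) <= M.

(** A class containing KU which is visibly stable under multiplication by the
    coordinates [z_j]; smoothness in [x] is weakened to continuity. *)
Record adm Phi := Adm {
  adm_x : forall z, ccont (fun x => Phi (x, z)) ;
  adm_z : forall x z j, hol (fun s => Phi (x, z + s *: delta_mx 0 j)) ;
  adm_b : forall k, exists M, decay_le k M Phi }.

Lemma sqnormc_ge0 (z : 'rV[C]_n) : 0 <= sqnormc z.
Proof. by apply: sumr_ge0 => j _; exact: sqr_ge0. Qed.

Lemma strip0 k : strip k (0 : 'rV[C]_n).
Proof. by move=> j; rewrite mxE normr0. Qed.

Lemma decay_le_ge0 k M Phi : decay_le k M Phi -> 0 <= M.
Proof.
move=> /(_ 0 0 (strip0 k)); apply: le_trans.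
by rewrite !mulr_ge0 ?expR_ge0 ?powR_ge0 ?normc_ge0.
Qed.

Lemma decay_le_mono k k' M Phi : (k <= k')%N -> decay_le k' M Phi -> decay_le k M Phi.
Proof.
move=> kk' h x z kz; apply: le_trans (h x z (strip_le kk' kz)).
rewrite ler_wpM2r ?normc_ge0// ler_pM ?expR_ge0 ?powR_ge0//.
  by rewrite ler_expR ler_wpM2r// ler_nat.
apply: ler_powR; first by rewrite lerDl sqnormc_ge0.
by rewrite ler_wpM2r// ler_nat.
Qed.

Lemma cderive1n0 (f : R -> C) x : cderive1n 0 f x = f x.
Proof. by rewrite /cderive1n /= /ReF /ImF; case: (f x). Qed.

Lemma rhoU_decay_le k (N : R) Phi : (rhoU (k, 0%N) Phi <= N%:E)%E -> decay_le k N Phi.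
Proof.
move=> h x z kz; rewrite -lee_fin; apply: le_trans h.
apply: ereal_sup_ubound; exists (x, z); first exact: kz.
by congr (_ * _)%:E; congr (@ComplexField.Normc.normc R _); exact: cderive1n0.
Qed.

Lemma le_rhoU kl Phi x z : strip kl.1 z ->
  ((expR (kl.1%:R * `|x|) * (1 + sqnormc z) `^ (kl.1%:R / 2) *
    normc (cderive1n kl.2 (fun y => Phi (y, z)) x))%:E <= rhoU kl Phi)%E.
Proof. by move=> kz; apply: ereal_sup_ubound; exists (x, z). Qed.

Lemma rhoU_fin kl Phi : (rhoU kl Phi < +oo)%E ->
  (rhoU kl Phi <= (fine (rhoU kl Phi))%:E)%E.
Proof.
move=> h; rewrite fineK// fin_numElt h andbT.
exact: lt_le_trans (ltNyr _) (le_rhoU Phi 0 (strip0 kl.1)).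
Qed.

Lemma gt0_realE (c : C) : 0 < c -> c = (complex.Re c)%:C /\ 0 < complex.Re c.
Proof. by case: c => a b; rewrite ltcE /= => /andP[/eqP -> ?]. Qed.

Lemma KU_adm Phi : Phi \in @KU_pred R n -> adm Phi.
Proof.
rewrite inE => -[sm en rh]; split.
- move=> z; have h := sm z 0%N; split => x; have [d1 d2] := h x.
    exact/differentiable_continuous/derivable1_diffP.
  exact/differentiable_continuous/derivable1_diffP.
- move=> x z j s0; have [D hD] := differentiable_line j (en x (z + s0 *: delta_mx 0 j)).
  exists D => e e0; have [d d0 h] := hD e%:C (etrans (ltcR _ _) e0).
  have [dE dr] := gt0_realE d0.
  exists (complex.Re d) => // s sd.
  have := h s; rewrite dE normC_normc ltcR => /(_ sd).
  rewrite (_ : z + s0 *: _ + s *: _ = z + (s0 + s) *: delta_mx 0 j); last first.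
    by rewrite scalerDl addrA.
  have -> : e%:C * (normc s)%:C = (e * normc s)%:C.
    by rewrite (rmorphM (real_complex R)).
  by rewrite normC_normc lecR.
- move=> k; exists (fine (rhoU (k, 0%N) Phi)); apply: rhoU_decay_le.
  exact: rhoU_fin.
Qed.

Definition mul_coord (j : 'I_n) Phi : R * 'rV[C]_n -> C := fun xz => xz.2 0 j * Phi xz.

Lemma normc_coord_le (z : 'rV[C]_n) j : normc (z 0 j) <= (1 + sqnormc z) `^ 2^-1.
Proof.
have s1 : 0 <= 1 + sqnormc z by rewrite addr_ge0// sqnormc_ge0.
rewrite powR12_sqrt// -[leLHS]ger0_norm ?normc_ge0// -sqrtr_sqr ler_wsqrtr//.
rewrite /sqnormc (bigD1 j)//= addrCA lerDl addr_ge0//.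
by apply: sumr_ge0 => i _; exact: sqr_ge0.
Qed.

(** [|z_j|] is at most the square root of [1 + |z| ^ 2], that is, half a unit of the
    exponent [k / 2]. *)
Lemma decay_le_mul_coord k M j Phi : decay_le k.+1 M Phi -> decay_le k M (mul_coord j Phi).
Proof.
move=> h x z kz; apply: le_trans (h x z (strip_le (leqnSn k) kz)).
rewrite /mul_coord /= ComplexField.Normc.normcM mulrA ler_wpM2r ?normc_ge0// -mulrA.
apply: ler_pM; rewrite ?expR_ge0 ?mulr_ge0 ?powR_ge0 ?normc_ge0//.
  by rewrite ler_expR ler_wpM2r// ler_nat.
have s1 : 1 + sqnormc z != 0 by rewrite gt_eqF// ltr_wpDr// sqnormc_ge0.
rewrite -[k.+1%:R]natr1 mulrDl mul1r powRD ?s1 ?implybT//.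
by rewrite ler_wpM2l ?powR_ge0// normc_coord_le.
Qed.

Lemma adm_mul_coord j Phi : adm Phi -> adm (mul_coord j Phi).
Proof.
move=> [ax az ab]; split.
- by move=> z; apply: ccontM; [exact: ccont_cst|exact: ax].
- move=> x z i; apply: (@holM _ (fun s => (z + s *: delta_mx 0 i) 0 j)); last exact: az.
  under eq_fun do rewrite !mxE; exact: hol_affine.
- by move=> k; have [M hM] := ab k.+1; exists M; exact: decay_le_mul_coord.
Qed.

(** [1 + x ^ 2 <= 2 exp(k |x|)] and the product of the [1 + xi_j ^ 2] is at most
    [(1 + |z| ^ 2) ^ n], where [n <= k / 2]. *)
Lemma decay_le_weight k M Phi x z (xi : 'rV[R]_n) : (2 * n < k)%N -> decay_le k M Phi ->
  strip k z -> (forall j, complex.Re (z 0 j) = xi 0 j) ->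
  normc (Phi (x, z)) <= 2 * M * weight (consr x xi).
Proof.
move=> nk h kz zx; rewrite weight_consr.
have k1 : (1 <= k)%N by exact: leq_ltn_trans nk.
have w0 : 0 < \prod_j (1 + xi 0 j ^+ 2) by apply: prodr_gt0 => j _; exact: oneDsq_gt0.
rewrite /weight prodfV mulrA ler_pdivlMr// ler_pdivlMr ?oneDsq_gt0//.
have s0 := sqnormc_ge0 z.
have h1 : 1 + x ^+ 2 <= 2 * expR (k%:R * `|x|).
  apply: le_trans (oneDsq_le_expR x) _; rewrite ler_wpM2l// ler_expR.
  by rewrite ler_peMl// ler1n.
have h2 : \prod_j (1 + xi 0 j ^+ 2) <= (1 + sqnormc z) `^ (k%:R / 2).
  apply: (@le_trans _ _ (\prod_(j < n) (1 + sqnormc z))).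
    apply: ler_prod => j _; rewrite ltW ?oneDsq_gt0//= lerD2l /sqnormc (bigD1 j)//=.
    apply: ler_wpDr; first by apply: sumr_ge0 => i _; exact: sqr_ge0.
    rewrite -real_normK ?num_real// lerXn2r ?nnegrE ?normc_ge0//.
    by rewrite -zx; exact: Re_le_normc.
  rewrite prodr_const card_ord -powR_mulrn; last by rewrite addr_ge0.
  apply: ler_powR; first by rewrite lerDl.
  by rewrite ler_pdivlMr// -natrM ler_nat mulnC ltnW.
have := h x z kz; set A := normc _ => hA.
have A0 : 0 <= A by exact: normc_ge0.
apply: (@le_trans _ _ (A * (1 + sqnormc z) `^ (k%:R / 2) * (2 * expR (k%:R * `|x|)))).
  apply: ler_pM => //; [by rewrite mulr_ge0// ltW|exact/ltW/oneDsq_gt0|].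
  by rewrite ler_wpM2l.
rewrite [leLHS](_ : _ = 2 * (expR (k%:R * `|x|) * (1 + sqnormc z) `^ (k%:R / 2) * A)).
  by rewrite ler_wpM2l.
by ring.
Qed.

End admissible.

(** * Contour shift in the synthesis integral *)

Section contour_shift.
Context {R : realType} {n : nat} (u : 'rV[R]_n) (u1 : enorm u = 1).
Context (hs : nat -> R -> R[i]) (th : tower hs).
Notation C := R[i].
Notation leb := (@lebesgue_measure R).
Implicit Type Phi : R * 'rV[C]_n -> C.

(** The integrand as a function of [p = (x, xi)] in R^(n+1), with [xi] moved to
    [xi + eta] in C^n; [eta = 0] is the original one. *)
Definition DSs_integrand (h : R -> C) Phi (t : 'rV[R]_n) (eta : 'rV[C]_n)
    (p : 'rV[R]_n.+1) : C :=
  Phi (p 0 ord0, toC (row_tail p) + eta) * h (dot u t - p 0 ord0) *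
  cexp (twopii R * dot (toC (row_tail p) + eta) (toC t)).

Lemma dot_toC (x t : 'rV[R]_n) : dot (toC x) (toC t) = (dot x t)%:C.
Proof.
rewrite /dot (rmorph_sum (real_complex R)) /=; apply: eq_bigr => j _.
by rewrite !mxE (rmorphM (real_complex R)).
Qed.

Lemma cdotDl (z w : 'rV[C]_n) t : dot (z + w) t = dot z t + dot w t.
Proof. by rewrite /dot -big_split /=; apply: eq_bigr => j _; rewrite mxE mulrDl. Qed.

Lemma cdotZ (w : C) j (t : 'rV[C]_n) : dot (w *: delta_mx 0 j) t = w * t 0 j.
Proof.
rewrite /dot (bigD1 j)//= !mxE !eqxx mulr1 big1 ?addr0// => i /negPf ij.
by rewrite !mxE ij mulr0 mul0r.
Qed.

(** Moving along a real line in the variable [xi_k] is the same as changing [eta],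
    so that this line and its parallels fill the complex line used for the contour
    shift. *)
Lemma DSs_integrand_slice h Phi t eta p y k :
  DSs_integrand h Phi t eta (p + y *: delta_mx 0 (lift ord0 k)) =
  DSs_integrand h Phi t (eta + y%:C *: delta_mx 0 k) p.
Proof.
rewrite /DSs_integrand sliceSE consr0 row_tail_consr toC_slice.
by rewrite -!addrA ![_ *: _ + eta]addrC.
Qed.

Lemma DSs_integrand_slice0 h Phi t eta p y :
  DSs_integrand h Phi t eta (p + y *: delta_mx 0 ord0) =
  Phi (p 0 ord0 + y * 1, toC (row_tail p) + eta) * h ((dot u t - p 0 ord0) + y * (-1)) *
  cexp (twopii R * dot (toC (row_tail p) + eta) (toC t)).
Proof.
by rewrite /DSs_integrand slice0E consr0 row_tail_consr mulr1 mulrN1 opprD addrA.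
Qed.

Lemma hol_DSs_integrand h Phi t eta k p : adm Phi ->
  hol (fun w => DSs_integrand h Phi t (eta + w *: delta_mx 0 k) p).
Proof.
move=> aP; apply: holM; first (apply: holM; last exact: hol_cst).
  have := adm_z aP (p 0 ord0) (toC (row_tail p) + eta) k.
  by under eq_fun do rewrite -addrA.
rewrite (_ : (fun _ => _) = fun w =>
    cexp (twopii R * dot (toC (row_tail p) + eta) (toC t) + w * (twopii R * (t 0 k)%:C))).
  exact: hol_cexp.
apply/funext => w; congr cexp; rewrite addrA [in LHS]cdotDl [in LHS]mulrDr; congr (_ + _).
by rewrite cdotZ mxE mulrCA.
Qed.

Lemma csep_DSs_integrand l Phi t eta : adm Phi -> csep (DSs_integrand (hs l) Phi t eta).
Proof.
move=> aP p j; case: (unliftP ord0 j) => [k|] ->.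
  rewrite (_ : (fun y : R => _) = (fun y : R =>
      (fun w => DSs_integrand (hs l) Phi t (eta + w *: delta_mx 0 k) p) (0 + y%:C * 1))).
    exact: hol_ccont (hol_DSs_integrand (hs l) t eta k p aP).
  have E (y : C) : y = 0 + y * 1 by rewrite mulr1 add0r.
  by apply/funext => y; rewrite DSs_integrand_slice [in LHS](E y%:C).
under eq_fun do rewrite DSs_integrand_slice0.
apply: ccontM; last exact: ccont_cst.
apply: ccontM; last by apply: ccont_affine; exact: tower_ccont.
exact: (@ccont_affine _ (fun y => Phi (y, _))) (adm_x aP _).
Qed.

Definition imshift (s : R) j : 'rV[C]_n := (0 +i* s) *: delta_mx 0 j.

(** The gain of the contour shift: the modulus of the exponential is
    [exp(- 2 pi s t_j)]. *)
Lemma Re_twopii_dot (x t : 'rV[R]_n) s j :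
  complex.Re (twopii R * dot (toC x + imshift s j) (toC t)) = - (2 * pi * s * t 0 j).
Proof.
by rewrite cdotDl dot_toC cdotZ mxE !(ReM, ImM, ReD, ImD) /=; ring.
Qed.

Lemma strip_imshift k (x : 'rV[R]_n) s j : `|s| <= k%:R -> strip k (toC x + imshift s j).
Proof.
move=> sk i; rewrite !mxE eqxx /=; case: (i == j).
  by rewrite mulr1 ImD [complex.Im _%:C]/= add0r.
by rewrite mulr0 addr0 [complex.Im _]/= normr0.
Qed.

Lemma Re_imshift (x : 'rV[R]_n) s j i : complex.Re ((toC x + imshift s j) 0 i) = x 0 i.
Proof.
rewrite !mxE eqxx /=; case: (i == j).
  by rewrite mulr1 ReD [complex.Re (_ +i* _)]/= addr0.
by rewrite mulr0 addr0.
Qed.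

Lemma cwdom_DSs_integrand l k M Mh Phi (t : 'rV[R]_n) (s : R) j :
  adm Phi -> (2 * n < k)%N -> decay_le k M Phi ->
  (forall y, normc (hs l y) <= Mh) -> `|s| <= k%:R ->
  cwdom (2 * M * Mh * expR (- (2 * pi * s * t 0 j))) (DSs_integrand (hs l) Phi t (imshift s j)).
Proof.
move=> aP nk hM hMh sk p; rewrite /DSs_integrand !ComplexField.Normc.normcM normc_cexp.
rewrite Re_twopii_dot.
have := @decay_le_weight _ _ k M Phi (p 0 ord0) (toC (row_tail p) + imshift s j) (row_tail p) nk hM
  (strip_imshift _ _ sk) (Re_imshift _ _ _).
rewrite consr_row_tail => h.
rewrite [leRHS](_ : _ = 2 * M * weight p * Mh * expR (- (2 * pi * s * t 0 j))); last by ring.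
rewrite ler_wpM2r ?expR_ge0//.
by apply: ler_pM => //; rewrite normc_ge0.
Qed.

Lemma tower_sup l : exists2 Mh, 0 <= Mh & forall y, normc (hs l y) <= Mh.
Proof.
have [M M0 hM] := tower_bound th l 0; exists M => // y.
by have := hM y; rewrite mul0r expR0 mul1r.
Qed.

Lemma imshift0 j : imshift 0 j = 0.
Proof. by rewrite /imshift (_ : 0 +i* 0 = 0) ?scale0r. Qed.

(** Along each line in the variable [xi_j] the two integrals agree by the contour
    shift in one variable, so their difference vanishes over R^(n+1). *)
Lemma integral_DSstar_shift l k M Phi (t : 'rV[R]_n) (s : R) j :
  adm Phi -> (2 * n < k)%N -> decay_le k M Phi ->
  `|s| <= k%:R ->
  integralRn (DSs_integrand (hs l) Phi t (imshift s j)) =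
  integralRn (DSs_integrand (hs l) Phi t 0).
Proof.
move=> aP nk hM sk; have [Mh Mh0 hMh] := tower_sup l.
have M0 := decay_le_ge0 hM.
have cs eta : csep (DSs_integrand (hs l) Phi t eta) by exact: csep_DSs_integrand.
have s0 : `|0 : R| <= k%:R by rewrite normr0.
pose B := 2 * M * Mh * expR (2 * pi * k%:R * `|t 0 j|).
have dB y : `|y| <= k%:R -> cwdom B (DSs_integrand (hs l) Phi t (imshift y j)).
  move=> yk p; apply: le_trans (cwdom_DSs_integrand t j aP nk hM hMh yk p) _.
  apply: ler_wpM2r; first exact/ltW/weight_gt0.
  apply: ler_wpM2l; first by rewrite !mulr_ge0.
  rewrite ler_expR; apply: le_trans (ler_norm _) _.
  rewrite normrN !normrM ler_wpM2r// ger0_norm// ger0_norm ?pi_ge0//.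
  by rewrite ler_wpM2l// mulr_ge0// pi_ge0.
have ds := dB s sk; have d0 := dB 0 s0; rewrite imshift0 in d0.
have slice (p : 'rV[R]_n.+1) (f : R -> C) (y : R) : `|y| <= k%:R ->
    (forall x, f x = DSs_integrand (hs l) Phi t (imshift y j) (p + x *: delta_mx 0 (lift ord0 j))) ->
    [/\ ccont f,
     forall x, normc (f x) <= B * (2 * (1 + p 0 (lift ord0 j) ^+ 2)) * (1 + x ^+ 2)^-1,
     (forall x, `|ReF f x| <= B * (2 * (1 + p 0 (lift ord0 j) ^+ 2)) * (1 + x ^+ 2)^-1) &
     (forall x, `|ImF f x| <= B * (2 * (1 + p 0 (lift ord0 j) ^+ 2)) * (1 + x ^+ 2)^-1)].
  move=> yk fE.
  have fB x : normc (f x) <= B * (2 * (1 + p 0 (lift ord0 j) ^+ 2)) * (1 + x ^+ 2)^-1.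
    rewrite fE; apply: le_trans (dB y yk _) _; rewrite -mulrA.
    apply: ler_wpM2l; first exact: wdom_ge0 (cwdomRe (dB y yk)).
    exact: weight_slice_le.
  split=> [|//|x|x].
  - have -> : f = (fun x => DSs_integrand (hs l) Phi t (imshift y j) (p + x *: delta_mx 0 (lift ord0 j))).
      exact/funext.
    exact: cs.
  - exact: le_trans (Re_le_normc _) (fB x).
  - exact: le_trans (Im_le_normc _) (fB x).
have HE p x y : DSs_integrand (hs l) Phi t (imshift y j) (p + x *: delta_mx 0 (lift ord0 j)) =
    DSs_integrand (hs l) Phi t (0 + (x +i* y) *: delta_mx 0 j) p.
  have E : imshift y j + x%:C *: delta_mx 0 j = 0 + (x +i* y) *: delta_mx 0 j.
    rewrite /imshift -scalerDl add0r (_ : (0 +i* y) + x%:C = x +i* y)//.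
    by apply/eqP; rewrite eq_complex ReD ImD /= add0r addr0 !eqxx.
  by rewrite DSs_integrand_slice E.
have H0 p x : DSs_integrand (hs l) Phi t 0 (p + x *: delta_mx 0 (lift ord0 j)) =
    DSs_integrand (hs l) Phi t (0 + (x +i* 0) *: delta_mx 0 j) p.
  by rewrite -HE imshift0.
have hH p := hol_DSs_integrand (hs l) t 0 j p aP.
have HB p (x y : R) : `|y| <= k%:R ->
    normc (DSs_integrand (hs l) Phi t (0 + (x +i* y) *: delta_mx 0 j) p) <=
    B * (2 * (1 + p 0 (lift ord0 j) ^+ 2)) * (1 + x ^+ 2)^-1.
  move=> yk; have [_ + _ _] := slice p
    (fun x => DSs_integrand (hs l) Phi t (0 + (x +i* y) *: delta_mx 0 j) p)
    y yk (fun x => esym (HE p x y)).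
  exact.
apply/eqP; rewrite -subr_eq0 -(integralRnB (cs _) ds (cs _) d0) integralRnE.
have cB := csepB (cs (imshift s j)) (cs 0); have dBB := cwdomB ds d0.
have k0 : 0 <= k%:R :> R by [].
have -> : rint (ReF (fun p => DSs_integrand (hs l) Phi t (imshift s j) p -
    DSs_integrand (hs l) Phi t 0 p)) = 0.
  apply: (rint_slice0 (j := lift ord0 j) (csepRe cB) (cwdomRe dBB)) => p.
  have [c1 _ r1 _] := slice p _ s sk (fun x => esym (HE p x s)).
  have [c0 _ r0 _] := slice p _ 0 s0 (fun x => esym (HE p x 0)).
  transitivity (\int[leb]_x (ReF (fun x => DSs_integrand (hs l) Phi t (0 + (x +i* s) *: delta_mx 0 j) p) x -
     ReF (fun x => DSs_integrand (hs l) Phi t (0 + (x +i* 0) *: delta_mx 0 j) p) x)).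
    by apply: eq_Rintegral => x _; rewrite /ReF H0 HE ReD ReN.
  rewrite RintegralB//; last 2 first.
  - exact: integrable_sdom c1.1 r1.
  - exact: integrable_sdom c0.1 r0.
  by apply/eqP; rewrite subr_eq0; apply/eqP; exact: hol_shiftRe (hH p) k0 (HB p) _ sk.
have -> : rint (ImF (fun p => DSs_integrand (hs l) Phi t (imshift s j) p -
    DSs_integrand (hs l) Phi t 0 p)) = 0.
  apply: (rint_slice0 (j := lift ord0 j) (csepIm cB) (cwdomIm dBB)) => p.
  have [c1 _ _ r1] := slice p _ s sk (fun x => esym (HE p x s)).
  have [c0 _ _ r0] := slice p _ 0 s0 (fun x => esym (HE p x 0)).
  transitivity (\int[leb]_x (ImF (fun x => DSs_integrand (hs l) Phi t (0 + (x +i* s) *: delta_mx 0 j) p) x -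
     ImF (fun x => DSs_integrand (hs l) Phi t (0 + (x +i* 0) *: delta_mx 0 j) p) x)).
    by apply: eq_Rintegral => x _; rewrite /ImF H0 HE ImD ImN.
  rewrite RintegralB//; last 2 first.
  - exact: integrable_sdom c1.2 r1.
  - exact: integrable_sdom c0.2 r0.
  by apply/eqP; rewrite subr_eq0; apply/eqP; exact: hol_shiftIm (hH p) k0 (HB p) _ sk.
by [].
Qed.

(** Fubini, to pass from the iterated integral to one over R^(n+1). *)
Lemma DSstarE l Phi t : adm Phi ->
  DSstar (hs l) u Phi t = integralRn (DSs_integrand (hs l) Phi t 0).
Proof.
move=> aP; have [M hM] := adm_b aP (2 * n).+1; have [Mh Mh0 hMh] := tower_sup l.
have cs : csep (DSs_integrand (hs l) Phi t 0) by exact: csep_DSs_integrand.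
have E x xi : DSs_integrand (hs l) Phi t 0 (consr x xi) =
    Phi (x, toC xi) * hs l (dot u t - x) * cexp (twopii R * (dot xi t)%:C).
  by rewrite /DSs_integrand consr0 row_tail_consr addr0 dot_toC.
have [K cK] : exists K, cwdom K (DSs_integrand (hs l) Phi t 0).
  have j : 'I_n := Ordinal (enorm1_dim u1).
  exists (2 * M * Mh * expR (- (2 * pi * 0 * t 0 j))).
  rewrite -(imshift0 j); apply: (cwdom_DSs_integrand t j aP (ltnSn _) hM hMh).
  by rewrite normr0.
rewrite integralRnE (rint_consl (csepRe cs) (cwdomRe cK)) (rint_consl (csepIm cs) (cwdomIm cK)).
pose G xi x := Phi (x, toC xi) * hs l (dot u t - x) * cexp (twopii R * (dot xi t)%:C).
have -> : DSstar (hs l) u Phi t =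
    rint (fun xi => \int[leb]_x complex.Re (G xi x)) +i*
    rint (fun xi => \int[leb]_x complex.Im (G xi x)) by reflexivity.
have e1 : (fun xi => \int[leb]_x complex.Re (G xi x)) =
    (fun xi => \int[leb]_x ReF (DSs_integrand (hs l) Phi t 0) (consr x xi)).
  by apply/funext => xi; apply: eq_Rintegral => x _; rewrite /ReF E.
have e2 : (fun xi => \int[leb]_x complex.Im (G xi x)) =
    (fun xi => \int[leb]_x ImF (DSs_integrand (hs l) Phi t 0) (consr x xi)).
  by apply/funext => xi; apply: eq_Rintegral => x _; rewrite /ImF E.
by rewrite e1 e2.
Qed.

Lemma max_coord (t : 'rV[R]_n) : exists j, enorm t <= n%:R * `|t 0 j|.
Proof.
have j0 : 'I_n := Ordinal (enorm1_dim u1).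
have [j hj] : exists j, forall i, `|t 0 i| <= `|t 0 j|.
  have [j hj] : exists j, forall i, i \in enum 'I_n -> `|t 0 i| <= `|t 0 j|.
    elim: (enum 'I_n) => [|i s [j hj]]; first by exists j0.
    have [ij|/ltW ij] := leP `|t 0 i| `|t 0 j|.
      by exists j => k; rewrite inE => /predU1P[->//|/hj].
    exists i => k; rewrite inE => /predU1P[->//|/hj /le_trans]; exact.
  by exists j => i; apply: hj; rewrite mem_enum.
exists j; apply: le_trans (enorm_le_sum t) _.
rewrite (_ : n%:R * _ = \sum_(i < n) `|t 0 j|); last by rewrite sumr_const card_ord mulr_natl.
exact: ler_sum.
Qed.

(** For a coordinate [j] with [|t_j|] maximal one has [K |t| <= K n |t_j|], and the
    contour of [xi_j] is moved by [s = k sg(t_j)] with [k >= K n]; the remaining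
    [2 n + 1] units of [k] make the integral converge. *)
Lemma DSstar_decay l K : exists k Cst, 0 <= Cst /\
  forall Phi M, adm Phi -> decay_le k M Phi -> forall t,
  expR (K%:R * enorm t) * normc (DSstar (hs l) u Phi t) <= Cst * M.
Proof.
have [Mh Mh0 hMh] := tower_sup l; pose k := (K * n + (2 * n).+1)%N.
have nk : (2 * n < k)%N by rewrite /k addnS ltnS leq_addl.
exists k, (4 * Mh * pi ^+ n.+1); split; first by rewrite !mulr_ge0 ?exprn_ge0 ?pi_ge0.
move=> Phi M aP hM t; have [j hj] := max_coord t.
pose s : R := k%:R * Num.sg (t 0 j).
have sk : `|s| <= k%:R.
  rewrite normrM ger0_norm// ler_piMr// normr_sg; by case: (_ != 0).
have := le_integralRn (csep_DSs_integrand l t (imshift s j) aP)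
  (cwdom_DSs_integrand t j aP nk hM hMh sk).
rewrite (integral_DSstar_shift l t j aP nk hM sk) -DSstarE// => h.
have M0 := decay_le_ge0 hM.
apply: le_trans (ler_wpM2l (expR_ge0 _) h) _.
have Es : 2 * pi * s * t 0 j = 2 * pi * (k%:R * `|t 0 j|).
  by rewrite /s [X in _ = 2 * pi * (k%:R * X)]normrEsg; ring.
rewrite Es.
have e1 : expR (K%:R * enorm t) * expR (- (2 * pi * (k%:R * `|t 0 j|))) <= 1.
  rewrite -expRD expR_le1 subr_le0.
  apply: (@le_trans _ _ (k%:R * `|t 0 j|)).
    apply: (@le_trans _ _ ((K * n)%:R * `|t 0 j|)); last by rewrite ler_wpM2r// ler_nat leq_addr.
    by rewrite natrM -mulrA ler_wpM2l.
  rewrite ler_peMl ?mulr_ge0//; have := @pihalf_ge1 R; lra.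
rewrite [leLHS](_ : _ = (4 * Mh * pi ^+ n.+1 * M) *
   (expR (K%:R * enorm t) * expR (- (2 * pi * (k%:R * `|t 0 j|))))); last by ring.
by rewrite ler_piMr// !mulr_ge0 ?exprn_ge0 ?pi_ge0.
Qed.

End contour_shift.

(** * Smoothness from derivatives along lines *)

Section slices_to_smoothness.
Context {R : realType} {n : nat}.
Implicit Type f : 'rV[R]_n -> R.

Lemma slice_derivable f v j (D : R) :
  is_derive (0 : R) (1 : R) (fun y : R => f (v + y *: delta_mx 0 j)) D ->
  derivable f v (delta_mx 0 j) /\ partial j f v = D.
Proof.
move=> [d1 d2].
have E : (fun h : R => h^-1 *: (((fun y : R => f (v + y *: delta_mx 0 j)) \o shift 0) (h *: 1)
    - f (v + 0 *: delta_mx 0 j))) =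
    (fun h : R => h^-1 *: ((f \o shift v) (h *: delta_mx 0 j) - f v)).
  apply/funext => h /=; rewrite scale0r !addr0; congr (_ *: (f _ - _)).
  by rewrite [h *: 1]mulr1 addrC.
split; first by move: d1; rewrite /derivable E.
by move: d2; rewrite /derive E.
Qed.

(** Bounded partial derivatives make the function Lipschitz, changing one coordinate
    after the other and using the mean value theorem each time. *)
Lemma continuous_of_partials f K :
  (forall v j (s : R), exists2 D, `|D| <= K &
     is_derive s (1 : R) (fun y : R => f (v + y *: delta_mx 0 j)) D) ->
  continuous f.
Proof.
move=> h.
have step v j (s : R) : `|f (v + s *: delta_mx 0 j) - f v| <= K * `|s|.
  have /choice[df dfP] : forall y : R, exists D, `|D| <= K /\
      is_derive y (1 : R) (fun y : R => f (v + y *: delta_mx 0 j)) D.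
    by move=> y; have [D] := h v j y; exists D.
  have := @MVT_norm R (fun y : R => f (v + y *: delta_mx 0 j)) df K 0 s
    (fun x => (dfP x).2) (fun x _ => (dfP x).1).
  by rewrite scale0r addr0 subr0.
have lip (v w : 'rV[R]_n) : `|f (v + w) - f v| <= K * \sum_j `|w 0 j|.
  pose p (s : seq 'I_n) := v + \sum_(j <- s) w 0 j *: delta_mx 0 j.
  have hp s : `|f (p s) - f v| <= K * \sum_(j <- s) `|w 0 j|.
    elim: s => [|j s ih]; first by rewrite /p !big_nil addr0 subrr normr0 mulr0.
    have -> : p (j :: s) = p s + w 0 j *: delta_mx 0 j.
      by rewrite /p big_cons -addrA [_ + \sum_(_ <- _) _]addrC.
    rewrite big_cons mulrDr; apply: le_trans (ler_distD (f (p s)) _ _) _.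
    by apply: lerD; [exact: step|exact: ih].
  have := hp (index_enum 'I_n); rewrite /p.
  by rewrite -(row_sum_delta w).
move=> v; apply/(@cvgrPdist_le _ _ _ _ (nbhs_filter (v : 'rV[R]_n))) => e e0.
have nK : 0 < n%:R * `|K| + 1 by rewrite ltr_wpDl// mulr_ge0.
apply/nbhs_ballP; exists (e / (n%:R * `|K| + 1)) => /=; first by rewrite divr_gt0.
move=> w [_ hw]; rewrite distrC -[w](subrKC v).
apply: le_trans (lip _ _) _.
apply: (@le_trans _ _ (`|K| * (n%:R * (e / (n%:R * `|K| + 1))))).
  apply: le_trans (ler_wpM2r _ (ler_norm K)) _; first exact: sumr_ge0.
  apply: ler_wpM2l => //; rewrite (_ : n%:R * _ = \sum_(j < n) (e / (n%:R * `|K| + 1))); last first.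
    by rewrite sumr_const card_ord mulr_natl.
  apply: ler_sum => j _; rewrite !mxE; have := hw 0 j.
  by rewrite /ball /= distrC => /ltW.
rewrite [leLHS](_ : _ = e * (n%:R * `|K| / (n%:R * `|K| + 1))); last by ring.
apply: ler_piMr; first exact: ltW.
by rewrite ler_pdivrMr// mul1r lerDl.
Qed.

End slices_to_smoothness.

(** * The synthesis integral maps KU to K_1 *)

Section S_operator.
Context {R : realType} {n : nat} (u : 'rV[R]_n) (u1 : enorm u = 1).
Context (hs : nat -> R -> R[i]) (th : tower hs).
Notation C := R[i].
Implicit Type Phi : R * 'rV[C]_n -> C.

Lemma DSs_integrand_cwdom0 l Phi : adm Phi ->
  exists K, forall t, cwdom K (DSs_integrand u (hs l) Phi t 0).
Proof.
move=> aP; have [M hM] := adm_b aP (2 * n).+1; have [Mh Mh0 hMh] := tower_sup th l.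
have j : 'I_n := Ordinal (enorm1_dim u1).
exists (2 * M * Mh * expR (- (2 * pi * 0))) => t.
rewrite -(imshift0 j).
have := cwdom_DSs_integrand u t j aP (ltnSn _) hM hMh (s := 0).
by rewrite normr0 !mulr0 !mul0r; apply.
Qed.

(** [t_i] occurs in [h(u.t - x)] and in the phase, whose derivative is
    [2 pi i xi_i]. *)
Lemma DSstar_slice l Phi (t : 'rV[R]_n) i (s : R) : adm Phi ->
  cis_derive (fun y : R => DSstar (hs l) u Phi (t + y *: delta_mx 0 i)) s
    ((u 0 i)%:C * DSstar (hs l.+1) u Phi (t + s *: delta_mx 0 i) +
     twopii R * DSstar (hs l) u (mul_coord i Phi) (t + s *: delta_mx 0 i)).
Proof.
move=> aP; have aZ := adm_mul_coord i aP.
rewrite (_ : (fun y : R => _) = (fun y : R =>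
    integralRn (DSs_integrand u (hs l) Phi (t + y *: delta_mx 0 i) 0))); last first.
  by apply/funext => y; exact: DSstarE.
rewrite !DSstarE//.
have [K0 hK0] := DSs_integrand_cwdom0 l aP; have [K1 hK1] := DSs_integrand_cwdom0 l.+1 aP.
have [K2 hK2] := DSs_integrand_cwdom0 l aZ.
pose te (y : R) := t + y *: delta_mx 0 i.
have c1 y := csep_DSs_integrand u th l.+1 (te y) 0 aP.
have c2 y := csep_DSs_integrand u th l (te y) 0 aZ.
pose ui := (u 0 i)%:C.
have cc1 y := csepZ ui (c1 y); have cc2 y := csepZ (twopii R) (c2 y).
have w1 y := cwdomZ ui (hK1 (te y)); have w2 y := cwdomZ (twopii R) (hK2 (te y)).
rewrite -(integralRnZ ui (c1 s) (hK1 _)) -(integralRnZ (twopii R) (c2 s) (hK2 _)).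
rewrite -(integralRnD (cc1 s) (w1 s) (cc2 s) (w2 s)).
apply: (@cis_derive_integralRn R n.+1 K0 (normc ui * K1 + normc (twopii R) * K2)
  (fun y => DSs_integrand u (hs l) Phi (te y) 0)
  (fun y p => ui * DSs_integrand u (hs l.+1) Phi (te y) 0 p +
              twopii R * DSs_integrand u (hs l) (mul_coord i Phi) (te y) 0 p)).
- by move=> y; exact: csep_DSs_integrand.
- by move=> y; exact: hK0.
- by move=> y; exact: cwdomD.
move=> y p.
have Ed (x : R) : dot u (te x) - p 0 ord0 = (dot u t - p 0 ord0) + x * u 0 i.
  by rewrite dot_slice addrAC.
pose z := toC (row_tail p) + 0.
have Ec (x : R) : twopii R * dot z (toC (te x)) =
    twopii R * dot z (toC t) + x%:C * (twopii R * z 0 i).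
  have dotC (v w : 'rV[C]_n) : dot v w = dot w v.
    by apply: eq_bigr => k _; rewrite mulrC.
  by rewrite /te dotC cdot_slice -(dotC z) mulrDr [_ * (x%:C * _)]mulrCA.
have d1 : cis_derive (fun x => hs l (dot u (te x) - p 0 ord0)) y
    (ui * hs l.+1 (dot u (te y) - p 0 ord0)).
  under eq_fun do rewrite Ed.
  by rewrite Ed; apply: cis_derive_affine; exact: tower_derive.
have d2 : cis_derive (fun x => cexp (twopii R * dot z (toC (te x)))) y
    (twopii R * z 0 i * cexp (twopii R * dot z (toC (te y)))).
  under eq_fun do rewrite Ec.
  by rewrite Ec; exact: cis_derive_cexp.
apply: cis_derive_eq (cis_deriveM (cis_deriveZ (Phi (p 0 ord0, z)) d1) d2) _.
rewrite /DSs_integrand /mul_coord -/z /=; ring.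
Qed.

(** The operators on functions [Phi] obtained from synthesis maps by multiplying
    [Phi] with coordinates, by replacing the window by its derivatives and by
    taking linear combinations.  They are described as operators, not as functions
    of [t], so that the bounds are uniform in [Phi]. *)
Inductive synth_ops : ((R * 'rV[C]_n -> C) -> 'rV[R]_n -> C) -> Prop :=
| synth_ops_base l (s : seq 'I_n) :
    synth_ops (fun Phi => DSstar (hs l) u (foldr (@mul_coord R n) Phi s))
| synth_ops_scale c T : synth_ops T -> synth_ops (fun Phi t => c * T Phi t)
| synth_ops_add T1 T2 : synth_ops T1 -> synth_ops T2 ->
    synth_ops (fun Phi t => T1 Phi t + T2 Phi t).

Lemma adm_mul_coords s Phi : adm Phi -> adm (foldr (@mul_coord R n) Phi s).
Proof. by move=> aP; elim: s => //= i s ih; exact: adm_mul_coord. Qed.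

Lemma decay_le_mul_coords s k M Phi : decay_le (k + size s) M Phi ->
  decay_le k M (foldr (@mul_coord R n) Phi s).
Proof.
elim: s k => [|i s ih] k /=; first by rewrite addn0.
by rewrite addnS => h; apply: decay_le_mul_coord; apply: ih; rewrite addSn.
Qed.

Lemma synth_ops_derive T i : synth_ops T -> exists2 T', synth_ops T' & forall Phi, adm Phi ->
  forall t (s : R), cis_derive (fun y : R => T Phi (t + y *: delta_mx 0 i)) s
    (T' Phi (t + s *: delta_mx 0 i)).
Proof.
elim=> {T} [l s|c T _ [T' oT' hT']|T1 T2 _ [T1' o1 h1] _ [T2' o2 h2]].
- exists (fun Phi t => (u 0 i)%:C * DSstar (hs l.+1) u (foldr (@mul_coord R n) Phi s) t +
     twopii R * DSstar (hs l) u (foldr (@mul_coord R n) Phi (i :: s)) t).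
    apply: synth_ops_add; first exact: synth_ops_scale (synth_ops_base _ _).
    exact: synth_ops_scale (synth_ops_base _ _).
  move=> Phi aP t y; apply: DSstar_slice; exact: adm_mul_coords.
- exists (fun Phi t => c * T' Phi t); first exact: synth_ops_scale.
  by move=> Phi aP t y; apply: cis_deriveZ; exact: hT'.
- exists (fun Phi t => T1' Phi t + T2' Phi t); first exact: synth_ops_add.
  by move=> Phi aP t y; apply: cis_deriveD; [exact: h1|exact: h2].
Qed.

Lemma synth_ops_bound T : synth_ops T -> forall K, exists k Cst, 0 <= Cst /\
  forall Phi M, adm Phi -> decay_le k M Phi -> forall t,
  expR (K%:R * enorm t) * normc (T Phi t) <= Cst * M.
Proof.
elim=> {T} [l s|c T _ ih|T1 T2 _ ih1 _ ih2] K.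
- have [k [Cst [C0 h]]] := DSstar_decay u1 th l K.
  exists (k + size s)%N, Cst; split => // Phi M aP hM t.
  by apply: h; [exact: adm_mul_coords|exact: decay_le_mul_coords].
- have [k [Cst [C0 h]]] := ih K; exists k, (normc c * Cst).
  split; first by rewrite mulr_ge0// normc_ge0.
  move=> Phi M aP hM t; rewrite ComplexField.Normc.normcM mulrCA -[leRHS]mulrA.
  by apply: ler_wpM2l; [exact: normc_ge0|exact: h].
- have [k1 [C1 [C10 h1]]] := ih1 K; have [k2 [C2 [C20 h2]]] := ih2 K.
  exists (maxn k1 k2), (C1 + C2); split; first exact: addr_ge0.
  move=> Phi M aP hM t.
  have {}h1 := h1 Phi M aP (decay_le_mono (leq_maxl _ _) hM) t.
  have {}h2 := h2 Phi M aP (decay_le_mono (leq_maxr _ _) hM) t.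
  rewrite mulrDl; apply: le_trans (lerD h1 h2); rewrite -mulrDr.
  by rewrite ler_wpM2l ?expR_ge0// normcD.
Qed.

Lemma synth_ops_sup T Phi : synth_ops T -> adm Phi -> exists K, forall t, normc (T Phi t) <= K.
Proof.
move=> oT aP; have [k [Cst [C0 h]]] := synth_ops_bound oT 0.
have [M hM] := adm_b aP k; exists (Cst * M) => t.
by have := h Phi M aP hM t; rewrite mul0r expR0 mul1r.
Qed.

Lemma synth_ops_partial T i : synth_ops T -> exists2 T', synth_ops T' & forall Phi, adm Phi ->
  [/\ forall t, derivable (ReF (T Phi)) t (delta_mx 0 i),
      forall t, derivable (ImF (T Phi)) t (delta_mx 0 i),
      partial i (ReF (T Phi)) = ReF (T' Phi) &
      partial i (ImF (T Phi)) = ImF (T' Phi)].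
Proof.
move=> /(synth_ops_derive i)[T' oT' h]; exists T' => // Phi aP.
have D t := h Phi aP t 0.
have DR t : derivable (ReF (T Phi)) t (delta_mx 0 i) /\
    partial i (ReF (T Phi)) t = ReF (T' Phi) t.
  by apply: slice_derivable; have [+ _] := D t; rewrite scale0r addr0.
have DI t : derivable (ImF (T Phi)) t (delta_mx 0 i) /\
    partial i (ImF (T Phi)) t = ImF (T' Phi) t.
  by apply: slice_derivable; have [_ +] := D t; rewrite scale0r addr0.
split.
- by move=> t; case: (DR t).
- by move=> t; case: (DI t).
- by apply/funext => t; case: (DR t).
- by apply/funext => t; case: (DI t).
Qed.

(** All partial derivatives belong to the class, hence are bounded. *)
Lemma synth_ops_continuous T Phi : synth_ops T -> adm Phi ->
  continuous (ReF (T Phi)) /\ continuous (ImF (T Phi)).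
Proof.
move=> oT aP.
have [K hK] : exists K, forall v j (s : R), exists2 D, normc D <= K &
    cis_derive (fun y : R => T Phi (v + y *: delta_mx 0 j)) s D.
  have h j : exists K, forall v (s : R), exists2 D, normc D <= K &
      cis_derive (fun y : R => T Phi (v + y *: delta_mx 0 j)) s D.
    have [T' oT' h] := synth_ops_derive j oT; have [K hK] := synth_ops_sup oT' aP.
    by exists K => v s; exists (T' Phi (v + s *: delta_mx 0 j)) => //; exact: h.
  have [Kf hKf] := choice h; exists (\sum_j `|Kf j|) => v j s.
  have [D hD dD] := hKf j v s; exists D => //; apply: le_trans hD _.
  apply: le_trans (ler_norm _) _; rewrite (bigD1 j)//= lerDl.
  exact: sumr_ge0.
split; apply: (@continuous_of_partials R n _ K) => v j s;
    have [D hD [d1 d2]] := hK v j s.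
  by exists (complex.Re D) => //; exact: le_trans (Re_le_normc _) hD.
by exists (complex.Im D) => //; exact: le_trans (Im_le_normc _) hD.
Qed.

Lemma synth_ops_cCinfty T Phi : synth_ops T -> adm Phi -> cCinfty (T Phi).
Proof.
move=> oT aP; suff h k : forall T, synth_ops T -> Ck k (ReF (T Phi)) /\ Ck k (ImF (T Phi)).
  by split => k; have [] := h k T oT.
elim: k => [|k ih] {}T {}oT; have [c1 c2] := synth_ops_continuous oT aP => //=.
split; split => // i; have [T' oT' /(_ Phi aP)[d1 d2 e1 e2]] := synth_ops_partial i oT.
  by split => //; rewrite e1; have [] := ih T' oT'.
by split => //; rewrite e2; have [] := ih T' oT'.
Qed.

Lemma synth_ops_multi_partial T (al : {ffun 'I_n -> nat}) : synth_ops T ->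
  exists2 T', synth_ops T' & forall Phi, adm Phi -> cmulti_partial al (T Phi) = T' Phi.
Proof.
move=> oT; rewrite /cmulti_partial /multi_partial.
have [T' oT' h] : exists2 T', synth_ops T' & forall Phi, adm Phi ->
    foldr (fun i => iter (al i) (partial i)) (ReF (T Phi)) (enum 'I_n) = ReF (T' Phi) /\
    foldr (fun i => iter (al i) (partial i)) (ImF (T Phi)) (enum 'I_n) = ImF (T' Phi).
  elim: (enum 'I_n) => [|i s [T1 o1 h1]] /=; first by exists T.
  elim: (al i) => [|m [T2 o2 h2]] /=; first by exists T1.
  have [T3 o3 h3] := synth_ops_partial i o2; exists T3 => // Phi aP.
  by have [-> ->] := h2 Phi aP; have [_ _ -> ->] := h3 Phi aP.
exists T' => // Phi aP; have [-> ->] := h Phi aP.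
by apply/funext => t; rewrite /ReF /ImF; case: (T' Phi t).
Qed.

(** There are finitely many [al] of total order at most [K]; they are indexed by
    functions to ['I_K.+1] to combine their constants. *)
Lemma DSstar_rho K : exists k Cst, 0 <= Cst /\
  forall Phi M, adm Phi -> decay_le k M Phi -> rho_le K (Cst * M) (DSstar (hs 0) u Phi).
Proof.
have h (a : {ffun 'I_n -> 'I_K.+1}) : exists k Cst, 0 <= Cst /\
    forall Phi M, adm Phi -> decay_le k M Phi -> forall t,
    expR (K%:R * enorm t) *
      normc (cmulti_partial [ffun i => nat_of_ord (a i)] (DSstar (hs 0) u Phi) t) <=
    Cst * M.
  have [T oT hT] := synth_ops_multi_partial [ffun i => nat_of_ord (a i)] (synth_ops_base 0 [::]).
  have [k [Cst [C0 hC]]] := synth_ops_bound oT K; exists k, Cst; split => // Phi M aP hM t.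
  by rewrite (hT Phi aP); exact: hC.
have [kf] := choice h => /choice[Cf] hf.
exists (\max_a kf a), (\sum_a Cf a); split.
  by apply: sumr_ge0 => a _; have [] := hf a.
move=> Phi M aP hM t al alK.
have aiK i : (al i < K.+1)%N.
  by rewrite ltnS (leq_trans _ alK)// (bigD1 i)//= leq_addr.
pose a : {ffun 'I_n -> 'I_K.+1} := [ffun i => Ordinal (aiK i)].
have -> : al = [ffun i => nat_of_ord (a i)] by apply/ffunP => i; rewrite !ffunE.
have [C0 hC] := hf a.
apply: le_trans (hC Phi M aP (decay_le_mono (leq_bigmax a) hM) t) _.
rewrite ler_wpM2r ?(decay_le_ge0 hM)// (bigD1 a)//= lerDl.
by apply: sumr_ge0 => b _; have [] := hf b.
Qed.

Lemma DSstar_in_K1 Phi : adm Phi -> DSstar (hs 0) u Phi \in @K1_pred R n.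
Proof.
move=> aP; rewrite inE; split; first exact: (synth_ops_cCinfty (synth_ops_base 0 [::])).
move=> K; have [k [Cst [C0 h]]] := DSstar_rho K; have [M hM] := adm_b aP k.
apply: le_lt_trans (ltry (Cst * M)).
by apply/rho_leP; exact: h.
Qed.

Lemma DSstarL l a Phi Psi t : adm Phi -> adm Psi ->
  adm (fun xz => a * Phi xz + Psi xz) ->
  DSstar (hs l) u (fun xz => a * Phi xz + Psi xz) t =
  a * DSstar (hs l) u Phi t + DSstar (hs l) u Psi t.
Proof.
move=> aP aQ aL; rewrite !DSstarE//.
have [K hK] := DSs_integrand_cwdom0 l aP; have [K' hK'] := DSs_integrand_cwdom0 l aQ.
have c1 := csep_DSs_integrand u th l t 0 aP; have c2 := csep_DSs_integrand u th l t 0 aQ.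
have ca := csepZ a c1; have wa := cwdomZ a (hK t).
rewrite -(integralRnZ a c1 (hK t)) -(integralRnD ca wa c2 (hK' t)).
by apply: eq_integralRn => p; rewrite /DSs_integrand; ring.
Qed.

End S_operator.

(** * Transposes and strong topologies *)

Section transposes.
Context {K : numFieldType} {E F : preTopologicalLmodType K}.
Context (T : E -> F) (Tl : linear T) (cT : continuous T).

Lemma linear_at0 : T 0 = 0.
Proof. by have := Tl (-1) 0 0; rewrite scaler0 addr0 scaleN1r addNr. Qed.

Lemma linear_atZ c x : T (c *: x) = c *: T x.
Proof. by have := Tl c x 0; rewrite !addr0 linear_at0 addr0. Qed.

Lemma vN_bounded_image B : vN_bounded B -> vN_bounded [set T x | x in B].
Proof.
move=> bB U U0.
have V0 : nbhs (0 : E) (T @^-1` U) by apply: cT; rewrite linear_at0.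
have [r r0 hr] := bB _ V0; exists r => // c rc _ [x Bx <-].
have [y Uy <-] := hr c rc x Bx; exists (T y) => //.
by rewrite linear_atZ.
Qed.

Lemma transpose_subproof (f : dual F) : (f \o T : E -> K^o) \in @continuous_scalar K E.
Proof.
have := dual_funP f; rewrite !inE => -[lf cf]; split.
  by move=> a x y /=; rewrite Tl lf.
by move=> x; apply: continuous_comp; [exact: cT|exact: cf].
Qed.

Definition transpose (f : dual F) : dual E := Dual (transpose_subproof f).

Lemma transpose_linear : linear transpose.
Proof. by move=> a f g; apply: val_inj; apply/funext => x. Qed.

HB.instance Definition _ := GRing.isLinear.Build K (dual F) (dual E) _ transpose transpose_linear.

(** A basic neighbourhood of [transpose f] consists of the functionals close to it
    uniformly on a bounded set [A]; the transposes of the functionals close to [f]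
    uniformly on the bounded set [T A] lie in it. *)
Lemma transpose_continuous : continuous transpose.
Proof.
apply: continuous_comp_initial => f.
apply/(fam_cvgP _ _ (fmap_filter _ (nbhs_filter (f : dual F)))) => A bA P.
move=> /uniform_nbhs[W [entW WP]].
have h : nbhs ((f : F -> K^o) : {family @vN_bounded K F, F -> K^o})
    [set g | forall y, [set T x | x in A] y -> W (f y, g y)].
  by apply: fam_nbhs => //; exact: vN_bounded_image.
have h2 := @initial_continuous (dual F) {family @vN_bounded K F, F -> K^o}
  (fun f : dual F => (f : F -> K^o)) f _ h.
apply: (@filterS _ (nbhs (f : dual F)) _ _ _ _ h2) => g hg.
by apply: WP => y Ay; apply: hg; exists y.
Qed.

End transposes.

(** * Continuity from seminorm estimates *)

Section seminorm_continuity.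
Context {R : realType} {E F : zmodType} {I J : eqType}.
Context (p : I -> E -> \bar R) (q : J -> F -> \bar R).

(** The estimates are stated as implications between upper bounds because the
    seminorms take values in the extended reals. *)
Lemma seminorm_open_preimage (T : E -> F) U :
  (forall x y, T (x - y) = T x - T y) ->
  (forall j, exists i C, 0 <= C /\ forall x (N : R), (p i x <= N%:E)%E ->
     (q j (T x) <= (C * N)%:E)%E) ->
  (forall i x, (0 <= p i x)%E) ->
  seminorm_open q U -> seminorm_open p (T @^-1` U).
Proof.
move=> TB pq p0 oU x Ux; have [s [e [e0 seU]]] := oU _ Ux.
suff [t [d [d0 hd]]] : exists (t : seq I) (d : R), 0 < d /\ forall y,
    (forall i, i \in t -> (p i y < d%:E)%E) ->
    forall j, j \in s -> (q j (T y) < e%:E)%E.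
  exists t, d; split=> // y hy; apply: seU => j js.
  by rewrite -TB; exact: hd.
elim: s {seU} => [|j s [t [d [d0 h]]]]; first by exists [::], 1; split.
have [i [C [C0 hC]]] := pq j.
have C1 : 0 < C + 1 by rewrite ltr_wpDl.
exists (i :: t), (Num.min d (e / (C + 1))); split; first by rewrite lt_min d0 divr_gt0.
move=> y hy k; rewrite inE => /predU1P[->|ks].
  have := hy i (mem_head _ _) => pi.
  have fp : (p i y \is a fin_num)%E.
    by rewrite ge0_fin_numE// (lt_le_trans pi)// leey.
  move: pi; rewrite -(fineK fp) lte_fin lt_min => /andP[_].
  have P0 : 0 <= fine (p i y) by rewrite fine_ge0.
  rewrite ltr_pdivlMr// mulrDr mulr1 => pe.
  apply: le_lt_trans (hC y (fine (p i y)) _) _; first by rewrite fineK.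
  rewrite lte_fin; apply: le_lt_trans pe; rewrite mulrC lerDl//.
apply: h ks => i' it; apply: lt_le_trans (hy i' _) _; first by rewrite inE it orbT.
by rewrite lee_fin ge_min lexx.
Qed.

End seminorm_continuity.

(** * The analysis and synthesis operators *)

Section operators.
Context {R : realType} {n : nat} (u : 'rV[R]_n) (u1 : enorm u = 1).
Context (hs : nat -> R -> R[i]) (th : tower hs).
Notation C := R[i].

Lemma dstftL l a (phi psi : 'rV[R]_n -> C) x z : testfun phi -> testfun psi ->
  dstft (hs l) u (a *: phi + psi) x z =
  a * dstft (hs l) u phi x z + dstft (hs l) u psi x z.
Proof.
move=> tp tq.
have [K hK] := cwdom_DS_integrand_unif u1 th l z tp.
have [K' hK'] := cwdom_DS_integrand_unif u1 th l z tq.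
have c1 := csep_DS_integrand u x z (tower_ccont l th) (testfun_csep tp).
have c2 := csep_DS_integrand u x z (tower_ccont l th) (testfun_csep tq).
have ca := csepZ a c1; have wa := cwdomZ a (hK x).
rewrite /dstft -(integralRnZ a c1 (hK x)) -(integralRnD ca wa c2 (hK' x)).
apply: eq_integralRn => p; rewrite /DS_integrand.
rewrite (_ : (a *: phi + psi) p = a * phi p + psi p)//; ring.
Qed.

Lemma K1_testfun (phi : 'rV[R]_n -> C) : phi \in @K1_pred R n -> testfun phi.
Proof.
by move=> pK; rewrite -(dpow0 (Ordinal (enorm1_dim u1)) phi); exact: testfun_dpow.
Qed.

Definition analysis (phi : K1 R n) : KU R n := MkKU (dstft_in_KU u1 th (K1_funP phi)).

Definition synthesis (Phi : KU R n) : K1 R n :=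
  MkK1 (DSstar_in_K1 u1 th (KU_adm (KU_funP Phi))).

Lemma analysis_linear : linear analysis.
Proof.
move=> a phi psi; apply: val_inj; apply/funext => -[x z] /=.
apply: dstftL; exact/K1_testfun/K1_funP.
Qed.

Lemma synthesis_linear : linear synthesis.
Proof.
move=> a Phi Psi; apply: val_inj; apply/funext => t /=.
have := KU_adm (KU_funP (a *: Phi + Psi)).
by apply: (DSstarL u1 th); exact/KU_adm/KU_funP.
Qed.

Lemma rho_ge0 k (phi : 'rV[R]_n -> C) : (0 <= rho k phi)%E.
Proof.
apply: (@le_trans _ _ (expR (k%:R * enorm (0 : 'rV[R]_n)) *
  normc (cmulti_partial [ffun=> 0%N] phi 0))%:E).
  by rewrite lee_fin mulr_ge0 ?expR_ge0 ?normc_ge0.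
apply: ereal_sup_ubound; exists (0, [ffun=> 0%N]) => //=.
by rewrite big1// => i _; rewrite ffunE.
Qed.

Lemma rhoU_ge0 kl (Phi : R * 'rV[C]_n -> C) : (0 <= rhoU kl Phi)%E.
Proof.
apply: le_trans (le_rhoU Phi 0 (strip0 kl.1)).
by rewrite lee_fin !mulr_ge0 ?expR_ge0 ?powR_ge0 ?normc_ge0.
Qed.

Lemma analysis_continuous : continuous analysis.
Proof.
apply/continuousP => U oU.
apply: (@seminorm_open_preimage R (K1 R n) (KU R n) nat (nat * nat)%type
  (@K1_norm R n) (@KU_norm R n) analysis U) => //.
- move=> x y; have := analysis_linear (-1) y x.
  by rewrite !scaleN1r [- y + x]addrC => ->; rewrite addrC.
- move=> [k l]; have [K [Cst [C0 h]]] := dstft_KU_bound u1 th k l (enorm1_dim u1).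
  exists K, Cst; split=> // phi N /rho_leP hN.
  apply: ge_ereal_sup => _ [[x z] /= kz <-]; rewrite lee_fin.
  rewrite [X in _ * X](_ : _ = normc (dstft (hs l) u phi x z)).
    by apply: h => //; exact: K1_funP.
  by apply: normc_cderive1n_dstft => //; exact/K1_testfun/K1_funP.
- by move=> k phi; exact: rho_ge0.
Qed.

Lemma synthesis_continuous : continuous synthesis.
Proof.
apply/continuousP => U oU.
apply: (@seminorm_open_preimage R (KU R n) (K1 R n) (nat * nat)%type nat
  (@KU_norm R n) (@K1_norm R n) synthesis U) => //.
- move=> x y; have := synthesis_linear (-1) y x.
  by rewrite !scaleN1r [- y + x]addrC => ->; rewrite addrC.
- move=> K; have [k [Cst [C0 h]]] := DSstar_rho u1 th K.
  exists (k, 0%N), Cst; split=> // Phi N hN; apply/rho_leP.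
  apply: h; first exact/KU_adm/KU_funP.
  exact: rhoU_decay_le.
- by move=> k phi; exact: rhoU_ge0.
Qed.

End operators.

Theorem proposition3p3 (R : realType) (n : nat) (u : 'rV[R]_n) (g : R -> R[i])
    (hu : unit_sphere u) (hg : g \in @K1_line R) :
  (exists (S : KU R n -> K1 R n)
      (A : {linear dual (K1 R n) -> dual (KU R n)}),
    [/\ forall Phi : KU R n, S Phi = DSstar (conjc \o g) u Phi :> (_ -> _),
        forall (f : dual (K1 R n)) (Phi : KU R n), A f Phi = f (S Phi) &
        continuous A]) /\
  (exists (D : K1 R n -> KU R n)
      (B : {linear dual (KU R n) -> dual (K1 R n)}),
    [/\ forall phi : K1 R n, D phi = DS (conjc \o g) u phi :> (_ -> _),
        forall (F : dual (KU R n)) (phi : K1 R n), B F phi = F (D phi) &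
        continuous B]).
Proof.
have u1 : enorm u = 1 by exact: hu.
have [hs th hs0] := K1_line_tower hg; have thc := tower_conj th.
split.
  exists (synthesis u1 thc), (transpose (@synthesis_linear R n u u1 _ thc)
    (@synthesis_continuous R n u u1 _ thc)).
  split=> [Phi|f Phi|]; last exact: transpose_continuous.
    by rewrite -hs0.
  reflexivity.
exists (analysis u1 th), (transpose (@analysis_linear R n u u1 _ th)
  (@analysis_continuous R n u u1 _ th)).
split=> [phi|F phi|]; last exact: transpose_continuous.
  apply/funext => xz; apply: eq_integralRn => t.
  by rewrite /DS_integrand hs0 /= conjcK.
reflexivity.
Qed.
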